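(* Let $k\ge 8$ be an integer and let $f(v)=\min\{d(v),k\}$ for all $v\in V(G)$. If $G$ is a $K_5$-minor-free graph with $d(S_k)\ge 3$ such that no connected component of $G$ is a Gallai tree, then $G$ is $f$-list colorable.
   Context: For a graph $G$, $d(v)$ denotes the degree of $v$. For an integer $k$, $S_k=\{v\in V(G): d(v)<k\}$, and $d(S_k)$ denotes the smallest distance in $G$ between two distinct connected components of the induced subgraph $G[S_k]$ (taken as $+\infty$ for components in different components of $G$); if $G[S_k]$ has at most one component, $d(S_k)=0$. A Gallai tree is a graph in which every block is a complete graph or an odd cycle. A list assignment $L$ assigns a set $L(v)$ of colors to each vertex; $G$ is $L$-colorable if there is a proper coloring $\varphi$ with $\varphi(v)\in L(v)$ for all $v$. For $f:V(G)\to\mathbb{N}$, $G$ is $f$-list colorable if it is $L$-colorable for every list assignment $L$ with $|L(v)|=f(v)$ for all $v$. A graph is $K_5$-minor-free if it has no minor isomorphic to $K_5$. *)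

(* Defs.v *)
From HB Require Import structures.
From mathcomp Require Import all_boot.
Set Implicit Arguments.
Unset Strict Implicit.
Unset Printing Implicit Defensive.

(** Extended natural numbers: [None] stands for [+oo]. *)
Definition enat := option nat.

Definition ele (a b : enat) : bool :=
  match a, b with
  | _, None => true
  | None, Some _ => false
  | Some m, Some n => m <= n
  end.

Definition emin (a b : enat) : enat :=
  match a, b with
  | None, _ => b
  | _, None => a
  | Some m, Some n => Some (minn m n)
  end.

Fact eminA : associative emin.
Proof. by case=> [a|] [b|] [c|] //=; rewrite minnA. Qed.

Fact eminC : commutative emin.
Proof. by case=> [a|] [b|] //=; rewrite minnC. Qed.

Fact emin0 : left_id None emin.
Proof. by []. Qed.

HB.instance Definition _ :=
  Monoid.isComLaw.Build enat None emin eminA eminC emin0.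

(** Finite simple graphs *)
Record sgraph := SGraph {
  vertex :> finType;
  adj : rel vertex;
  adj_sym : symmetric adj;
  adj_irrefl : irreflexive adj }.

Definition deg (G : sgraph) (v : G) : nat := #|[set u | adj v u]|.

Section Induced.
Variables (G : sgraph) (S : {set G}).

Definition induced_adj : rel {x : G | x \in S} :=
  [rel x y | adj (val x) (val y)].

Fact induced_sym : symmetric induced_adj.
Proof. by move=> x y; exact: adj_sym. Qed.

Fact induced_irrefl : irreflexive induced_adj.
Proof. by move=> x; exact: adj_irrefl. Qed.

Definition induced : sgraph := SGraph induced_sym induced_irrefl.

End Induced.

Section CompleteGraph.
Variable n : nat.

Definition complete_adj : rel 'I_n := [rel x y | x != y].

Fact complete_sym : symmetric complete_adj.
Proof. by move=> x y; rewrite /complete_adj /= eq_sym. Qed.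

Fact complete_irrefl : irreflexive complete_adj.
Proof. by move=> x; rewrite /complete_adj /= eqxx. Qed.

Definition complete_graph : sgraph := SGraph complete_sym complete_irrefl.

End CompleteGraph.

(** Vertex sets of the connected components; the components themselves are the
    graphs [induced C] for [C \in components G]. *)
Definition components (G : sgraph) : {set {set G}} :=
  equivalence_partition (connect (@adj G)) [set: G].

(** The null graph is not connected. *)
Definition connected (G : sgraph) : bool := #|components G| == 1.

Definition cut_vertex (G : sgraph) (v : G) : bool :=
  #|components G| < #|components (induced (~: [set v]))|.

(** A block is a maximal connected subgraph without a cut vertex of its own.
    Adding edges on the same vertex set preserves both conditions, so blocks
    are induced subgraphs and are given by their vertex sets.  Bridges (K_2)
    and isolated vertices (K_1) count as blocks. *)
Definition nonseparable (G : sgraph) : bool :=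
  connected G && [forall v : G, ~~ cut_vertex v].

Definition block (G : sgraph) (B : {set G}) : bool :=
  maxset (fun A : {set G} => nonseparable (induced A)) B.

Definition is_complete (G : sgraph) : Prop :=
  forall x y : G, adj x y = (x != y).

(** [s] lists the vertices in cyclic order. *)
Definition is_odd_cycle (G : sgraph) : Prop :=
  exists s : seq G,
    [/\ uniq s, s =i G, 3 <= size s, odd (size s) &
        forall x y : G, adj x y = (y == next s x) || (x == next s y)].

Definition gallai_tree (G : sgraph) : Prop :=
  forall B : {set G}, block B ->
    is_complete (induced B) \/ is_odd_cycle (induced B).

(** [H] is a minor of [G]: there are pairwise disjoint connected (in particular
    nonempty) branch sets in [G], one for each vertex of [H], with an edge of
    [G] between the branch sets of any two adjacent vertices of [H]. *)
Definition minor (G H : sgraph) : Prop :=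
  exists phi : H -> {set G},
    [/\ forall x, connected (induced (phi x)),
        forall x y, x != y -> [disjoint phi x & phi y] &
        forall x y, adj x y ->
          exists u v, [/\ u \in phi x, v \in phi y & adj u v]].

Definition K5_minor_free (G : sgraph) : Prop := ~ minor G (complete_graph 5).

(** Length of a shortest walk from [x] to [y], [None] if there is none; a
    shortest walk has fewer than [#|G|] edges. *)
Definition dist (G : sgraph) (x y : G) : enat :=
  \big[emin/None]_(n < #|G| |
     [exists p : n.-tuple G, path (@adj G) x p && (last x p == y)])
    Some (n : nat).

Definition set_dist (G : sgraph) (A B : {set G}) : enat :=
  \big[emin/None]_(x in A) \big[emin/None]_(y in B) dist x y.

(** The components of [G[S]], as subsets of [G]; distances between them are
    taken in [G]. *)
Definition components_in (G : sgraph) (S : {set G}) : {set {set G}} :=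
  [set val @: C | C : {set induced S} in components (induced S)].

Definition comp_dist (G : sgraph) (S : {set G}) : enat :=
  if #|components_in S| <= 1 then Some 0 else
  \big[emin/None]_(A in components_in S)
    \big[emin/None]_(B in components_in S | A != B) set_dist A B.

Definition small_vertices (G : sgraph) (k : nat) : {set G} :=
  [set v | deg v < k].

(** Lists are finite and so is [G], so only finitely many colours occur and a
    finite type of colours, arbitrary otherwise, is no restriction. *)
Definition list_colorable (G : sgraph) (C : finType) (L : G -> {set C}) : Prop :=
  exists phi : G -> C,
    (forall v, phi v \in L v) /\ (forall u v, adj u v -> phi u != phi v).

Definition f_list_colorable (G : sgraph) (f : G -> nat) : Prop :=
  forall (C : finType) (L : G -> {set C}),
    (forall v, #|L v| = f v) -> list_colorable L.

(* Main.v *)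
Require Import Defs.
From mathcomp Require Import all_boot.
From mathcomp Require Import perm zify.
From Stdlib Require Import Classical.
Set Implicit Arguments.
Unset Strict Implicit.
Unset Printing Implicit Defensive.

(** Two colouring theorems are combined.

    (1) K5-minor-free graphs are 5-choosable.  This is Thomassen's argument with
    the outer face replaced by the neighbourhood of a root [r]: the neighbours of
    [r] have lists of size 3, except for a precoloured clique of at most two of
    them, and all other vertices have lists of size 5; then the graph without [r]
    is colourable.  Small separators containing [r] are split off by contracting
    one side; without them every neighbour of [r] has at most two neighbours in
    N(r), as otherwise rooted triangles give a K5, and contracting a suitable
    neighbour into [r] plays the role of deleting a vertex of the outer cycle.

    (2) For every component [D] of G[S_k] that has outer neighbours one can
    forbid, in advance, at most k - 5 colours at each outer neighbour so that every
    colouring of the rest extends to [D].  If nothing cheaper works then [D] has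
    an end block K4; three colours forbidden around it either make it
    extendable or reduce the problem to [D] without that block.

    As the components are at distance at least 3, every vertex outside of S_k is
    adjacent to at most one of them, so it keeps 5 colours and (1) applies.
    Components without outer neighbours are not Gallai trees, and their lists have
    the size of the degrees. *)

(** The constant 8 comes from end blocks K4. A vertex outside [S_k] has k colours and must keep 5,
    so k - 5 may be forbidden at it. To give a vertex of a small component a surplus, it is enough
    to forbid at its outer neighbours one colour more than it has neighbours in the component.
    Complete blocks have at most 4 vertices, so this never takes more than 4 colours, and only k = 8
    leaves a gap. There the lists in small components have at most 7 colours, so the three vertices
    of a resisting K4 have at most 4 outer neighbours each; this makes their outer neighbourhoods
    either easy to play against each other or nearly equal.

    For 5-choosability no embedding is at hand, and the induction has to survive both splitting and
    contraction. This is why the precoloured vertices form a clique: a clique never lies on both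
    sides of a cut.

    All graphs share a vertex type; deletion, contraction and identification only change the vertex
    set and the relation. Connectedness is therefore expressed by cuts of vertex sets. *)

Ltac nlia := repeat match goal with
  | H : is_true (leq _ _) |- _ => revert H
  | H : @eq nat _ _ |- _ => revert H
  end; clear; intros; lia.

(** * Connectivity by cuts, and K5 models *)

Section Connectivity.
Variable V : finType.
Implicit Types (e : rel V) (A B D E K Q S U W X Y Z : {set V}) (a b c q r u v w x y z : V).

Definition adjs e A B := [exists a in A, [exists b in B, e a b]].

Lemma adjsP e A B : reflect (exists a b, [/\ a \in A, b \in B & e a b]) (adjs e A B).
Proof.
apply: (iffP exists_inP) => [[a aA /exists_inP[b bB ab]]|[a [b [aA bB ab]]]].
  by exists a, b.
by exists a => //; apply/exists_inP; exists b.
Qed.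

Lemma adjsN e A B a b : ~~ adjs e A B -> a \in A -> b \in B -> e a b = false.
Proof. by move=> /adjsP h aA bB; apply/negP => ab; apply: h; exists a, b. Qed.

Lemma adjs_sub e e' A A' B B' : A \subset A' -> B \subset B' ->
  {in A & B, forall a b, e a b -> e' a b} -> adjs e A B -> adjs e' A' B'.
Proof.
move=> /subsetP sA /subsetP sB ee /adjsP[a [b [aA bB ab]]].
by apply/adjsP; exists a, b; split; [apply: sA | apply: sB | apply: ee].
Qed.

Lemma adjs_sym e A B : symmetric e -> adjs e A B = adjs e B A.
Proof.
move=> se; apply/idP/idP => /adjsP[a [b [aA bB ab]]];
  by apply/adjsP; exists b, a; rewrite se.
Qed.

(* No proper nonempty part of [A] is cut off from the rest; this holds for the
   empty set, which [conn] excludes. *)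
Definition nsep e A :=
  [forall X : {set V}, [&& X \subset A, X != set0 & X != A] ==> adjs e X (A :\: X)].
Definition conn e A := (A != set0) && nsep e A.

Lemma nsepP e A X : nsep e A -> X \subset A -> X != set0 -> X != A -> adjs e X (A :\: X).
Proof. by move=> /forallP /(_ X) /implyP h xA x0 xn; apply: h; rewrite xA x0. Qed.

Lemma nsepI e A :
  (forall X, X \subset A -> X != set0 -> X != A -> adjs e X (A :\: X)) -> nsep e A.
Proof. by move=> h; apply/forallP => X; apply/implyP => /and3P[]; apply: h. Qed.

Lemma nsepN e A : ~~ nsep e A ->
  exists X, [/\ X \subset A, X != set0, X != A & ~~ adjs e X (A :\: X)].
Proof.
by rewrite negb_forall => /existsP[X]; rewrite negb_imply => /andP[/and3P[]]; exists X.
Qed.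

Lemma nsep_sub e e' A : {in A &, forall a b, e a b -> e' a b} -> nsep e A -> nsep e' A.
Proof.
move=> ee h; apply: nsepI => X XA X0 Xn.
apply: adjs_sub (subxx _) (subxx _) _ (nsepP h XA X0 Xn) => a b aX.
by rewrite inE => /andP[_ bA]; apply: ee => //; apply: (subsetP XA).
Qed.

Lemma conn_sub e e' A : {in A &, forall a b, e a b -> e' a b} -> conn e A -> conn e' A.
Proof. by move=> ee /andP[A0 h]; rewrite /conn A0; apply: nsep_sub h. Qed.

Lemma nsep_conn e A x : nsep e A -> x \in A -> conn e A.
Proof. by move=> h xA; rewrite /conn h andbT; apply/set0Pn; exists x. Qed.

Lemma nsep1 e A : #|A| <= 1 -> nsep e A.
Proof.
move=> A1; apply: nsepI => X XA X0 Xn.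
have : X \proper A by rewrite properEneq Xn.
by move/proper_card; move: X0; rewrite -card_gt0; lia.
Qed.

Lemma conn1 e x : conn e [set x].
Proof. by apply: (@nsep_conn _ _ x); rewrite ?nsep1 ?cards1 ?inE. Qed.

(* The sides of a cut may be exchanged, so it is enough to look at cuts
   whose first side misses a given vertex. *)
Lemma nsep_root e A r : symmetric e -> r \in A ->
  (forall X, X \subset A -> X != set0 -> r \notin X -> adjs e X (A :\: X)) -> nsep e A.
Proof.
move=> se rA h; apply: nsepI => X XA X0 Xn; case: (boolP (r \in X)) => rX; last exact: h.
have e1 : A :\: (A :\: X) = X by rewrite setDDr setDv set0U; apply/setIidPr.
rewrite adjs_sym // -{2}e1; apply: h; rewrite ?subsetDl //; last by rewrite inE rX.
by rewrite setD_eq0; apply: contraNN Xn => AX; rewrite eqEsubset XA.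
Qed.

Lemma conn_rootP e A r X : conn e A -> r \in A -> X \subset A -> X != set0 ->
  r \notin X -> adjs e X (A :\: X).
Proof.
move=> /andP[_ h] rA XA X0 rX; apply: nsepP => //.
by apply: contraNneq rX => ->.
Qed.

Lemma connU e A B : symmetric e -> conn e A -> conn e B ->
  (A :&: B != set0) || adjs e A B -> conn e (A :|: B).
Proof.
move=> se cA cB AB.
have /set0Pn[r rA] : A != set0 by case/andP: cA.
apply: (@nsep_conn _ _ r); last by rewrite inE rA.
apply: (nsep_root se (r := r)); rewrite ?inE ?rA // => X XU X0 rX.
have [XA|nXA] := boolP (X :&: A == set0); last first.
  have := conn_rootP cA rA (subsetIr X A) nXA _; rewrite inE negb_and rX => /(_ isT).
  apply: adjs_sub => //; first exact: subsetIl.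
  by apply/subsetP => y; rewrite !inE negb_and => /andP[/orP[->->|/negPf->]].
have XB : X \subset B.
  apply/subsetP => y yX; have := subsetP XU y yX; rewrite inE => /orP[yA|//].
  by have : y \in X :&: A by [rewrite inE yX]; rewrite (eqP XA) inE.
have [XeB|XnB] := eqVneq X B; last first.
  case/andP: cB => _ h; have := nsepP h XB X0 XnB.
  by apply: adjs_sub => //; apply: setSD; apply: subsetUr.
move: AB; rewrite -XeB setIC XA /= adjs_sym //; apply: adjs_sub => //.
apply/subsetP => y yA; rewrite !inE yA andbT.
apply: contraL XA => yX; apply/set0Pn; exists y.
by rewrite inE yX.
Qed.

Lemma connU1 e A v : symmetric e -> conn e A -> adjs e [set v] A -> conn e (v |: A).
Proof. by move=> se cA vA; apply: connU; rewrite ?conn1 ?vA ?orbT. Qed.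

Lemma adjs1 e A v : adjs e [set v] A = [exists b in A, e v b].
Proof.
apply/adjsP/exists_inP => [[a [b [/set1P-> bA vb]]]|[b bA vb]]; first by exists b.
by exists v, b; rewrite inE.
Qed.

Lemma adjs11 e u v : adjs e [set u] [set v] = e u v.
Proof.
apply/adjsP/idP => [[a [b [/set1P-> /set1P->]]]//|uv].
by exists u, v; rewrite !inE.
Qed.

(** A largest connected subset through [x] will do: any further neighbour in [S] could be added to
    it. *)
Lemma compP e S x : symmetric e -> x \in S ->
  exists K, [/\ x \in K, K \subset S, conn e K & ~~ adjs e K (S :\: K)].
Proof.
move=> se xS.
pose P K := [&& x \in K, K \subset S & conn e K].
have P1 : P [set x] by rewrite /P inE eqxx sub1set xS conn1.
case: (arg_maxnP (fun K : {set V} => #|K|) P1) => K /and3P[xK KS cK] mK.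
exists K; split=> //; apply/adjsP => -[a [b [aK]]]; rewrite inE => /andP[bK bS] ab.
have : P (b |: K).
  rewrite /P inE xK orbT subUset sub1set bS KS connU1 //.
  by rewrite adjs1; apply/exists_inP; exists a => //; rewrite se.
by move/mK; rewrite cardsU1 bK; lia.
Qed.

(* The branch sets of a K5 model are the members of [s]. *)
Definition K5 e W (s : seq {set V}) :=
  [&& size s == 5, all (fun A => (A \subset W) && conn e A) s
    & pairwise (fun A B => [disjoint A & B] && adjs e A B) s].
Definition K5free e W := forall s, ~~ K5 e W s.

Lemma K5free_sub e e' W W' : W' \subset W ->
  {in W' &, forall a b, e' a b -> e a b} -> K5free e W -> K5free e' W'.
Proof.
move=> WW ee h s; apply: contra (h s) => /and3P[sz a p]; apply/and3P; split=> //.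
  apply/allP => A /(allP a) /andP[AW cA]; rewrite (subset_trans AW WW).
  by apply: conn_sub cA => u v uA vA; apply: ee; apply: (subsetP AW).
elim: s a p {h sz} => //= A s IH /andP[/andP[AW _] a] /andP[p ps].
rewrite IH // andbT; apply/allP => B Bs.
have /andP[BW _] := allP a _ Bs; have /andP[-> AB] := allP p _ Bs.
by apply: adjs_sub AB => // u v uA vB; apply: ee; [apply: (subsetP AW)|apply: (subsetP BW)].
Qed.

(* [contract e Q q] contracts the set [Q] to its member [q]; the vertices of
   [Q :\ q] keep junk adjacencies and have to be left out by the user. *)
Definition blow Q q a := if a == q then Q else [set a].
Definition contract e Q q := [rel a b | (a != b) && adjs e (blow Q q a) (blow Q q b)].

Lemma contract_sym e Q q : symmetric e -> symmetric (contract e Q q).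
Proof. by move=> se a b /=; rewrite eq_sym adjs_sym. Qed.

Lemma contract_irr e Q q : irreflexive (contract e Q q).
Proof. by move=> a /=; rewrite eqxx. Qed.

Lemma mem_blow Q q a : q \in Q -> a \in blow Q q a.
Proof. by rewrite /blow; case: eqP => [->|]; rewrite ?inE. Qed.

Lemma contract_incl e Q q a b : irreflexive e -> q \in Q -> e a b -> contract e Q q a b.
Proof.
move=> ie qQ ab /=; apply/andP; split; first by apply: contraTneq ab => ->; rewrite ie.
by apply/adjsP; exists a, b; rewrite !mem_blow.
Qed.

Lemma contractE e Q q a b : irreflexive e -> a != q -> b != q ->
  contract e Q q a b = e a b.
Proof.
move=> ie aq bq; rewrite /= /blow (negPf aq) (negPf bq) adjs11.
by case: eqP => // ->; rewrite ie.
Qed.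

Lemma contractEq e Q q a : symmetric e -> a != q ->
  contract e Q q q a = adjs e [set a] Q.
Proof. by move=> se aq; rewrite /= /blow eqxx (negPf aq) eq_sym aq adjs_sym. Qed.

Definition blows Q q A := \bigcup_(a in A) blow Q q a.

Lemma blowsP Q q A x :
  reflect (exists2 a, a \in A & x \in blow Q q a) (x \in blows Q q A).
Proof. exact: bigcupP. Qed.

Lemma adjs_blows e Q q A B : adjs (contract e Q q) A B ->
  adjs e (blows Q q A) (blows Q q B).
Proof.
case/adjsP=> a [b [aA bB /andP[_]]].
by apply: adjs_sub => //; apply: bigcup_sup.
Qed.

(** A cut [X] of the blown-up set either cuts through [Q], whose connectedness supplies the edge, or
    is a union of blown-up vertices and comes from a cut of [A] in the contracted graph. *)
Lemma conn_blows e Q q A : q \in Q -> A :&: Q \subset [set q] -> conn e Q ->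
  conn (contract e Q q) A -> conn e (blows Q q A).
Proof.
move=> qQ AQ cQ cA; have /set0Pn[a aA] : A != set0 by case/andP: cA.
apply: (@nsep_conn _ _ a); last by apply/blowsP; exists a; rewrite ?mem_blow.
apply: nsepI => X XA X0 Xn.
have inA x : x \in X -> exists2 a, a \in A & x \in blow Q q a.
  by move=> xX; apply/blowsP; apply: (subsetP XA).
(* A vertex outside [X] whose blow-up meets [X] can only be [q], and then [X] cuts [Q]. *)
have blowX b x : b \in A -> b \notin X -> x \in blow Q q b -> x \in X ->
   adjs e X (blows Q q A :\: X).
  move=> bA bX; rewrite /blow; case: eqP => [bq|_]; last first.
    by move=> /set1P -> xX; rewrite xX in bX.
  move=> xQ xX; have := @conn_rootP e Q q (X :&: Q) cQ qQ (subsetIr _ _).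
  rewrite inE -bq (negPf bX) /= => /(_ _ isT).
  have -> : X :&: Q != set0 by apply/set0Pn; exists x; rewrite inE xX.
  move/(_ isT); apply: adjs_sub => //; first exact: subsetIl.
  apply/subsetP => y; rewrite !inE negb_and => /andP[yX yQ].
  move: yX; rewrite yQ orbF => ->; apply/blowsP; exists b => //.
  by rewrite /blow bq eqxx.
have [/exists_inP[b bA /andP[bX /set0Pn[x]]]|] :=
  boolP [exists b in A, (b \notin X) && (blow Q q b :&: X != set0)].
  by rewrite inE => /andP[]; apply: blowX.
move=> H.
have H1 b x : b \in A -> x \in blow Q q b -> x \in X -> b \in X.
  move=> bA xb xX; apply: contraNT H => bX; apply/exists_inP; exists b => //.
  by rewrite bX; apply/set0Pn; exists x; rewrite inE xb.
have [Xcl|] := boolP [forall b in A, (b \in X) ==> (blow Q q b \subset X)]; last first.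
  rewrite negb_forall_in => /exists_inP[b bA]; rewrite negb_imply => /andP[bX].
  rewrite /blow; case: eqP => [bq QX|]; last by rewrite sub1set bX.
  have := @nsepP e Q (X :&: Q) _ (subsetIr _ _) _ _.
  have -> : nsep e Q by case/andP: cQ.
  have -> : X :&: Q != set0 by apply/set0Pn; exists b; rewrite inE bX bq.
  have -> : X :&: Q != Q by apply: contraNneq QX => /setIidPr.
  move=> /(_ isT isT isT); apply: adjs_sub => //; first exact: subsetIl.
  apply/subsetP => y; rewrite !inE negb_and => /andP[yX yQ].
  move: yX; rewrite yQ orbF => ->; apply/blowsP; exists b => //.
  by rewrite /blow bq eqxx.
(* Now [X] splits no blow-up, so [X :&: A] is a cut of [A]. *)
have := @nsepP (contract e Q q) A (X :&: A) _ (subsetIr _ _) _ _.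
have -> : nsep (contract e Q q) A by case/andP: cA.
have -> : X :&: A != set0.
  have /set0Pn[x xX] := X0; have [b bA xb] := inA x xX.
  by apply/set0Pn; exists b; rewrite inE bA (H1 b x).
have -> : X :&: A != A.
  apply: contraNneq Xn => /setIidPr AX; rewrite eqEsubset XA; apply/subsetP => x.
  case/blowsP=> b bA xb; have /implyP := forall_inP Xcl b bA.
  by move=> /(_ (subsetP AX b bA)) /subsetP; apply.
move=> /(_ isT isT isT) /adjs_blows; apply: adjs_sub => //.
  apply/subsetP => y /blowsP[b]; rewrite inE => /andP[bX bA] yb.
  by have /implyP := forall_inP Xcl b bA; move=> /(_ bX) /subsetP; apply.
apply/subsetP => y /blowsP[b]; rewrite !inE negb_and => /andP[bX bA] yb.
move: bX; rewrite bA orbF => bX; apply/andP; split; last by apply/blowsP; exists b.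
by apply: contraNN bX; apply: H1.
Qed.

Lemma disjoint_blows Q q W A B : W :&: Q \subset [set q] -> A \subset W -> B \subset W ->
  [disjoint A & B] -> [disjoint blows Q q A & blows Q q B].
Proof.
move=> WQ AW BW AB; rewrite -setI_eq0; apply/eqP/setP => x; rewrite !inE.
apply/negP => /andP[/blowsP[a aA xa] /blowsP[b bB xb]].
have aq y : y \in W -> y \in Q -> y = q.
  by move=> yW yQ; apply/set1P; apply: (subsetP WQ); rewrite inE yW.
have aW := subsetP AW a aA; have bW := subsetP BW b bB.
have ab : a = b.
  move: xa xb; rewrite /blow; case: eqP => [->|na]; case: eqP => [->|nb] //.
  - by move=> xQ /set1P xb; move: xQ; rewrite xb => /(aq _ bW).
  - by move=> /set1P-> /(aq _ aW).
  - by move=> /set1P <- /set1P.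
by have := disjointFr AB aA; rewrite ab bB.
Qed.

(** Blowing up the branch sets of a model in the contracted graph gives a model in [e]. As [W']
    meets [Q] in [q] at most, only one branch set can receive [Q], and disjointness survives. *)
Lemma K5free_contract e Q q W W' : q \in Q -> Q \subset W -> conn e Q ->
  W' \subset W -> W' :&: Q \subset [set q] ->
  K5free e W -> K5free (contract e Q q) W'.
Proof.
move=> qQ QW cQ WW WQ h s; apply: contra (h (map (blows Q q) s)) => /and3P[sz a p].
apply/and3P; split; first by rewrite size_map.
  apply/allP => _ /mapP[A /(allP a) /andP[AW cA] ->]; apply/andP; split.
    apply/subsetP => x /blowsP[b bA]; rewrite /blow; case: eqP => [_|_ /set1P->].
      by apply: (subsetP QW).
    by apply: (subsetP WW); apply: (subsetP AW).
  by apply: conn_blows => //; apply: subset_trans WQ; apply: setSI.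
rewrite pairwise_map; elim: s {sz} a p => //= A s IH /andP[/andP[AW _] a] /andP[p ps].
rewrite IH // andbT; apply/allP => B Bs.
have /andP[BW _] := allP a _ Bs; have /andP[AB adAB] := allP p _ Bs.
by rewrite /= (disjoint_blows WQ) //= adjs_blows.
Qed.

End Connectivity.

(** * Rooted triangles in graphs without cut vertices *)

Section RootedMinors.
Variable V : finType.
Implicit Types (e : rel V) (A B C D E K Q S U W X Y Z : {set V}) (a b c q r u v w x y z : V).

Lemma closed_sub e A S K x : conn e A -> A \subset S -> x \in A -> x \in K ->
  ~~ adjs e K (S :\: K) -> A \subset K.
Proof.
move=> /andP[_ cA] AS xA xK; apply: contraNT => nAK.
have := nsepP cA (subsetIl A K).
have -> : A :&: K != set0 by apply/set0Pn; exists x; rewrite inE xA.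
have -> : A :&: K != A by apply: contraNneq nAK => /setIidPl.
move=> /(_ isT isT); apply: adjs_sub => //; first exact: subsetIr.
apply/subsetP => y; rewrite !inE negb_and => /andP[yK yA].
by move: yK; rewrite yA /= => ->; rewrite (subsetP AS).
Qed.

(** A remaining part that misses [B] has an edge leaving it in [S], and this edge cannot end in [K],
    since [K] has no edge to the rest of [S :\: B]. *)
Lemma conn_setD e S B K : symmetric e -> conn e S -> conn e B -> B \subset S ->
  K \subset S :\: B -> ~~ adjs e K (S :\: B :\: K) -> conn e (S :\: K).
Proof.
move=> se cS cB BS KS nK; have /set0Pn[r rB] : B != set0 by case/andP: cB.
have rSK : r \in S :\: K.
  rewrite inE (subsetP BS) // andbT; apply: contraL rB => /(subsetP KS).
  by rewrite inE => /andP[].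
apply: (@nsep_conn _ _ _ r) => //; apply: (nsep_root se rSK) => X XS X0 rX.
have [XB|XB] := eqVneq (X :&: B) set0; last first.
  have := conn_rootP cB rB (subsetIr X B) XB; rewrite inE (negPf rX) => /(_ isT).
  apply: adjs_sub => //; first exact: subsetIl.
  apply/subsetP => y; rewrite !inE negb_and => /andP[yX yB].
  move: yX; rewrite yB orbF => -> /=; rewrite (subsetP BS) // andbT.
  by apply: contraL yB => /(subsetP KS); rewrite inE => /andP[].
have := conn_rootP cS (subsetP BS r rB) (subset_trans XS (subsetDl _ _)) X0 rX.
case/adjsP=> x [y [xX]]; rewrite inE => /andP[yX yS] xy.
apply/adjsP; exists x, y; split=> //; rewrite !inE yX yS andbT /=.
apply/negP => yK; move/adjsP: nK; apply; exists y, x; split; rewrite 1?se //.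
have := subsetP XS x xX; rewrite !inE => /andP[-> ->]; rewrite andbT.
by apply/negP => xB; have := in_set0 x; rewrite -XB inE xX xB.
Qed.

(** Together with [[set a]] the two sets form a triangle model rooted at [a], [b], [c]. [C] is
    chosen smallest, and [B] is the remainder of [S :\ a]; the work is to show that [a] has a
    neighbour in [B]. *)
Lemma rooted_K3 e S a b c : symmetric e -> a \in S -> b \in S -> c \in S ->
  a != b -> a != c -> b != c -> nsep e S -> (forall z, z \in S -> nsep e (S :\ z)) ->
  exists B C, [/\ [/\ b \in B, c \in C, B \subset S :\ a & C \subset S :\ a],
    conn e B /\ conn e C, [disjoint B & C] &
    [/\ adjs e B C, adjs e [set a] B & adjs e [set a] C]].
Proof.
move=> se aS bS cS ab ac bc nS nSz.
have cSa : conn e (S :\ a) by apply: (@nsep_conn _ _ _ b); rewrite ?nSz // !inE eq_sym ab.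
pose P C := [&& conn e C, C \subset S :\ a, c \in C, b \notin C,
  conn e (S :\ a :\: C) & adjs e [set a] C].
(* The component of [c] in [S] without [a] and [b]; it touches [a] because [b] is no cut vertex. *)
have [C0 PC0] : exists C, P C.
  have [] := @compP _ e (S :\ a :\ b) c se; first by rewrite !inE eq_sym bc eq_sym ac cS.
  move=> K [cK KS coK nK]; exists K; rewrite /P coK cK.
  have bK : b \notin K by apply/negP => /(subsetP KS); rewrite !inE eqxx.
  rewrite bK (subset_trans KS (subsetDl _ _)) /=; apply/andP; split.
    by apply: (conn_setD (B := [set b])); rewrite ?conn1 // sub1set !inE eq_sym ab.
  have cb : conn e (S :\ b) by apply: (@nsep_conn _ _ _ a); rewrite ?nSz // !inE ab.
  have aK : a \notin K by apply/negP => /(subsetP KS); rewrite !inE eqxx andbF.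
  have := conn_rootP (r := a) (X := K) cb; rewrite !inE ab aS aK => /(_ isT).
  have -> : K \subset S :\ b by apply: subset_trans KS _; rewrite setDDl setUC -setDDl subsetDl.
  have -> : K != set0 by apply/set0Pn; exists c.
  move=> /(_ isT isT isT) /adjsP[x [y [xK]]]; rewrite !inE => /and3P[yK yb yS] xy.
  have [ya|ya] := eqVneq y a.
    by rewrite adjs1; apply/exists_inP; exists x; rewrite // -ya se.
  by case/adjsP: nK; exists x, y; rewrite !inE yK yb ya.
case: (arg_minnP (fun C : {set V} => #|C|) PC0) => C /and5P[cC CS cinC bC /andP[cB aC]] mC.
pose B := S :\ a :\: C.
have B_mem t : (t \in B) = [&& t \notin C, t != a & t \in S] by rewrite !inE.
rewrite -/B in cB.
have bB : b \in B by rewrite B_mem bC eq_sym ab.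
have BSa : B \subset S :\ a by apply: subsetDl.
have BC : [disjoint B & C] by rewrite disjoint_sym disjoints_subset setCD subsetUr.
clearbody B.
have inS t : t \in S -> t != a -> t \in B \/ t \in C.
  by move=> tS ta; rewrite B_mem ta tS; case: (t \in C); [right|left].
have aB : a \notin B by rewrite B_mem eqxx andbF.
have aC' : a \notin C by apply/negP => /(subsetP CS); rewrite !inE eqxx.
have BS : B \subset S by apply/subsetP => y; rewrite B_mem => /and3P[].
have CS' : C \subset S by apply: subset_trans CS (subsetDl _ _).
have cB' : c \notin B by rewrite (disjointFl BC).
have B0 : B != set0 by apply/set0Pn; exists b.
exists B, C; split=> //; split=> //.
  have := conn_rootP (r := c) (X := B) cSa; rewrite !inE cS eq_sym ac cB' BSa.
  move=> /(_ isT isT B0 isT); apply: adjs_sub => //; apply/subsetP => y.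
  by rewrite in_setD in_setD1 => /and3P[yB ya yS]; case: (inS y yS ya) => // yB'; rewrite yB' in yB.
apply: contraT => nab.
(* A pair consists of a neighbour [t] of [B] in [C] and the component [K] of [c] in [C :\ t]; below
   [K] is taken largest. *)
pose R (p : V * {set V}) := [&& p.1 \in C, p.1 != c, adjs e B [set p.1],
  c \in p.2, p.2 \subset C :\ p.1, conn e p.2 & ~~ adjs e p.2 (C :\ p.1 :\: p.2)].
have mkR t : t \in C -> t != c -> adjs e B [set t] -> exists K, R (t, K).
  move=> tC tc Bt; have [] := @compP _ e (C :\ t) c se; first by rewrite !inE eq_sym tc.
  by move=> K [cK KC coK nK]; exists K; apply/and5P; split=> //; apply/and3P.
have BaF x : x \in B -> e x a = false.
  by move=> xB; rewrite se; apply: (adjsN nab); rewrite ?inE.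
have [p0 Rp0] : exists p, R p.
  have ccS : conn e (S :\ c) by apply: (@nsep_conn _ _ _ a); rewrite ?nSz // !inE ac.
  have := conn_rootP (r := a) (X := B) ccS; rewrite !inE ac aS => /(_ isT).
  rewrite subsetD1 BS cB' B0 aB => /(_ isT isT isT) /adjsP[x [y [xB]]].
  rewrite 2!inE in_set1 => /and3P[yB yc yS] xy.
  case: (inS y) => //; first by apply: contraTneq xy => ->; rewrite BaF.
    by move=> yB'; rewrite yB' in yB.
  move=> yC; have [|K RK] := mkR y yC yc; last by exists (y, K).
  by apply/adjsP; exists x, y; rewrite inE.
case: (arg_maxnP (fun p : V * {set V} => #|p.2|) Rp0) => -[t K].
case/and5P=> /= tC tc Bt cK /and3P[KC coK nK] mK.
have KCC : K \subset C by apply: subset_trans KC (subsetDl _ _).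
have tK : t \notin K by apply/negP => /(subsetP KC); rewrite !inE eqxx.
(* Otherwise [K] is a smaller choice for [C]: what remains of [S :\ a] is connected through [B] and
   [t]. *)
have nKa : ~~ adjs e [set a] K.
  apply/negP => aK.
  have PK : P K.
    apply/and5P; split=> //; first exact: subset_trans KCC CS.
      by apply: contra bC; apply: subsetP.
    rewrite aK andbT.
    have e1 : S :\ a :\: (B :|: [set t]) = C :\ t.
      apply/setP => y; rewrite !inE B_mem; have [yC|yC] := boolP (y \in C).
        by have := subsetP CS y yC; rewrite !inE => ->; rewrite andbT.
      by rewrite !andbF /=; case: (y != a); case: (y \in S); rewrite ?andbF.
    apply: (conn_setD (B := B :|: [set t])) => //.
    - by apply: connU; rewrite ?conn1 ?Bt ?orbT.
    - by rewrite subUset BSa sub1set (subsetP CS).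
    - by rewrite e1.
    by rewrite e1.
  have := mC K PK.
  have := subset_leq_card KC; rewrite (cardsD1 t C) tC; nlia.
have ta : t != a by apply: contraTneq tC => ->.
have cSt : conn e (S :\ t) by apply: (@nsep_conn _ _ _ a); rewrite ?nSz ?(subsetP CS') // !inE eq_sym ta.
have tB : t \notin B by rewrite (disjointFl BC).
have aK : a \notin K by apply: contra aC'; apply: subsetP.
(* Since [t] is no cut vertex, an edge leaves [B :|: K]. It runs from [B] to some [y] in [C], and
   the component of [c] in [C :\ y] contains [K] and [t], against the choice of [K]. *)
have /adjsP[x [y [xBK]]] : adjs e (B :|: K) (S :\ t :\: (B :|: K)).
  apply: (conn_rootP (r := a) cSt).
  - by rewrite in_setD1 aS eq_sym ta.
  - by rewrite subsetD1 subUset BS (subset_trans KCC CS') in_setU negb_or tB.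
  - by apply/set0Pn; exists b; rewrite in_setU bB.
  - by rewrite in_setU negb_or aB.
rewrite in_setU in xBK; rewrite in_setD in_setU negb_or in_setD1.
case/andP=> /andP[yB yK] /andP[yt yS] xy.
have ya : y != a.
  apply: contraTneq xy => ->; case/orP: xBK => [/BaF->//|xK].
  by rewrite se (adjsN nKa) ?inE.
have yC : y \in C by case: (inS y yS ya) => // yB'; rewrite yB' in yB.
case/orP: xBK => xB; last by rewrite (adjsN nK xB) // in xy; rewrite !inE yK yt.
have yc : y != c by apply: contraNneq yK => ->.
have [|K' RK'] := mkR y yC yc; first by apply/adjsP; exists x, y; rewrite inE.
have := mK _ RK'; case/and5P: RK' => /= _ _ _ cK' /and3P[KC' coK' nK'].
suff : t |: K \subset K' by move/subset_leq_card; rewrite cardsU1 tK /=; nlia.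
apply: (closed_sub (S := C :\ y) (x := c)) => //; rewrite ?inE ?cK ?orbT //.
  apply: connU1 => //; rewrite adjs_sym //.
  have := conn_rootP cC tC KCC; rewrite tK => /(_ _ isT).
  have -> : K != set0 by apply/set0Pn; exists c.
  move=> /(_ isT) /adjsP[u [v [uK]]]; rewrite inE => /andP[vK vC] uv.
  have [vt|vt] := eqVneq v t; first by apply/adjsP; exists u, v; split=> //; rewrite inE vt.
  by rewrite (adjsN nK uK) // in uv; rewrite !inE vK vt.
  by rewrite subsetD1 subUset sub1set tC KCC !inE negb_or yt yK.
exact: nK'.
Qed.

Definition nb e A v := [set u in A | e v u].

Lemma in_nb e A v u : (u \in nb e A v) = (u \in A) && e v u.
Proof. by rewrite inE. Qed.

Lemma set2_card A x y : #|A| = 2 -> x \in A -> y \in A -> x != y -> A = [set x; y].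
Proof.
move=> A2 xA yA xy; apply/esym/eqP; rewrite eqEcard cards2 xy A2 leqnn andbT.
by rewrite subUset !sub1set xA.
Qed.

Lemma card_other A x : 1 < #|A| -> exists2 y, y \in A & y != x.
Proof.
move=> A2; have : 0 < #|A :\ x| by move: (cardsD1 x A) A2; case: (x \in A); nlia.
by rewrite card_gt0 => /set0Pn[y]; rewrite !inE => /andP[]; exists y.
Qed.

(** Take a cut vertex [z] with a smallest side [X]. One neighbour [x0] of [z] lies in [X] and the
    other outside, so [x0] cuts off [X :\ x0], a smaller side. *)
Lemma cycle_nsep e A : symmetric e -> irreflexive e -> conn e A ->
  (forall v, v \in A -> #|nb e A v| = 2) -> forall z, nsep e (A :\ z).
Proof.
move=> se ie cA A2 z0; apply: contraT => nz.
have nA : nsep e A by case/andP: cA.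
have z0A : z0 \in A.
  by apply: contraNT nz => z0A; rewrite (setDidPl _) // disjoint_sym disjoints1.
pose P (p : V * {set V}) := [&& p.1 \in A, p.2 \subset A :\ p.1, p.2 != set0,
  p.2 != A :\ p.1 & ~~ adjs e p.2 (A :\ p.1 :\: p.2)].
have [p0 Pp0] : exists p, P p.
  by have [X [XA X0 Xn nX]] := nsepN nz; exists (z0, X); apply/and5P.
case: (arg_minnP (fun p : V * {set V} => #|p.2|) Pp0) => -[z X].
case/and5P=> /= zA XA X0 Xn nX mX.
have zX : z \notin X by apply/negP => /(subsetP XA); rewrite !inE eqxx.
have XA' : X \subset A by apply: subset_trans XA (subsetDl _ _).
have outX x y : x \in X -> y \in A -> e x y -> y \notin X -> y = z.
  move=> xX yA xy yX; apply: contraTeq xy => yz.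
  by rewrite (adjsN nX) // !inE yX yz.
have [x0 x0X zx0] : exists2 x, x \in X & e z x.
  have /adjsP[x [y [xX]]] := conn_rootP cA zA XA' X0 zX; rewrite inE => /andP[yX yA] xy.
  by exists x => //; rewrite se -(outX x y).
have [y0 y0Y zy0] : exists2 y, y \in A :\ z :\: X & e z y.
  have := conn_rootP (X := A :\ z :\: X) cA zA (subset_trans (subsetDl _ _) (subsetDl _ _)).
  have -> : A :\ z :\: X != set0.
    by rewrite setD_eq0; apply: contra Xn => h; rewrite eqEsubset XA.
  have -> : z \notin A :\ z :\: X by rewrite !inE eqxx andbF.
  move=> /(_ isT isT) /adjsP[x [y [xY]]]; rewrite inE => /andP[yY yA] xy.
  suff yz : y = z by exists x => //; rewrite se -yz.
  apply/eqP; apply: contraTT xY => yz.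
  have yX : y \in X by move: yY; rewrite !inE yz yA !andbT negbK.
  rewrite in_setD in_setD1.
  have [->|xz] := eqVneq x z; first by rewrite andbF.
  case: (boolP (x \in X)) => //= xX; apply/negP => xA.
  by move/eqP: xz; apply; apply: (outX y); rewrite // se.
have y0z : y0 \notin X by move: y0Y; rewrite inE => /andP[].
have x0A := subsetP XA' x0 x0X.
have nbz : nb e A z = [set x0; y0].
  apply: set2_card; rewrite ?A2 ?in_nb ?zx0 ?zy0 ?x0A //.
    by move: y0Y; rewrite !inE => /and3P[_ _ ->].
  by apply: contraTneq x0X => ->.
have [x1] := @card_other (nb e A x0) z ltac:(by rewrite A2).
rewrite in_nb => /andP[x1A x01] x1z.
have x1X : x1 \in X by apply: contraT => /(outX x0 x1 x0X x1A x01)/eqP; rewrite (negPf x1z).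
have : P (x0, X :\ x0).
  apply/and5P; split=> //=; first by apply: setSD.
  - apply/set0Pn; exists x1; rewrite !inE x1X andbT.
    by apply: contraTneq x01 => ->; rewrite ie.
  - apply/eqP => /setP/(_ z); rewrite !inE (negPf zX) zA andbT andbF.
    by move=> /esym/negbFE/eqP zx; rewrite zx x0X in zX.
  apply/adjsP => -[s [t [/setD1P[sx0 sX]]]].
  rewrite in_setD !in_setD1 => /and3P[tX tx0 tA] st.
  rewrite tx0 /= in tX.
  have tz := outX s t sX tA st tX.
  have : s \in nb e A z by rewrite in_nb (subsetP XA') // se -tz.
  by rewrite nbz !inE (negPf sx0) => /eqP sy; rewrite -sy sX in y0z.
by move/mX => /=; rewrite (cardsD1 x0 X) x0X; nlia.
Qed.

Lemma K5free_five e W A B C D E : symmetric e -> K5free e W ->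
  conn e A -> conn e B -> conn e C -> conn e D -> conn e E ->
  A \subset W -> B \subset W -> C \subset W -> D \subset W -> E \subset W ->
  [disjoint A & B] -> [disjoint A & C] -> [disjoint A & D] -> [disjoint A & E] ->
  [disjoint B & C] -> [disjoint B & D] -> [disjoint B & E] ->
  [disjoint C & D] -> [disjoint C & E] -> [disjoint D & E] ->
  adjs e A B -> adjs e A C -> adjs e A D -> adjs e A E ->
  adjs e B C -> adjs e B D -> adjs e B E ->
  adjs e C D -> adjs e C E -> adjs e D E -> False.
Proof.
move=> se /(_ [:: A; B; C; D; E]) /negP K cA cB cC cD cE sA sB sC sD sE.
move=> d1 d2 d3 d4 d5 d6 d7 d8 d9 d10 a1 a2 a3 a4 a5 a6 a7 a8 a9 a10; apply: K.
apply/and3P; split=> //=; first by rewrite cA cB cC cD cE sA sB sC sD sE.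
by rewrite d1 d2 d3 d4 d5 d6 d7 d8 d9 d10 a1 a2 a3 a4 a5 a6 a7 a8 a9 a10.
Qed.

End RootedMinors.

(** * 5-choosability *)

Lemma card_between (T : finType) (A B : {set T}) n :
  A \subset B -> #|A| <= n <= #|B| ->
  exists M : {set T}, [/\ A \subset M, M \subset B & #|M| = n].
Proof.
elim: n => [|n IH] AB /andP[An nB].
  by exists A; split=> //; apply/eqP; rewrite -leqn0.
have [An'|An'] := leqP #|A| n; last by exists A; split=> //; apply/eqP; rewrite eqn_leq An.
have [|M [AM MB Mn]] := IH AB; first by rewrite An' ltnW.
have /properP[_ [x xB xM]] : M \proper B by rewrite properEcard MB Mn.
exists (x |: M); split; first exact: subset_trans AM (subsetUr _ _).
  by rewrite subUset sub1set xB.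
by rewrite cardsU1 xM Mn.
Qed.

Lemma card_lt_ex (T : finType) (A B : {set T}) : #|A| < #|B| -> exists2 c, c \in B & c \notin A.
Proof.
move=> AB; have /subsetPn[c cB cA] : ~~ (B \subset A); last by exists c.
by apply: contraL AB => /subset_leq_card; rewrite -leqNgt.
Qed.

Lemma card_setD_ge (T : finType) (A B : {set T}) : #|A| <= #|A :\: B| + #|B|.
Proof. by have := cardsID B A; have := subset_leq_card (subsetIr A B); nlia. Qed.

Lemma card_setD1_ge (T : finType) (A : {set T}) c : #|A| <= #|A :\ c|.+1.
Proof. by have := card_setD_ge A [set c]; rewrite cards1 addn1. Qed.

(** * Colourings from lists and the greedy argument *)

Section ListColouring.
Variables (V C : finType) (c0 : C).
Implicit Types (e : rel V) (A B D E K P Q S U W X Y Z : {set V}) (p q r u v w x y z : V).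
Implicit Types (L : V -> {set C}) (phi : V -> C).

Definition col e D L := exists phi, (forall v, v \in D -> phi v \in L v) /\
  (forall u v, u \in D -> v \in D -> e u v -> phi u != phi v).

Lemma col_sub e e' D D' L L' : D' \subset D -> (forall v, v \in D' -> L v \subset L' v) ->
  (forall u v, u \in D' -> v \in D' -> e' u v -> e u v) -> col e D L -> col e' D' L'.
Proof.
move=> /subsetP DD LL ee [phi [h1 h2]]; exists phi; split=> [v vD|u v uD vD uv].
  by apply: (subsetP (LL v vD)); apply: h1; apply: DD.
by apply: h2; [apply: DD|apply: DD|apply: ee].
Qed.

Lemma col_vertex e D L v c : symmetric e -> irreflexive e -> c \in L v ->
  col e (D :\ v) (fun u => if e v u then L u :\ c else L u) -> col e D L.
Proof.
move=> se ie cL [phi [h1 h2]]; exists (fun u => if u == v then c else phi u).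
have H u : u \in D -> u != v -> phi u \in (if e v u then L u :\ c else L u).
  by move=> uD uv; apply: h1; rewrite !inE uv.
split=> [u uD|u w uD wD uw].
  case: eqP => [->//|/eqP uv]; have := H u uD uv.
  by case: ifP => // _; rewrite !inE => /andP[].
have [uE|uv] := eqVneq u v; have [wE|wv] := eqVneq w v; rewrite ?uE ?wE in uw *.
- by rewrite ie in uw.
- by have := H w wD wv; rewrite uw !inE eq_sym => /andP[].
- by have := H u uD uv; rewrite se uw !inE => /andP[].
by apply: h2; rewrite ?inE ?uv ?wv.
Qed.

(** The vertex found for [Z = D] is coloured last: its neighbours use fewer colours than its list
    has. The condition passes to subsets. *)
Lemma greedy e D L : symmetric e -> irreflexive e ->
  (forall Z, Z \subset D -> Z != set0 -> exists2 v, v \in Z & #|nb e Z v| < #|L v|) ->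
  col e D L.
Proof.
move=> se ie; have [n] := ubnP #|D|; elim: n D => // n IH D Dn h.
have [->|D0] := eqVneq D set0.
  by exists (fun=> c0); split=> [v|u v]; rewrite inE.
have [v vD dv] := h D (subxx _) D0.
have [|Z ZD|phi [h1 h2]] := IH (D :\ v).
- by move: Dn; rewrite (cardsD1 v D) vD; nlia.
- by apply: h; apply: subset_trans ZD (subsetDl _ _).
have [|c cL cN] := @card_lt_ex _ (phi @: nb e D v) (L v).
  by apply: leq_ltn_trans dv; apply: leq_imset_card.
exists (fun u => if u == v then c else phi u).
have H u : u \in D -> e v u -> phi u != c.
  by move=> uD vu; apply: contraNneq cN => <-; apply: imset_f; rewrite in_nb uD.
split=> [u uD|u w uD wD uw].
  by case: eqP => [->//|/eqP uv]; apply: h1; rewrite !inE uv.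
have [uE|uv] := eqVneq u v; have [wE|wv] := eqVneq w v; rewrite ?uE ?wE in uw *.
- by rewrite ie in uw.
- by rewrite eq_sym; apply: H.
- by apply: H; rewrite // se.
by apply: h2; rewrite ?inE ?uv ?wv.
Qed.

Lemma nb_sub e D Z v : Z \subset D -> nb e Z v \subset nb e D v.
Proof. by move=> /subsetP ZD; apply/subsetP => u; rewrite !in_nb => /andP[/ZD-> ->]. Qed.

Lemma deg_drop e D Z : conn e D -> Z \subset D -> Z != set0 -> Z != D ->
  exists2 v, v \in Z & #|nb e Z v| < #|nb e D v|.
Proof.
case/andP=> _ nD ZD Z0 ZnD; have /adjsP[v [u [vZ]]] := nsepP nD ZD Z0 ZnD.
rewrite inE => /andP[uZ uD] vu; exists v => //; apply/proper_card/properP.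
by split; [apply: nb_sub|exists u; rewrite in_nb ?uD // (negPf uZ)].
Qed.

Lemma col_surplus e D L w : symmetric e -> irreflexive e -> conn e D ->
  (forall v, v \in D -> #|nb e D v| <= #|L v|) -> w \in D -> #|nb e D w| < #|L w| ->
  col e D L.
Proof.
move=> se ie cD h wD hw; apply: greedy => // Z ZD Z0.
have [->|ZnD] := eqVneq Z D; first by exists w.
have [v vZ dv] := deg_drop cD ZD Z0 ZnD; exists v => //.
by apply: leq_trans dv (h _ (subsetP ZD v vZ)).
Qed.

Lemma col_proper e D X L : symmetric e -> irreflexive e -> conn e D ->
  (forall v, v \in D -> #|nb e D v| <= #|L v|) -> X \proper D -> col e X L.
Proof.
move=> se ie cD h XD; apply: greedy => // Z ZX Z0.
have ZD := sub_proper_trans ZX XD.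
have [v vZ dv] := deg_drop cD (proper_sub ZD) Z0 (proper_neq ZD); exists v => //.
by apply: leq_trans dv (h _ (subsetP (proper_sub ZD) v vZ)).
Qed.

(* [r] stands for the outer face of Thomassen's theorem and [P] for the
   precoloured edge on it. *)
Record good e W r P L : Prop := Good {
  good_sym : symmetric e;
  good_irr : irreflexive e;
  good_K5 : K5free e W;
  good_r : r \in W;
  good_P : P \subset nb e W r;
  good_P2 : #|P| <= 2;
  good_clique : forall p q, p \in P -> q \in P -> p != q -> e p q;
  good_single : forall p, p \in P -> #|L p| = 1;
  good_diff : forall p q, p \in P -> q \in P -> p != q -> L p != L q;
  good_3 : forall v, v \in W -> e r v -> v \notin P -> 3 <= #|L v|;
  good_5 : forall v, v \in W -> v != r -> ~~ e r v -> 5 <= #|L v| }.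

(** * The induction step for a root with a precoloured clique *)

Section Step.
Variable n : nat.
Hypothesis IH : forall e W r P L,
  3 * #|W| - #|P| < n -> good e W r P L -> col e (W :\ r) L.
Variables (e : rel V) (W : {set V}) (r : V) (P : {set V}) (L : V -> {set C}).
Hypothesis Wn : 3 * #|W| - #|P| <= n.
Hypothesis G : good e W r P L.

Let se := good_sym G.
Let ie := good_irr G.

Lemma P_mem p : p \in P -> [/\ p \in W, e r p & p != r].
Proof.
move=> /(subsetP (good_P G)); rewrite in_nb => /andP[pW rp]; split=> //.
by apply: contraTneq rp => ->; rewrite ie.
Qed.

(** The factor 3 lets the loss of one vertex of [W] outweigh any change of the precoloured set, as
    [P] has at most 2 elements. *)
Lemma measure_lt W' P' : W' \proper W -> 3 * #|W'| - #|P'| < n.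
Proof.
move=> /proper_card WW; have P2 := good_P2 G.
by move: Wn WW P2; clear; lia.
Qed.

Lemma list3 v : v \in W -> v != r -> v \notin P -> 3 <= #|L v|.
Proof.
move=> vW vr vP; have [rv|rv] := boolP (e r v); first exact: (good_3 G).
by apply: leq_trans (good_5 G vW vr rv).
Qed.

Lemma root_proper : W :\ r \proper W.
Proof. by rewrite properD1 // (good_r G). Qed.

(* Once all neighbours of [r] are precoloured, [r] is useless and a coloured
   vertex takes over its role. *)
Lemma step_root : nb e W r \subset P -> col e (W :\ r) L.
Proof.
move=> NP; have [W0|/set0Pn[x1 x1W]] := eqVneq (W :\ r) set0.
  by rewrite W0; exists (fun=> c0); split=> [v|u v]; rewrite inE.
(* A vertex of [P] is preferred: the rest of the clique is then in its neighbourhood and serves as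
   the new precoloured set. *)
have [x [xW xr Px]] : exists x, [/\ x \in W, x != r & P != set0 -> x \in P].
  have [P0|/set0Pn[x xP]] := eqVneq P set0.
    by exists x1; move: x1W; rewrite !inE => /andP[].
  by have [xW _ xr] := P_mem xP; exists x.
have Lx : 0 < #|L x|.
  have [xP|xP] := boolP (x \in P); first by rewrite (good_single G xP).
  by apply: leq_trans (list3 xW xr xP).
have /card_gt0P[c cLx] := Lx.
apply: (col_vertex (v := x) (c := c)) => //.
apply: (@IH e _ x (P :\ x)); first by apply: measure_lt root_proper.
have Px' p : p \in P -> x \in P by move=> pP; apply: Px; apply/set0Pn; exists p.
(* The singleton lists on [P] are distinct, so removing the colour of [x] does not touch the
   others. *)
have dP p : p \in P :\ x -> L p :\ c = L p.
  rewrite !inE => /andP[px pP]; apply/setP => d; rewrite !inE.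
  case: eqP => // -> /=; apply/esym/negP => cp.
  have xP := Px' _ pP; have /negP := good_diff G pP xP px; apply.
  have /eqP/cards1P[d1 e1] := good_single G pP; have /eqP/cards1P[d2 e2] := good_single G xP.
  by move: cp cLx; rewrite e1 e2 !inE => /eqP <- /eqP <-.
split=> //.
- by apply: K5free_sub (good_K5 G) => //; apply: subsetDl.
- by rewrite !inE xr.
- apply/subsetP => p; rewrite in_nb !inE => /andP[px pP].
  have [pW rp pr] := P_mem pP; rewrite pW pr /=.
  by apply: (good_clique G); rewrite ?(Px' p) // eq_sym.
- by apply: leq_trans (subset_leq_card (subsetDl _ _)) (good_P2 G).
- by move=> p q; rewrite !inE => /andP[_ pP] /andP[_ qP]; apply: (good_clique G).
- move=> p pP; rewrite dP //; move: pP; rewrite !inE => /andP[_ pP].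
  by case: ifP => _; rewrite (good_single G).
- move=> p q pP qP pq; rewrite !dP // !if_same.
  by move: pP qP; rewrite !inE => /andP[_ pP] /andP[_ qP]; apply: (good_diff G).
- move=> v; rewrite !inE => /andP[vr vW] xv; rewrite xv => vP.
  have vx : v != x by apply: contraTneq xv => ->; rewrite ie.
  rewrite vx /= in vP.
  have rv : ~~ e r v by apply: contra vP => rv; apply: (subsetP NP); rewrite in_nb vW.
  by have := good_5 G vW vr rv; have := card_setD1_ge (L v) c; nlia.
move=> v; rewrite !inE => /andP[vr vW] vx xv; rewrite (negPf xv).
apply: (good_5 G vW vr); apply: contra xv => rv.
have vP : v \in P by apply: (subsetP NP); rewrite in_nb vW.
by apply: (good_clique G); rewrite ?(Px' v) // eq_sym.
Qed.

(** Two vertices of [P] on different sides would be joined by an edge across the cut. *)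
Lemma clique_side X Y : ~~ adjs e X Y -> P \subset X :|: Y ->
  P \subset X \/ P \subset Y.
Proof.
move=> XY PXY; have [|/subsetPn[p pP pX]] := boolP (P \subset X); first by left.
right; apply/subsetP => q qP; have := subsetP PXY q qP; rewrite inE => /orP[qX|//].
have := subsetP PXY p pP; rewrite inE (negPf pX) => pY.
have pq : q != p by apply: contraNneq pX => <-.
by have := good_clique G qP pP pq; rewrite (adjsN XY qX pY).
Qed.

(** The sides meet only in [r], which gets no colour, so they are coloured independently; the side
    without [P] starts with an empty precoloured set. *)
Lemma step_cut1 X : X \subset W :\ r -> X != set0 -> X != W :\ r ->
  ~~ adjs e X (W :\ r :\: X) -> P \subset X -> col e (W :\ r) L.
Proof.
move=> XW X0 Xn XY PX; set Y := W :\ r :\: X in XY.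
have Yp : Y \proper W :\ r.
  rewrite properE subsetDl /=; apply: contra X0 => /subsetP h; apply/eqP/setP => x.
  rewrite inE; apply/negP => xX; have := h x (subsetP XW x xX).
  by rewrite inE xX.
have Xp : X \proper W :\ r by rewrite properEneq Xn.
have prop Z : Z \proper W :\ r -> r |: Z \proper W.
  case/properP=> ZW [z zW zZ]; apply/properP; split.
    by rewrite subUset sub1set (good_r G) (subset_trans ZW (subsetDl _ _)).
  by exists z; move: zW; rewrite !inE => /andP[zr zW] //; rewrite negb_or zr.
have sub Z P' : Z \proper W :\ r -> P' \subset P -> P' \subset Z -> P :&: Z \subset P' ->
   good e (r |: Z) r P' L.
  move=> ZW PP PZ ZP; have ZW' := proper_sub (prop Z ZW); have PG p := subsetP PP p.
  split=> //.
  - by apply: K5free_sub (good_K5 G).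
  - by rewrite !inE eqxx.
  - apply/subsetP => p pP'; rewrite in_nb !inE (subsetP PZ) // orbT.
    by have [] := P_mem (PG p pP').
  - by apply: leq_trans (subset_leq_card PP) (good_P2 G).
  - by move=> p q /PG pP /PG qP; apply: (good_clique G).
  - by move=> p /PG; apply: (good_single G).
  - by move=> p q /PG pP /PG qP; apply: (good_diff G).
  - move=> v vZ rv vP; apply: (good_3 G) => //; first exact: (subsetP ZW').
    apply: contra vP => vP; apply: (subsetP ZP); rewrite inE vP.
    by move: vZ; rewrite !inE; case: eqP rv => // ->; rewrite ie.
  by move=> v vZ; apply: (good_5 G); apply: (subsetP ZW').
have rZ Z : Z \proper W :\ r -> (r |: Z) :\ r = Z.
  move=> ZW; rewrite setU1K //; apply/negP => /(subsetP (proper_sub ZW)).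
  by rewrite !inE eqxx.
have [phi1 [a1 b1]] := IH (measure_lt P (prop X Xp)) (sub X P Xp (subxx _) PX (subsetIl _ _)).
have PY : P :&: Y \subset set0.
  apply/subsetP => p; rewrite inE => /andP[/(subsetP PX) pX].
  by rewrite inE pX.
have [phi2 [a2 b2]] := IH (measure_lt set0 (prop Y Yp)) (sub Y set0 Yp (sub0set _) (sub0set _) PY).
rewrite !rZ // in a1 b1 a2 b2.
have inY v : v \in W :\ r -> v \notin X -> v \in Y by move=> vW vX; rewrite inE vX.
exists (fun v => if v \in X then phi1 v else phi2 v); split=> [v vW|u v uW vW uv].
  by case: ifPn => vX; [apply: a1|apply: a2; apply: inY].
case: ifPn => uX; case: ifPn => vX.
- exact: b1.
- by rewrite (adjsN XY uX (inY v vW vX)) in uv.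
- by rewrite se (adjsN XY vX (inY u uW uX)) in uv.
by apply: b2 => //; apply: inY.
Qed.

Lemma step_conn : ~~ nsep e (W :\ r) -> col e (W :\ r) L.
Proof.
move=> /nsepN[X [XW X0 Xn nX]].
have PX : P \subset X :|: (W :\ r :\: X).
  apply/subsetP => p /P_mem[pW _ pr]; rewrite !inE pW pr.
  by case: (p \in X).
case: (clique_side nX PX) => PX'; first exact: (step_cut1 (X := X)).
apply: (step_cut1 (X := W :\ r :\: X)) => //.
- exact: subsetDl.
- by rewrite setD_eq0; apply: contra Xn => h; rewrite eqEsubset XW.
- apply: contra X0 => /eqP h; apply/eqP/setP => x; rewrite inE; apply/negP => xX.
  by have := subsetP XW x xX; rewrite -h inE xX.
have -> : W :\ r :\: (W :\ r :\: X) = X by rewrite setDDr setDv set0U; apply/setIidPr.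
by rewrite adjs_sym.
Qed.

(* Contracting one closed side of the separator [r |: z |: A] into [z] makes
   [z] a neighbour of [A], and of [r] as soon as that side meets [r]. *)
Lemma step_split_side A z X Y : A \subset nb e W r -> #|A| <= 1 -> z \in W :\ r -> z \notin A ->
  X :|: Y = W :\ r :\: A :\ z -> [disjoint X & Y] -> ~~ adjs e X Y ->
  X != set0 -> Y != set0 -> conn e (z |: X) -> conn e (z |: Y) ->
  (forall v, v \in A -> adjs e [set v] X) -> (forall v, v \in A -> adjs e [set v] Y) ->
  P \subset X :|: (z |: A) -> ~~ adjs e [set r] (z |: Y) \/ adjs e [set r] (z |: X) ->
  col e (W :\ r) L.
Proof.
move=> AN A1 zW zA XYS dXY nXY X0 Y0 cX cY AX AY PX rXY.
have inXY v : (v \in X) || (v \in Y) = [&& v != z, v \notin A, v != r & v \in W].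
  by rewrite -in_setU XYS !inE.
have XW v : v \in X -> [/\ v != z, v \notin A, v != r & v \in W].
  by move=> vX; apply/and4P; rewrite -inXY vX.
have YW v : v \in Y -> [/\ v != z, v \notin A, v != r & v \in W].
  by move=> vY; apply/and4P; rewrite -inXY vY orbT.
have /andP[zr zW'] : (z != r) && (z \in W) by rewrite !inE in zW.
have rz : r != z by rewrite eq_sym.
have AW v : v \in A -> [/\ v \in W, v != r, v != z & e r v].
  move=> vA; have := subsetP AN v vA; rewrite in_nb => /andP[-> rv]; split=> //.
    by apply: contraTneq rv => ->; rewrite ie.
  by apply: contraNneq zA => <-.
have Aeq u v : u \in A -> v \in A -> u = v by move/card_le1P: A1 => h /h -> /eqP.
have side Z Z' : Z :|: Z' = X :|: Y -> [disjoint Z & Z'] -> Z' != set0 -> conn e (z |: Z') ->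
  (forall v, v \in A -> adjs e [set v] Z') -> 
  [/\ K5free (contract e (z |: Z') z) (W :\: Z'), W :\: Z' \proper W &
      forall v, v \in A -> contract e (z |: Z') z z v].
  move=> ZZ dZ Z'0 cZ' AZ'.
  have Z'W v : v \in Z' -> [/\ v != z, v \notin A, v != r & v \in W].
    by move=> vZ; apply/and4P; rewrite -inXY -in_setU -ZZ inE vZ orbT.
  split.
  - apply: K5free_contract (good_K5 G) => //.
    + by rewrite !inE eqxx.
    + by rewrite subUset sub1set zW'; apply/subsetP => v /Z'W[].
    + exact: subsetDl.
    by apply/subsetP => v; rewrite !inE; case: (v \in Z'); rewrite ?orbF // => /andP[].
  - apply/properP; split; first exact: subsetDl.
    by have /set0Pn[v vZ] := Z'0; exists v; rewrite ?inE ?vZ //; case: (Z'W v vZ).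
  move=> v vA; have [_ _ vz _] := AW v vA; rewrite contractEq //.
  by apply: adjs_sub (AZ' v vA) => //; apply: subsetUr.
have [K1 W1 A1z] := side X Y erefl dXY Y0 cY AY.
have [K2 W2 A2z] := side Y X (setUC Y X) ltac:(by rewrite disjoint_sym) X0 cX AX.
(* [e1] keeps [X] and shrinks the other side to [z]; [e2] does the same for [Y]. *)
pose e1 : rel V := contract e (z |: Y) z; pose e2 : rel V := contract e (z |: X) z.
have {}K1 : K5free e1 (W :\: Y) := K1; have {}K2 : K5free e2 (W :\: X) := K2.
have {}A1z v : v \in A -> e1 z v := A1z v; have {}A2z v : v \in A -> e2 z v := A2z v.
have in1 u v : e u v -> e1 u v by apply: contract_incl => //; rewrite !inE eqxx.
have in2 u v : e u v -> e2 u v by apply: contract_incl => //; rewrite !inE eqxx.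
have se1 : symmetric e1 by apply: contract_sym.
have ie1 : irreflexive e1 by apply: contract_irr.
have se2 : symmetric e2 by apply: contract_sym.
have ie2 : irreflexive e2 by apply: contract_irr.
have e2z a : a != z -> e2 z a = adjs e [set a] (z |: X) by apply: contractEq.
clearbody e1 e2.
have PY p : p \in P -> p \notin Y.
  move=> /(subsetP PX); rewrite !inE => /orP[pX|/orP[/eqP->|pA]].
  - by rewrite (disjointFr dXY).
  - by apply/negP => /YW[]; rewrite eqxx.
  by apply/negP => /YW[_]; rewrite pA.
have rY : r \notin Y by apply/negP => /YW[_ _]; rewrite eqxx.
have rX : r \notin X by apply/negP => /XW[_ _]; rewrite eqxx.
have G1 : good e1 (W :\: Y) r P L.
  split=> //.
  - by rewrite inE rY (good_r G).
  - by apply/subsetP => p pP; have [pW rp pr] := P_mem pP; rewrite in_nb inE PY ?pW // in1.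
  - exact: (good_P2 G).
  - by move=> p q pP qP pq; apply: in1; apply: (good_clique G).
  - exact: (good_single G).
  - exact: (good_diff G).
  - move=> v; rewrite inE => /andP[_ vW] rv vP; apply: list3 => //.
    by apply: contraTneq rv => ->; rewrite ie1.
  move=> v; rewrite inE => /andP[_ vW] vr rv; apply: (good_5 G) => //.
  by apply: contra rv; apply: in1.
have [phi1 [a1 b1]] := IH (measure_lt P W1) G1.
have mem1 v : v \in W -> v != r -> v \notin Y -> v \in W :\: Y :\ r by move=> *; rewrite !inE; apply/and3P.
have zY : z \notin Y by apply/negP => /YW[]; rewrite eqxx.
have AnY v : v \in A -> v \notin Y by move=> vA; apply/negP => /YW[_]; rewrite vA.
(* [X] is coloured first. As [z] is adjacent to [A] in [e1], the colours obtained on [z |: A] are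
   distinct and can be prescribed for the other side. *)
have zAd v : v \in A -> phi1 z != phi1 v.
  by move=> vA; have [vW vr _ _] := AW v vA; apply: b1; [apply: mem1|apply: mem1 => //; apply: AnY|apply: A1z].
suff [phi2 [a2 b2 d2]] : exists phi2, [/\ forall v, v \in Y -> phi2 v \in L v,
    forall u v, u \in Y -> v \in Y -> e u v -> phi2 u != phi2 v &
    forall u v, u \in Y -> v \in z |: A -> e u v -> phi2 u != phi1 v].
  have cross u v : u \in Y -> v \in W -> v != r -> v \notin Y -> e u v -> phi2 u != phi1 v.
    move=> uY vW vr vY uv; apply: d2 => //; apply: contraTT uv; rewrite !inE negb_or => /andP[vz vA].
    have vX : v \in X by have := inXY v; rewrite (negPf vY) orbF vz vA vr vW.
    by rewrite se (adjsN nXY).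
  exists (fun v => if v \in Y then phi2 v else phi1 v); split=> [v|u v].
    rewrite !inE => /andP[vr vW]; case: ifPn => vY; first exact: a2.
    by apply: a1; apply: mem1.
  rewrite !inE => /andP[ur uW] /andP[vr vW] uv; case: ifPn => uY; case: ifPn => vY.
  - exact: b2.
  - exact: cross.
  - by rewrite eq_sym; apply: cross => //; rewrite se.
  by apply: b1; rewrite ?in1 ?mem1.
have Y3 v : v \in Y -> [/\ v \in W, v != r, v != z & v \notin P].
  by move=> vY; have [vz vA vr vW] := YW v vY; split=> //; apply: contraTN vY; apply: PY.
have YWX v : v \in Y -> v \in W :\: X.
  by move=> vY; rewrite inE (disjointFl dXY) //; case: (YW v vY).
have inW2 v : v \in W -> [|| v == r, v == z, v \in A | v \in X] || (v \in Y).
  move=> vW; have := inXY v; rewrite vW andbT.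
  by case: (v \in X); case: (v \in Y); case: (v == r); case: (v == z); case: (v \in A).
have AWX v : v \in A -> v \in W :\: X.
  by move=> vA; have [vW _ _ _] := AW v vA; rewrite inE vW andbT; apply/negP => /XW[_]; rewrite vA.
have zWX : z \in W :\: X.
  by rewrite inE zW' andbT; apply/negP => /XW[]; rewrite eqxx.
(* If [r] meets [z |: X], then [z] is a neighbour of [r] in [e2], and [z |: A] is a legitimate
   precoloured clique. *)
have [rX'|rX'] := boolP (adjs e [set r] (z |: X)).
  pose L2 v := if v \in z |: A then [set phi1 v] else L v.
  have [||phi2 [a2 b2]] := @IH e2 (W :\: X) r (z |: A) L2; first exact: measure_lt.
    have zA2 p q : p \in z |: A -> q \in z |: A -> p != q ->
        (p = z /\ q \in A) \/ (q = z /\ p \in A).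
      rewrite !inE => /orP[/eqP->|pA] /orP[/eqP->|qA]; rewrite ?eqxx //; [by left|by right|].
      by rewrite (Aeq p q) ?eqxx.
    split=> //.
    - by rewrite inE rX (good_r G).
    - apply/subsetP => p; rewrite in_nb !inE => /orP[/eqP->|pA].
        by rewrite -in_setD zWX se2 e2z.
      by rewrite -in_setD AWX // in2 //; have [_ _ _] := AW p pA.
    - by rewrite cardsU1 zA; move: A1; clear; lia.
    - move=> p q pA qA pq; case: (zA2 p q pA qA pq) => [[-> h]|[-> h]]; first exact: A2z.
      by rewrite se2 A2z.
    - by move=> p pA; rewrite /L2 pA cards1.
    - move=> p q pA qA pq; rewrite /L2 pA qA; apply/eqP => /set1_inj.
      case: (zA2 p q pA qA pq) => [[-> h]|[-> h]]; first exact/eqP/zAd.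
      by apply/eqP; rewrite eq_sym zAd.
    - move=> v; rewrite inE => /andP[vX vW] rv vA; rewrite /L2 (negPf vA).
      have vr : v != r by apply: contraTneq rv => ->; rewrite ie2.
      have vY : v \in Y.
        by have := inW2 v vW; move: vA; rewrite !inE (negPf vr) (negPf vX) orbF negb_or => /andP[/negPf-> /negPf->].
      by have [_ _ _ vP] := Y3 v vY; apply: list3.
    move=> v; rewrite inE => /andP[vX vW] vr rv; rewrite /L2; case: ifPn => vA.
      case/negP: rv; move: vA; rewrite !inE => /orP[/eqP->|vA].
        by rewrite se2 e2z.
      by apply: in2; case: (AW v vA).
    by apply: (good_5 G) => //; apply: contra rv; apply: in2.
  have mem2 v : v \in W :\: X -> v != r -> v \in W :\: X :\ r by move=> h1 h2; rewrite in_setD1 h2.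
  have nzA v : v \in Y -> v \notin z |: A.
    by move=> /YW[vz vA _ _]; rewrite !inE negb_or vz.
  exists phi2; split=> [v vY|u v uY vY uv|u v uY vA uv].
  - have [_ vr _ _] := Y3 v vY.
    by have := a2 v (mem2 v (YWX v vY) vr); rewrite /L2 (negPf (nzA v vY)).
  - have [_ vr _ _] := Y3 v vY; have [_ ur _ _] := Y3 u uY.
    by apply: b2; rewrite ?in2 ?mem2 ?YWX.
  have [_ ur _ _] := Y3 u uY.
  have [vWX vr] : v \in W :\: X /\ v != r.
    by move: vA; rewrite in_setU1 => /orP[/eqP->//|vA]; split; [apply: AWX|case: (AW v vA)].
  have := a2 v (mem2 v vWX vr); rewrite /L2 vA => /set1P <-.
  by apply: b2; [apply: mem2 => //; apply: YWX|apply: mem2|apply: in2].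
(* Otherwise [r] has no neighbour in [z |: Y], so all lists on [Y] have 5 colours. Then [r] is
   dropped and [z] becomes the root with precoloured set [A]; its neighbours lose just one
   colour. *)
have rY' : ~~ adjs e [set r] (z |: Y) by case: rXY => //; rewrite (negPf rX').
have rYe v : v \in Y -> ~~ e r v.
  by move=> vY; apply/negP; rewrite (adjsN rY') // !inE ?vY ?orbT.
pose L3 v := if v \in A then [set phi1 v] else if e2 z v then L v :\ phi1 z else L v.
have [||phi3 [a3 b3]] := @IH e2 (W :\: X :\ r) z A L3.
- by apply: measure_lt; rewrite ?(sub_proper_trans _ W2) // subsetDl.
- have vin v : v \in W :\: X :\ r -> v \notin A -> v != z -> v \in Y.
    rewrite !inE => /and3P[vr vX vW] vA vz.
    by have := inW2 v vW; rewrite (negPf vr) (negPf vX) (negPf vz) (negPf vA).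
  have L5 v : v \in Y -> 5 <= #|L v|.
    by move=> vY; have [vW vr _ _] := Y3 v vY; apply: (good_5 G); rewrite ?rYe.
  split=> //.
  - by apply: K5free_sub K2 => //; apply: subsetDl.
  - by rewrite in_setD1 zWX zr.
  - apply/subsetP => p pA; have [_ pr _ _] := AW p pA.
    by rewrite in_nb in_setD1 pr AWX //= A2z.
  - by move: A1; clear; lia.
  - by move=> p q pA qA; rewrite (Aeq p q) ?eqxx.
  - by move=> p pA; rewrite /L3 pA cards1.
  - by move=> p q pA qA; rewrite (Aeq p q) ?eqxx.
  - move=> v vW zv vA; rewrite /L3 (negPf vA) zv.
    have vz : v != z by apply: contraTneq zv => ->; rewrite ie2.
    by have := L5 v (vin v vW vA vz); have := card_setD1_ge (L v) (phi1 z); nlia.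
  move=> v vW vz zv; rewrite /L3 (negPf zv); case: ifPn => vA; last exact: L5 (vin v vW vA vz).
  by rewrite A2z in zv.
have mem3 v : v \in Y -> v \in W :\: X :\ r :\ z.
  by move=> vY; have [_ vr vz _] := Y3 v vY; rewrite in_setD1 in_setD1 YWX // vr vz.
have L3Y v : v \in Y -> phi3 v \in if e2 z v then L v :\ phi1 z else L v.
  by move=> vY; have := a3 v (mem3 v vY); rewrite /L3; have [_ /negPf-> _ _] := YW v vY.
exists phi3; split=> [v vY|u v uY vY uv|u v uY vA uv].
- by have := L3Y v vY; case: ifP => // _; rewrite inE => /andP[].
- by apply: b3; rewrite ?in2 ?mem3.
move: vA uv; rewrite in_setU1 => /orP[/eqP-> uz|vA uv].
  have zu : e2 z u by apply: in2; rewrite se.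
  by have := L3Y u uY; rewrite zu !inE => /andP[].
have [_ vr vz _] := AW v vA.
have vm : v \in W :\: X :\ r :\ z by rewrite in_setD1 in_setD1 AWX // vr vz.
have := a3 v vm; rewrite /L3 vA => /set1P <-.
by apply: b3; [apply: mem3|apply: vm|apply: in2].
Qed.

(** The separator consists of [r], [z] and [A]. Smaller sets do not separate, so each side is
    connected together with [z] and is adjacent to every vertex of [A]; this is what the contraction
    of either side requires. *)
Lemma step_split A z : A \subset nb e W r -> #|A| <= 1 -> z \in W :\ r -> z \notin A ->
  nsep e (W :\ r :\: A) -> (forall v, v \in A -> nsep e (W :\ r :\ z)) ->
  ~~ nsep e (W :\ r :\: A :\ z) -> col e (W :\ r) L.
Proof.
move=> AN A1 zW zA nA nz /nsepN[X [XS X0 Xn nX]].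
set S := W :\ r :\: A :\ z in XS Xn nX; set Y := S :\: X in nX.
have XY : X :|: Y = S.
  apply/setP => v; rewrite in_setU in_setD.
  by case: (boolP (v \in X)) => //= vX; rewrite (subsetP XS).
have Y0 : Y != set0 by rewrite setD_eq0; apply: contra Xn => h; rewrite eqEsubset XS.
have dXY : [disjoint X & Y] by rewrite disjoint_sym disjoints_subset /Y setDE subsetIr.
have cA : conn e (W :\ r :\: A).
  by apply: (nsep_conn (x := z)) => //; rewrite inE zA.
have half Z Z' : Z :|: Z' = S -> [disjoint Z & Z'] -> ~~ adjs e Z Z' -> Z != set0 ->
  conn e (z |: Z) /\ forall v, v \in A -> adjs e [set v] Z.
  move=> ZS dZ nZ Z0.
  have ZinS v : v \in Z -> [/\ v != z, v \notin A, v != r & v \in W].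
    move=> vZ; have : v \in S by rewrite -ZS inE vZ.
    by rewrite !inE => /and4P.
  split.
    have -> : z |: Z = W :\ r :\: A :\: Z'.
      apply/setP => v; rewrite in_setU1 in_setD.
      have : (v \in Z :|: Z') = (v \in S) by rewrite ZS.
      rewrite in_setU in_setD1.
      have := disjointFr dZ (x := v); have := disjointFl dZ (x := v).
      case: (v \in Z); case: (v \in Z') => //=; rewrite ?orbT ?orbF //.
      - by move=> /(_ isT).
      - by move=> _ _ /esym/andP[_ ->].
      - by move=> _ _ /esym/andP[/negPf].
      - by move=> _ _; have [->|] := eqVneq v z => //= _; rewrite inE zA zW.
    apply: (conn_setD (B := [set z])); rewrite ?conn1 //.
    - by rewrite sub1set inE zA.
    - by rewrite -/S -ZS subsetUr.
    rewrite -/S adjs_sym //; apply: contra nZ; apply: adjs_sub => //.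
    by rewrite -ZS setDUl setDv setU0 subsetDl.
  move=> v vA; have := nsepP (nz v vA) (X := Z).
  have -> : Z \subset W :\ r :\ z.
    by apply/subsetP => u /ZinS[uz uA ur uW]; rewrite !inE uz ur.
  have -> : Z != W :\ r :\ z.
    apply/eqP => /setP/(_ v); have /negPf-> : v \notin Z by apply/negP => /ZinS[_]; rewrite vA.
    have := subsetP AN v vA; rewrite in_nb => /andP[vW rv]; rewrite !inE vW andbT.
    have -> : v != z by apply: contraNneq zA => <-.
    by case: eqP rv => // ->; rewrite ie.
  rewrite Z0 => /(_ isT isT isT) /adjsP[x [y [xZ]]].
  rewrite in_setD => /andP[yZ yW] xy; rewrite adjs_sym //.
  apply/adjsP; exists x, y; split=> //; rewrite inE.
  have [yA|yA] := boolP (y \in A); first by move/card_le1P: A1 => /(_ v vA y); rewrite yA inE => /esym.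
  have : y \in S by move: yW; rewrite !inE yA.
  by rewrite -ZS inE (negPf yZ) /= => yZ'; rewrite (adjsN nZ) in xy.
have [cX AX] := half X Y XY dXY nX X0.
have dYX : [disjoint Y & X] by rewrite disjoint_sym.
have YX : Y :|: X = S by rewrite setUC.
have nX' : ~~ adjs e Y X by rewrite adjs_sym.
have [cY AY] := half Y X YX dYX nX' Y0.
have PS : P \subset S :|: (z |: A).
  apply/subsetP => p /P_mem[pW _ pr]; rewrite !inE pW pr !andbT.
  by case: (p == z); case: (p \in A).
have AW p : p \in A -> e r p.
  by move=> pA; have := subsetP AN p pA; rewrite in_nb => /andP[].
have main Z Z' : Z :|: Z' = S -> [disjoint Z & Z'] -> ~~ adjs e Z Z' -> Z != set0 -> Z' != set0 ->
   conn e (z |: Z) -> conn e (z |: Z') ->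
   (forall v, v \in A -> adjs e [set v] Z) -> (forall v, v \in A -> adjs e [set v] Z') ->
   P \subset Z :|: (z |: A) -> col e (W :\ r) L.
  move=> ZS dZ nZ Z0 Z'0 cZ cZ' AZ AZ' PZ.
  (* [Z] is coloured first if [r] meets [z |: Z] or meets neither side. If [r] meets only [z |: Z'],
     its neighbours in [P] must lie in [A], so the sides may be exchanged. *)
  have [rZ|rZ] := boolP (adjs e [set r] (z |: Z)).
    by apply: (@step_split_side A z Z Z') => //; right.
  have [rZ'|rZ'] := boolP (adjs e [set r] (z |: Z')); last first.
    by apply: (@step_split_side A z Z Z') => //; left.
  apply: (@step_split_side A z Z' Z) => //.
  - by rewrite setUC.
  - by rewrite disjoint_sym.
  - by rewrite adjs_sym.
  - apply/subsetP => p pP; have [_ rp _] := P_mem pP.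
    have := subsetP PZ p pP; rewrite !inE orbA => /orP[|->]; last by rewrite !orbT.
    by rewrite orbC => pz; rewrite (adjsN rZ) ?inE in rp.
  by left.
have PXY : P :\: (z |: A) \subset X :|: Y.
  apply/subsetP => p; rewrite inE XY => /andP[pzA pP].
  by have := subsetP PS p pP; rewrite inE (negPf pzA) orbF.
have [PX|] := boolP (P \subset X :|: (z |: A)); first exact: (main X Y).
case/subsetPn=> p pP; rewrite inE negb_or => /andP[pX pzA].
apply: (main Y X) => //; apply/subsetP => q qP; rewrite inE.
have [//|qzA] := boolP (q \in z |: A); first by rewrite orbT.
have pY : p \in Y.
  by have := subsetP PXY p; rewrite in_setD pzA pP in_setU (negPf pX) => /(_ isT).
have := subsetP PXY q; rewrite in_setD qzA qP in_setU => /(_ isT) /orP[qX|->//].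
have pq : q != p by apply: contraNneq pX => <-.
by have := good_clique G qP pP pq; rewrite (adjsN nX qX pY).
Qed.

(* [v] keeps two colours in reserve, which its neighbours outside [N(r)] give
   up; it is coloured last, once its neighbour [w] has got its colour. *)
Lemma step_absorb v w A : v \in nb e W r -> v \notin P -> A \subset P -> #|A| <= 1 ->
  nb e (nb e W r) v \subset w |: A -> col e (W :\ r) L.
Proof.
rewrite in_nb => /andP[vW rv] vP AP A1 Nv.
have vr : v != r by apply: contraTneq rv => ->; rewrite ie.
pose LA := \bigcup_(a in A) L a.
have LA1 : #|LA| <= 1.
  have [A0|/set0Pn[a aA]] := eqVneq A set0; first by rewrite /LA A0 big_set0 cards0.
  have Aa : A = [set a] by apply/eqP; rewrite eq_sym eqEcard sub1set aA cards1.
  by rewrite /LA Aa big_set1 (good_single G) // (subsetP AP).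
(* At least three colours at [v], less at most one used on [A], leave two for the reserve. *)
have [J [_ JL J2]] : exists J : {set C}, [/\ set0 \subset J, J \subset L v :\: LA & #|J| = 2].
  apply: card_between; rewrite ?sub0set // cards0 /=.
  have := card_setD_ge (L v) LA; have := good_3 G vW rv vP; nlia.
(* With [v] contracted into [r], the neighbours of [v] outside [N(r)] become neighbours of the root,
   so going down from 5 colours to 3 is allowed. *)
pose e' : rel V := contract e [set r; v] r.
pose L' u := if e v u && ~~ e r u then L u :\: J else L u.
have e'E a b : a != r -> b != r -> e' a b = e a b by apply: contractE.
have e'r a : a != r -> e' r a = e r a || e v a.
  move=> ar; have -> : e' r a = adjs e [set a] [set r; v] by apply: contractEq.
  rewrite adjs1; apply/exists_inP/orP => [[b]|[ra|va]].
  - by rewrite !inE => /orP[] /eqP->; rewrite se; [left|right].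
  - by exists r; rewrite ?inE ?eqxx // se.
  by exists v; rewrite ?inE ?eqxx ?orbT // se.
have Wv : W :\ v \proper W by rewrite properD1.
have nr u : e' r u -> u != r.
  by apply: contraTneq => ->; have -> : e' r r = false by apply: contract_irr.
have [|phi [h1 h2]] := IH (measure_lt P Wv) (_ : good e' (W :\ v) r P L').
  split.
  - exact: contract_sym.
  - exact: contract_irr.
  - apply: K5free_contract (good_K5 G).
    + by rewrite !inE eqxx.
    + by rewrite subUset !sub1set (good_r G).
    + by rewrite -[v]/v; apply: connU; rewrite ?conn1 ?adjs11 ?rv ?orbT.
    + exact: subsetDl.
    by apply/subsetP => u; rewrite !inE => /andP[/andP[/negPf-> _]]; rewrite orbF.
  - by rewrite !inE eq_sym vr (good_r G).
  - apply/subsetP => p pP; have [pW rp pr] := P_mem pP.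
    rewrite in_nb !inE pW e'r // rp !andbT.
    by apply: contraNneq vP => <-.
  - exact: (good_P2 G).
  - move=> p q pP qP pq; have [_ _ pr] := P_mem pP; have [_ _ qr] := P_mem qP.
    by rewrite e'E //; apply: (good_clique G).
  - by move=> p pP; have [_ rp _] := P_mem pP; rewrite /L' rp andbF (good_single G).
  - move=> p q pP qP pq; have [_ rp _] := P_mem pP; have [_ rq _] := P_mem qP.
    by rewrite /L' rp rq !andbF (good_diff G).
  - move=> u; rewrite !inE => /andP[uv uW] ru uP; have ur := nr u ru.
    rewrite /L'; case: ifPn => [/andP[vu ru']|]; last by rewrite list3.
    by have := good_5 G uW ur ru'; have := card_setD_ge (L u) J; nlia.
  move=> u; rewrite !inE => /andP[uv uW] ur; rewrite e'r // negb_or => /andP[ru vu].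
  by rewrite /L' (negPf vu); apply: (good_5 G).
have [c cJ cw] : exists2 c, c \in J & c != phi w by apply: card_other; rewrite J2.
have /setDP[cL cLA] := subsetP JL c cJ.
have mem u : u \in W -> u != r -> u != v -> u \in W :\ v :\ r by move=> *; rewrite !inE; apply/and3P.
have LL u : u \in W -> u != r -> u != v -> phi u \in L' u by move=> *; apply/h1/mem.
have cP u : u \in W -> u != r -> u != v -> e v u -> phi u != c.
  move=> uW ur uv vu; have := LL u uW ur uv; rewrite /L' vu /=.
  case: (boolP (e r u)) => ru /=; last first.
    by rewrite !inE => /andP[+ _]; apply: contraNneq => ->.
  have : u \in w |: A by apply: (subsetP Nv); rewrite !in_nb uW ru.
  rewrite in_setU1 => /orP[/eqP->|uA] phiL; first by rewrite eq_sym.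
  by apply: contraNneq cLA => <-; apply/bigcupP; exists u.
exists (fun u => if u == v then c else phi u); split=> [u|u u'].
  rewrite !inE => /andP[ur uW]; case: (eqVneq u v) => [->//|uv].
  by have := LL u uW ur uv; rewrite /L'; case: ifP => // _; rewrite inE => /andP[].
rewrite !inE => /andP[ur uW] /andP[u'r u'W] uu'.
have [uE|uv] := eqVneq u v; have [u'E|u'v] := eqVneq u' v; rewrite ?uE ?u'E in uu' *.
- by rewrite ie in uu'.
- by rewrite eq_sym; apply: cP.
- by apply: cP; rewrite // se.
by apply: h2; rewrite ?mem // e'E.
Qed.

(** [y] gets a colour unlike that of [P] and joins the precoloured clique. [W] is unchanged; this is
    the step for which the measure subtracts the size of [P]. *)
Lemma step_extend y : #|P| <= 1 -> y \in nb e W r -> y \notin P ->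
  (forall p, p \in P -> e p y) -> col e (W :\ r) L.
Proof.
rewrite in_nb => P1 /andP[yW ry] yP Py.
have yr : y != r by apply: contraTneq ry => ->; rewrite ie.
have [c cL cP] : exists2 c, c \in L y & c \notin \bigcup_(p in P) L p.
  apply: card_lt_ex; apply: leq_trans (list3 yW yr yP).
  have [->|/set0Pn[p pP]] := eqVneq P set0; first by rewrite big_set0 cards0.
  have Pp : P = [set p] by apply/eqP; rewrite eq_sym eqEcard sub1set pP cards1.
  by rewrite Pp big_set1 (good_single G).
pose L' u := if u == y then [set c] else L u.
have LL u : L' u \subset L u by rewrite /L'; case: eqP => [->|_//]; rewrite sub1set.
have yp p : p \in P -> p != y by move=> pP; apply: contraNneq yP => <-.
have Lp p : p \in P -> L' p = L p by rewrite /L' => /yp/negPf->.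
have cp p : p \in P -> L p != [set c].
  move=> pP; apply: contraNneq cP => Lpc; apply/bigcupP; exists p => //.
  by rewrite Lpc inE.
apply: (@col_sub e e (W :\ r) (W :\ r) L' L) => //.
apply: (@IH e W r (y |: P) L').
  have W0 : 0 < #|W| by apply/card_gt0P; exists r; apply: (good_r G).
  by rewrite cardsU1 yP; move: W0 P1 Wn; clear; lia.
split=> //.
- exact: (good_K5 G).
- exact: (good_r G).
- by rewrite subUset sub1set in_nb yW ry (good_P G).
- by rewrite cardsU1 yP; move: P1; clear; lia.
- move=> p q; rewrite !inE => /orP[/eqP->|pP] /orP[/eqP->|qP]; rewrite ?eqxx // => pq.
  + by rewrite se Py.
  + exact: Py.
  exact: (good_clique G).
- move=> p; rewrite !inE => /orP[/eqP->|pP]; first by rewrite /L' eqxx cards1.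
  by rewrite Lp // (good_single G).
- have Ly : L' y = [set c] by rewrite /L' eqxx.
  move=> p q; rewrite !inE => /orP[/eqP->|pP] /orP[/eqP->|qP]; rewrite ?eqxx // => pq.
  + by rewrite Ly Lp // eq_sym cp.
  + by rewrite Ly Lp // cp.
  by rewrite !Lp // (good_diff G).
- move=> v vW rv; rewrite in_setU1 negb_or => /andP[vy vP].
  by rewrite /L' (negPf vy) (good_3 G).
move=> v vW vr rv; rewrite /L'; case: eqP rv => [->|_ rv]; first by rewrite ry.
exact: (good_5 G).
Qed.

(** * The case without small separators through the root *)

Hypothesis nsep1' : nsep e (W :\ r).
Hypothesis nsep2 : forall z, z \in W :\ r -> nsep e (W :\ r :\ z).
Hypothesis nsep3 : forall v z, v \in nb e W r -> z \in W :\ r :\ v -> nsep e (W :\ r :\ v :\ z).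

Let H := nb e W r.

Lemma H_mem v : v \in H -> [/\ v \in W, e r v & v != r].
Proof.
rewrite in_nb => /andP[vW rv]; split=> //.
by apply: contraTneq rv => ->; rewrite ie.
Qed.

(** Without [r] and [v] there is no cut vertex, so three common neighbours of [r] and [v] root a
    triangle, which [r] and [v] complete to a K5 model. *)
Lemma deg_H v : v \in H -> #|nb e H v| <= 2.
Proof.
move=> vH; rewrite leqNgt; apply/negP => /card_gt2P[a [b [c]]].
case=> [[aN bN cN] [ab bc ca]]; have [vW rv vr] := H_mem vH.
have NS x : x \in nb e H v -> [/\ x \in W :\ r :\ v, e r x & e v x].
  rewrite in_nb => /andP[/H_mem[xW rx xr] vx]; split=> //; rewrite !inE xr xW !andbT.
  by apply: contraTneq vx => ->; rewrite ie.
have [aS ra va] := NS a aN; have [bS rb vb] := NS b bN; have [cS rc vc] := NS c cN.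
have ac : a != c by rewrite eq_sym.
have [||B [D [[bB cD BS DS] [cB cD'] dBD [aBD aaB aaD]]]] :=
  @rooted_K3 _ e (W :\ r :\ v) a b c se aS bS cS ab ac bc.
- by apply: nsep2; rewrite !inE vr.
- by move=> z zS; apply: nsep3.
have out Z : Z \subset W :\ r :\ v :\ a -> [/\ Z \subset W, r \notin Z, v \notin Z & a \notin Z].
  move=> ZS; split.
  - apply: subset_trans ZS _; apply: subset_trans (subsetDl _ _) _.
    by apply: subset_trans (subsetDl _ _) (subsetDl _ _).
  - by apply/negP => /(subsetP ZS); rewrite !inE eqxx /= !andbF.
  - by apply/negP => /(subsetP ZS); rewrite !inE eqxx /= !andbF.
  by apply/negP => /(subsetP ZS); rewrite !inE eqxx.
have [BW rB vB aB] := out B BS; have [DW rD vD aD] := out D DS.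
have [av ar aW] : [/\ a != v, a != r & a \in W] by move: aS; rewrite !inE => /and3P.
have adj1 x y Z : y \in Z -> e x y -> adjs e [set x] Z.
  by move=> yZ xy; apply/adjsP; exists x, y; rewrite inE.
apply: (@K5free_five _ e W [set r] [set v] [set a] B D) => //; rewrite ?conn1 ?sub1set ?disjoints1 ?inE //.
- exact: (good_K5 G).
- exact: (good_r G).
- by rewrite eq_sym.
- by rewrite eq_sym.
- by rewrite eq_sym.
- by rewrite adjs11.
- by rewrite adjs11.
- exact: adj1 rb.
- exact: adj1 rc.
- by rewrite adjs11.
- exact: adj1 vb.
exact: adj1 vc.
Qed.

(* Otherwise a component of [H :\: P] is a cycle, and it yields a K5 together
   with [r] and a component of the rest that meets [P]. *)
Lemma pendant_H p y : p \in P -> y \in H -> y \notin P ->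
  (forall x q, x \in H -> x \notin P -> q \in P -> ~~ e x q) ->
  exists2 v, v \in H :\: P & #|nb e H v| <= 1.
Proof.
move=> pP yH yP HP.
have [/exists_inP[v vH v1]|/exists_inPn all2] := boolP [exists v in H :\: P, #|nb e H v| <= 1].
  by exists v.
have [Q [yQ QH cQ nQ]] := @compP _ e (H :\: P) y se ltac:(by rewrite inE yP).
have QH' : Q \subset H by apply: subset_trans QH (subsetDl _ _).
have nbQ v : v \in Q -> nb e Q v = nb e H v.
  move=> vQ; apply/setP => u; rewrite [LHS]in_nb [RHS]in_nb; have [uQ|uQ] := boolP (u \in Q).
    by rewrite (subsetP QH').
  rewrite andFb; apply/esym/negP => /andP[uH vu].
  have := subsetP QH v vQ; rewrite inE => /andP[vP vH].
  have [uP|uP] := boolP (u \in P); first by have := HP v u vH vP uP; rewrite vu.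
  by rewrite (adjsN nQ) // in vu; rewrite in_setD in_setD uQ uP.
have deg2 v : v \in Q -> #|nb e Q v| = 2.
  move=> vQ; rewrite nbQ //; apply/eqP; rewrite eqn_leq deg_H ?(subsetP QH') //=.
  by have := all2 v (subsetP QH v vQ); rewrite -ltnNge.
have [pW rp pr] := P_mem pP.
have pQ : p \notin Q by apply/negP => /(subsetP QH); rewrite inE pP.
(* The part of the graph beyond [Q] that contains [p], and so is adjacent to [r]. *)
have [K [pK KS cK nK]] := @compP _ e (W :\ r :\: Q) p se ltac:(by rewrite !inE pr pW pQ).
have KW v : v \in K -> [/\ v \notin Q, v != r & v \in W].
  by move=> /(subsetP KS); rewrite !inE => /and3P.
pose N := [set t in Q | adjs e K [set t]].
have NQ : N \subset Q by apply/subsetP => t; rewrite inE => /andP[].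
have Q3 : 2 < #|Q|.
  have := deg2 y yQ; have : nb e Q y \proper Q.
    apply/properP; split; last by exists y; rewrite // in_nb ie andbF.
    by apply/subsetP => u; rewrite in_nb => /andP[].
  by move/proper_card; nlia.
(* Fewer than three attachments, padded to two vertices of [Q], would together with [r] separate [K]
   from the rest of [Q]. *)
have N3 : 2 < #|N|.
  rewrite ltnNge; apply/negP => N2.
  have [|M [NM MQ M2]] := @card_between _ N Q 2 NQ; first by rewrite N2 ltnW.
  have /cards2P[s [t [st Ms]]] : #|M| == 2 by rewrite M2.
  have sQ : s \in Q by apply: (subsetP MQ); rewrite Ms !inE eqxx.
  have tQ : t \in Q by apply: (subsetP MQ); rewrite Ms !inE eqxx orbT.
  have [x xQ xM] : exists2 x, x \in Q & x \notin M by apply: card_lt_ex; rewrite M2.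
  have sH := subsetP QH' s sQ; have [tW _ tr] := H_mem (subsetP QH' t tQ).
  have [xW _ xr] := H_mem (subsetP QH' x xQ).
  have := nsepP (nsep3 (v := s) (z := t) sH _) (X := K).
  rewrite !inE eq_sym st tr tW => /(_ isT).
  have -> : K \subset W :\ r :\ s :\ t.
    apply/subsetP => v vK; have [vQ vr vW] := KW v vK; rewrite !inE vr vW !andbT.
    by apply/andP; split; apply: contraNneq vQ => ->.
  have -> : K != set0 by apply/set0Pn; exists p.
  have -> : K != W :\ r :\ s :\ t.
    apply/eqP => /setP/(_ x); have /negPf-> : x \notin K.
      by apply/negP => /KW[]; rewrite xQ.
    by move: xM; rewrite Ms !inE xr xW negb_or => /andP[-> ->].
  move=> /(_ isT isT isT) /adjsP[u [v [uK]]]; rewrite !inE => /andP[vK /and4P[vt vs vr vW]] uv.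
  have [vQ|vQ] := boolP (v \in Q); last by rewrite (adjsN nK) // in uv; rewrite !inE vQ vr vK.
  have : v \in M.
    by apply: (subsetP NM); rewrite inE vQ; apply/adjsP; exists u, v; rewrite inE.
  by rewrite Ms !inE (negPf vt) (negPf vs).
have /card_gt2P[a [b [c [[aN bN cN] [ab bc ca]]]]] := N3.
have NP x : x \in N -> [/\ x \in Q, adjs e K [set x] & e r x].
  by rewrite inE => /andP[xQ Kx]; split=> //; have [] := H_mem (subsetP QH' x xQ).
have [aQ Ka ra] := NP a aN; have [bQ Kb rb] := NP b bN; have [cQ' Kc rc] := NP c cN.
have ac : a != c by rewrite eq_sym.
(* [Q] induces a cycle, so three attachments root a triangle in it; [r] and [K] are the other two
   branch sets. *)
have [||B [D [[bB cD BS DS] [cB cD'] dBD [aBD aaB aaD]]]] :=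
  @rooted_K3 _ e Q a b c se aQ bQ cQ' ab ac bc.
- by case/andP: cQ.
- by move=> z _; apply: cycle_nsep.
have QW : Q \subset W by apply/subsetP => x /(subsetP QH')/H_mem[].
have rQ : r \notin Q by apply/negP => /(subsetP QH')/H_mem[_ _]; rewrite eqxx.
have out Z : Z \subset Q :\ a -> [/\ Z \subset Q, Z \subset W, r \notin Z & a \notin Z].
  move=> ZS; have ZQ : Z \subset Q := subset_trans ZS (subsetDl _ _); split=> //.
  - exact: subset_trans ZQ QW.
  - by apply: contra rQ; apply: subsetP.
  by apply/negP => /(subsetP ZS); rewrite !inE eqxx.
have [BQ BW rB aB] := out B BS; have [DQ DW rD aD] := out D DS.
have dKQ Z : Z \subset Q -> [disjoint K & Z].
  move=> ZQ; rewrite disjoints_subset; apply/subsetP => x /KW[xQ _ _].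
  by rewrite inE; apply: contra xQ; apply: subsetP.
have adj1 x z Z : z \in Z -> e x z -> adjs e [set x] Z.
  by move=> zZ xz; apply/adjsP; exists x, z; rewrite inE.
have adjK x Z : x \in Z -> adjs e K [set x] -> adjs e K Z.
  by move=> xZ; apply: adjs_sub => //; rewrite sub1set.
have rK : r \notin K by apply/negP => /KW[_]; rewrite eqxx.
case: (@K5free_five _ e W [set r] K [set a] B D) => //;
  rewrite ?conn1 ?sub1set ?disjoints1 ?inE ?dKQ ?sub1set //.
- exact: (good_K5 G).
- exact: (good_r G).
- by apply/subsetP => v /KW[].
- exact: (subsetP QW).
- by apply: contraNneq rQ => ->.
- exact: adj1 rp.
- by rewrite adjs11.
- exact: adj1 rb.
- exact: adj1 rc.
- exact: adjK Kb.
exact: adjK Kc.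
Qed.

(** A neighbour of [r] can be absorbed if it has at most one neighbour in [N(r)] besides one
    precoloured vertex. If an edge joins [P] to some [y], then [deg_H] yields this for [y], unless
    [P] has room for [y]. Without such an edge an empty [P] is extended, and otherwise [pendant_H]
    finds the vertex. *)
Lemma step_2conn : col e (W :\ r) L.
Proof.
have [HP|/subsetPn[y0 y0H y0P]] := boolP (H \subset P); first exact: step_root.
have [|/exists_inPn noE] := boolP [exists y in H :\: P, [exists x in P, e x y]].
  case/exists_inP=> y /setDP[yH yP] /exists_inP[x xP xy].
  have [P1|P2] := leqP #|P| 1.
    have Px : P = [set x] by apply/esym/eqP; rewrite eqEcard sub1set xP cards1.
    by apply: (step_extend (y := y)) => // p; rewrite Px => /set1P->.
  have xH : x \in nb e H y by rewrite in_nb se xy (subsetP (good_P G)).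
  have [w Hw] : exists w, nb e H y \subset w |: [set x].
    have : #|nb e H y :\ x| <= 1.
      by have := deg_H yH; rewrite (cardsD1 x) xH.
    case: (set_0Vmem (nb e H y :\ x)) => [N0 _|[w wN] N1].
      by exists x; rewrite -setD_eq0 -subset0 -N0; apply: setDS; apply: subsetUr.
    exists w; apply/subsetP => u uN; rewrite !inE orbC; have [//|ux] := eqVneq u x.
    have uN' : u \in nb e H y :\ x by rewrite in_setD1 ux.
    by have := card_le1P N1 w wN u; rewrite uN' inE => /esym.
  by apply: (step_absorb (v := y) (w := w) (A := [set x])) => //; rewrite ?sub1set ?cards1.
have [P0|/set0Pn[p pP]] := eqVneq P set0.
  apply: (step_extend (y := y0)) => //; first by rewrite P0 cards0.
  by move=> p; rewrite P0 inE.
have [v vHP v1] : exists2 v, v \in H :\: P & #|nb e H v| <= 1.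
  apply: (pendant_H pP y0H y0P) => x q xH xP qP.
  have xHP : x \in H :\: P by rewrite inE xP.
  by have := noE x xHP; rewrite se => /exists_inPn/(_ q qP).
move: vHP => /setDP[vH vP].
have [w Hw] : exists w, nb e H v \subset w |: set0.
  case: (set_0Vmem (nb e H v)) => [->|[w wN]]; first by exists v; apply: sub0set.
  exists w; apply/subsetP => u uN; rewrite !inE orbF.
  by have := card_le1P v1 w wN u; rewrite uN inE => /esym.
by apply: (step_absorb (v := v) (w := w) (A := set0)) => //; rewrite ?sub0set ?cards0.
Qed.

End Step.

Theorem rooted_choosable e W r P L : good e W r P L -> col e (W :\ r) L.
Proof.
have [n] := ubnP (3 * #|W| - #|P|); elim: n e W r P L => // n IH e W r P L Wn G.
have [n1|n1] := boolP (nsep e (W :\ r)); last exact: (step_conn IH Wn G).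
have [|/exists_inPn n2] := boolP [exists z in W :\ r, ~~ nsep e (W :\ r :\ z)].
  case/exists_inP=> z zW nz; apply: (step_split IH Wn G (A := set0) (z := z)) => //.
  - exact: sub0set.
  - by rewrite cards0.
  - by rewrite inE.
  - by rewrite setD0.
  - by move=> v; rewrite inE.
  by rewrite setD0.
have {}n2 z : z \in W :\ r -> nsep e (W :\ r :\ z) by move=> /n2; rewrite negbK.
have [|/exists_inPn n3] := boolP [exists v in nb e W r,
    [exists z in W :\ r :\ v, ~~ nsep e (W :\ r :\ v :\ z)]].
  case/exists_inP=> v vN /exists_inP[z zW nz].
  have zW' : z \in W :\ r by move: zW; rewrite in_setD1 => /andP[].
  have vW : v \in W :\ r.
    move: vN; rewrite in_nb !inE => /andP[-> rv]; rewrite andbT.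
    by apply: contraTneq rv => ->; rewrite (good_irr G).
  apply: (step_split IH Wn G (A := [set v]) (z := z)) => //.
  - by rewrite sub1set.
  - by rewrite cards1.
  - by move: zW; rewrite in_setD1 inE => /andP[].
  - exact: n2.
  by move=> u _; apply: n2.
apply: (step_2conn IH Wn G) => // v z vN zW.
by have /exists_inPn/(_ z zW) := n3 v vN; rewrite negbK.
Qed.

(** Colouring an arbitrary vertex turns it into the root: its neighbours keep at least 4 colours,
    and 3 suffice. *)
Theorem K5free_choosable e W L : symmetric e -> irreflexive e -> K5free e W ->
  (forall v, v \in W -> 5 <= #|L v|) -> col e W L.
Proof.
move=> se ie K L5; have [->|/set0Pn[r rW]] := eqVneq W set0.
  by exists (fun=> c0); split=> [v|u v]; rewrite inE.
have /card_gt0P[c cL] : 0 < #|L r| by apply: leq_trans (L5 r rW).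
apply: (col_vertex se ie cL); apply: (@rooted_choosable e W r set0).
split=> //; try by move=> p; rewrite inE.
- exact: sub0set.
- by rewrite cards0.
- by move=> v vW rv _; rewrite rv; have := L5 v vW; have := card_setD1_ge (L v) c; nlia.
by move=> v vW _ rv; rewrite (negPf rv) L5.
Qed.
End ListColouring.

(** * Lists of the size of the degrees *)

Lemma cardsU_le (T : finType) (A B : {set T}) : #|A :|: B| <= #|A| + #|B|.
Proof. by rewrite cardsU leq_subr. Qed.

Section Degree.
Variables (V C : finType) (c0 : C).
Implicit Types (e : rel V) (A B D E K P Q S U W X Y Z : {set V}) (p q r u v w x y z : V).
Implicit Types (L : V -> {set C}) (phi : V -> C).

Lemma nb_setD1 e D u v : v \in D -> #|nb e D u| = e u v + #|nb e (D :\ v) u|.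
Proof.
move=> vD; rewrite (cardsD1 v) in_nb vD /=.
have -> // : nb e D u :\ v = nb e (D :\ v) u.
by apply/setP => w; rewrite !inE andbA.
Qed.

Lemma nb_split e D Z v : Z \subset D -> #|nb e D v| = #|nb e Z v| + #|nb e (D :\: Z) v|.
Proof.
move=> ZD; rewrite -(cardsID Z (nb e D v)).
have -> : nb e D v :&: Z = nb e Z v.
  apply/setP => u; rewrite !inE andbAC.
  by case: (boolP (u \in Z)) => uZ; rewrite ?andbF // (subsetP ZD).
have -> // : nb e D v :\: Z = nb e (D :\: Z) v.
by apply/setP => u; rewrite !inE andbA.
Qed.

(** Colouring [v] with [c] takes a neighbour from [w] but no colour; the surplus at [w] then colours
    the connected remainder. *)
Lemma col_noncut e D L v w c : symmetric e -> irreflexive e ->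
  (forall u, u \in D -> #|nb e D u| <= #|L u|) -> v \in D -> nsep e (D :\ v) ->
  w \in D -> e v w -> c \in L v -> c \notin L w -> col e D L.
Proof.
move=> se ie dL vD nv wD vw cv cw; apply: (col_vertex se ie cv).
have wDv : w \in D :\ v by rewrite !inE wD andbT; apply: contraTneq vw => ->; rewrite ie.
have := nb_setD1 e w vD; rewrite se vw => nw.
apply: (@col_surplus _ _ c0 _ _ _ w) => //; first exact: nsep_conn nv wDv.
  move=> u; rewrite !inE => /andP[uv uD]; have := dL u uD; rewrite (nb_setD1 _ _ vD) se.
  by case: (e v u) => //; have := card_setD1_ge (L u) c; nlia.
rewrite vw (_ : L w :\ c = L w); first by have := dL w wD; nlia.
by apply/setDidPl; rewrite disjoint_sym disjoints1.
Qed.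

(** [D :\: E] is colourable as a proper part, and each vertex of [E] loses at most one colour per
    neighbour there. An obstruction on [D] thus leaves one on every nonempty part, in particular on
    every block. *)
Lemma residual_lists e D E L : symmetric e -> irreflexive e -> conn e D ->
  (forall u, u \in D -> #|nb e D u| <= #|L u|) -> ~ col e D L -> E \subset D -> E != set0 ->
  exists2 L' : V -> {set C}, (forall u, u \in E -> #|nb e E u| <= #|L' u|) & ~ col e E L'.
Proof.
move=> se ie cD dL nD ED E0.
have [phi [h1 h2]] : col e (D :\: E) L.
  apply: col_proper dL _ => //; rewrite properE subsetDl.
  have /set0Pn[x xE] := E0; apply/subsetPn; exists x; rewrite ?(subsetP ED) //.
  by rewrite inE xE.
exists (fun u => L u :\: phi @: nb e (D :\: E) u) => [u uE|[psi [g1 g2]]].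
  have uD := subsetP ED u uE; have := dL u uD; rewrite (nb_split _ _ ED).
  have := card_setD_ge (L u) (phi @: nb e (D :\: E) u).
  by have := leq_imset_card phi (nb e (D :\: E) u); nlia.
apply: nD; exists (fun u => if u \in E then psi u else phi u).
have cross u v : u \in E -> v \in D -> v \notin E -> e u v -> psi u != phi v.
  move=> uE vD vE uv; have := g1 u uE; rewrite inE => /andP[+ _].
  by apply: contraNneq => ->; apply: imset_f; rewrite !inE vE vD.
split=> [u uD|u v uD vD uv].
  case: ifPn => uE; last by apply: h1; rewrite inE uE.
  by have := g1 u uE; rewrite inE => /andP[].
case: ifPn => uE; case: ifPn => vE.
- exact: g2.
- exact: cross.
- by rewrite eq_sym; apply: cross; rewrite // se.
by apply: h2; rewrite ?inE ?uE ?vE.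
Qed.

(** The first transposition takes [a] to [a']; the second takes the image of [b] to [b'] and leaves
    [a'] alone. *)
Lemma perm_two (a b a' b' : C) (S : {set C}) : a \in S -> b \in S -> a' \in S -> b' \in S ->
  (a == b) = (a' == b') ->
  exists f : C -> C, [/\ injective f, forall d, d \in S -> f d \in S, f a = a' & f b = b'].
Proof.
move=> aS bS a'S b'S ab.
have tS (c d c' : C) : c \in S -> d \in S -> c' \in S -> tperm c d c' \in S.
  by move=> cS dS c'S; case: tpermP.
exists (fun c => tperm (tperm a a' b) b' (tperm a a' c)); split.
- by move=> x y /perm_inj/perm_inj.
- by move=> d dS; apply: (tS) => //; apply: (tS).
- rewrite tpermL; have [abE|abN] := eqVneq a b.
    by move: ab; rewrite -abE eqxx tpermL => /esym/eqP->; rewrite tpermL.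
  rewrite tpermD //; last by rewrite eq_sym -ab.
  by rewrite -[X in _ != X](tpermL a a') (inj_eq perm_inj) eq_sym.
exact: tpermL.
Qed.

(** * Regular graphs with constant lists and two separating vertices *)

Section Separator.
Variables (e : rel V) (E : {set V}) (S : {set C}).
Hypotheses (se : symmetric e) (ie : irreflexive e) (cE : conn e E).
Hypothesis reg : forall v, v \in E -> #|nb e E v| = #|S|.

Let reg_le v : v \in E -> #|nb e E v| <= #|S|.
Proof. by move=> vE; rewrite reg. Qed.

(** With constant lists the colours of one side can be permuted, and [perm_two] matches the colours
    of both [u] and [z] as soon as the two colourings agree on whether they are equal. *)
Lemma glue_const X Y u z phi1 phi2 : X :|: Y = E :\ u :\ z -> [disjoint X & Y] ->
  ~~ adjs e X Y -> u \in E -> z \in E ->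
  (forall v, v \in E :\: Y -> phi1 v \in S) ->
  (forall v w, v \in E :\: Y -> w \in E :\: Y -> e v w -> phi1 v != phi1 w) ->
  (forall v, v \in E :\: X -> phi2 v \in S) ->
  (forall v w, v \in E :\: X -> w \in E :\: X -> e v w -> phi2 v != phi2 w) ->
  (phi1 u == phi1 z) = (phi2 u == phi2 z) -> col e E (fun=> S).
Proof.
move=> XY dXY nXY uE zE h1 g1 h2 g2 uz.
have inXY v : (v \in X) || (v \in Y) = [&& v != z, v != u & v \in E].
  by rewrite -in_setU XY !inE.
have not v : v = u \/ v = z -> v \notin X /\ v \notin Y.
  move=> vuz; apply/norP; rewrite inXY; case: vuz => ->; rewrite eqxx ?andbF //.
have [[uX uY] [zX zY]] := (not u (or_introl erefl), not z (or_intror erefl)).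
have [||||//|f [fi fS fu fz]] := @perm_two (phi2 u) (phi2 z) (phi1 u) (phi1 z) S.
- by apply: h2; rewrite inE uX.
- by apply: h2; rewrite inE zX.
- by apply: h1; rewrite inE uY.
- by apply: h1; rewrite inE zY.
have inYE v : v \in Y -> v \in E :\: X.
  move=> vY; rewrite inE (disjointFl dXY) //.
  by have := inXY v; rewrite vY orbT => /esym/and3P[].
have cross v w : v \in Y -> w \in E -> w \notin Y -> e v w -> f (phi2 v) != phi1 w.
  move=> vY wE wY vw; have vE := inYE v vY.
  have [wX|wX] := boolP (w \in X); first by rewrite se (adjsN nXY) in vw.
  have := inXY w; rewrite (negPf wX) (negPf wY) wE andbT => /esym/negbT.
  have wEX : w \in E :\: X by rewrite inE wX.
  rewrite negb_and !negbK => /orP[/eqP wE'|/eqP wE']; rewrite wE' in vw wEX *.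
    by rewrite -fz (inj_eq fi); apply: g2.
  by rewrite -fu (inj_eq fi); apply: g2.
exists (fun v => if v \in Y then f (phi2 v) else phi1 v); split=> [v vE|v w vE wE vw].
  by case: ifPn => vY; [apply/fS/h2/inYE|apply: h1; rewrite inE vY].
case: ifPn => vY; case: ifPn => wY.
- by rewrite (inj_eq fi); apply: g2; rewrite ?inYE.
- exact: cross.
- by rewrite eq_sym; apply: cross; rewrite // se.
by apply: g1; rewrite ?inE ?vY ?wY.
Qed.

Lemma proper_const Y : Y \subset E -> Y != set0 -> exists phi,
  (forall v, v \in E :\: Y -> phi v \in S) /\
  (forall v w, v \in E :\: Y -> w \in E :\: Y -> e v w -> phi v != phi w).
Proof.
move=> YE /set0Pn[y yY]; apply: (col_proper c0 se ie cE reg_le (X := E :\: Y)).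
rewrite properE subsetDl; apply/subsetPn; exists y; rewrite ?(subsetP YE) //.
by rewrite inE yY.
Qed.

(** An extra edge between [u] and [z] keeps them apart. Two neighbours of [u] are missing with [Y]:
    one pays for the extra edge and the other leaves [u] a spare colour for the greedy argument. *)
Lemma distinct_const Y u z : Y \subset E -> Y != set0 -> u \in E :\: Y -> z \in E :\: Y ->
  u != z -> 1 < #|nb e Y u| ->
  exists phi, [/\ forall v, v \in E :\: Y -> phi v \in S,
    forall v w, v \in E :\: Y -> w \in E :\: Y -> e v w -> phi v != phi w & phi u != phi z].
Proof.
move=> YE Y0 uY zY uz u2.
pose f a b := [|| e a b, (a == u) && (b == z) | (a == z) && (b == u)].
have sf : symmetric f.
  move=> a b; rewrite /f se.
  by case: (e b a); case: (a == u); case: (b == z); case: (a == z); case: (b == u).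
have fi : irreflexive f.
  move=> a; rewrite /f ie /=; apply/orP => -[] /andP[/eqP-> /eqP h].
    by rewrite h eqxx in uz.
  by rewrite h eqxx in uz.
have [Z ZE Z0|phi [h1 h2]] := @greedy _ _ c0 f (E :\: Y) (fun=> S) sf fi; last first.
  exists phi; split=> // [v w vE wE vw|]; first by apply: h2; rewrite // /f vw.
  by apply: h2; rewrite // /f !eqxx orbT.
have ZE' : Z \subset E := subset_trans ZE (subsetDl _ _).
have ZnE : Z != E.
  have /set0Pn[y yY] := Y0; apply/eqP => ZeE.
  by have := subsetP ZE y; rewrite ZeE inE yY => /(_ (subsetP YE y yY)).
have [/andP[uZ zZ]|nuz] := boolP ((u \in Z) && (z \in Z)).
  exists u => //; apply: (@leq_ltn_trans #|z |: nb e Z u|).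
    apply/subset_leq_card/subsetP => w; rewrite !inE /f eqxx (negPf uz) /= orbF.
    by case: (w \in Z) => //=; rewrite orbC.
  have uE : u \in E by move: uY; rewrite inE => /andP[].
  have := nb_split e u YE; rewrite reg //.
  have := subset_leq_card (nb_sub e u ZE); have := cardsU_le [set z] (nb e Z u).
  by rewrite cards1; move: u2; nlia.
have [v vZ dv] := deg_drop cE ZE' Z0 ZnE; exists v => //.
rewrite reg ?(subsetP ZE') // in dv; apply: leq_ltn_trans dv.
apply/subset_leq_card/subsetP => w; rewrite !inE => /andP[wZ]; rewrite wZ /f.
case/or3P=> [//|/andP[/eqP vu /eqP wz]|/andP[/eqP vz /eqP wu]].
  by rewrite -vu -wz vZ wZ in nuz.
by rewrite -vz -wu vZ wZ in nuz.
Qed.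

(** [u] and [z] have at most two neighbours in [Y] altogether, so some colour of [S] is free for
    both; any colouring of [E :\: X] is changed to it there. *)
Lemma same_const X Y u z : X :|: Y = E :\ u :\ z -> [disjoint X & Y] -> X != set0 ->
  u \in E -> z \in E -> u != z -> ~~ e u z -> 2 < #|S| ->
  #|nb e Y u| <= 1 -> #|nb e Y z| <= 1 ->
  exists phi, [/\ forall v, v \in E :\: X -> phi v \in S,
    forall v w, v \in E :\: X -> w \in E :\: X -> e v w -> phi v != phi w & phi u = phi z].
Proof.
move=> XY dXY X0 uE zE uz nuz S3 u1 z1.
have inXY v : (v \in X) || (v \in Y) = [&& v != z, v != u & v \in E].
  by rewrite -in_setU XY !inE.
have XE : X \subset E.
  by apply/subsetP => v vX; have := inXY v; rewrite vX => /esym/and3P[].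
have [phi [h1 h2]] := proper_const XE X0.
pose N := nb e Y u :|: nb e Y z.
have [c cS cN] : exists2 c, c \in S & c \notin phi @: N.
  apply: card_lt_ex; apply: leq_ltn_trans (leq_imset_card _ _) _.
  by have := cardsU_le (nb e Y u) (nb e Y z); rewrite -/N; move: u1 z1 S3; nlia.
have cP v w : v \in [set u; z] -> w \in E :\: X -> w \notin [set u; z] -> e v w -> phi w != c.
  move=> vuz; rewrite !inE negb_or => /andP[wX wE] /andP[wu wz] vw.
  have wY : w \in Y by have := inXY w; rewrite (negPf wX) wu wz wE.
  apply: contraNneq cN => <-; apply: imset_f; rewrite inE !in_nb wY /=.
  by move: vuz; rewrite !inE => /orP[]/eqP <-; rewrite vw ?orbT.
exists (fun v => if v \in [set u; z] then c else phi v); split; last by rewrite !inE !eqxx orbT.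
  by move=> v vE; case: ifP => // _; apply: h1.
move=> v w vE wE vw; case: ifPn => vuz; case: ifPn => wuz.
- case/negP: nuz; move: vuz wuz vw; rewrite !inE.
  by move=> /orP[]/eqP-> /orP[]/eqP->; rewrite ?ie // se.
- by rewrite eq_sym; apply: (cP v w).
- by apply: (cP w v); rewrite // se.
exact: h2.
Qed.

(* The sides of the separator are coloured apart and their colours permuted; the
   point is to make them agree on whether [u] and [z] get the same colour. *)
Lemma separator_const u z : 2 < #|S| -> u \in E -> z \in E -> u != z ->
  ~~ nsep e (E :\ u :\ z) -> col e E (fun=> S).
Proof.
move=> S3 uE zE uz /nsepN[X0 [XS X0n Xn nX]].
(* The last condition ensures a colouring of [E :\: X] with [u] and [z] apart. It can be met by
   naming the sides: if [u] and [z] are not adjacent, [u] has at least three neighbours, so two on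
   one side. *)
suff main X Y : X :|: Y = E :\ u :\ z -> [disjoint X & Y] -> ~~ adjs e X Y ->
    X != set0 -> Y != set0 -> (e u z) || (1 < #|nb e X u|) || (1 < #|nb e X z|) -> col e E (fun=> S).
  have XY : X0 :|: (E :\ u :\ z :\: X0) = E :\ u :\ z.
    apply/setP => v; rewrite in_setU in_setD.
    by case: (boolP (v \in X0)) => //= vX; rewrite (subsetP XS).
  have dXY : [disjoint X0 & E :\ u :\ z :\: X0].
    by rewrite disjoint_sym disjoints_subset setDE subsetIr.
  have Y0n : E :\ u :\ z :\: X0 != set0.
    by rewrite setD_eq0; apply: contra Xn => h; rewrite eqEsubset XS.
  set Y0 := E :\ u :\ z :\: X0 in XY dXY Y0n nX.
  have [uX|uX] := leqP #|nb e X0 u| 1; last by apply: (main X0 Y0) => //; rewrite uX orbT.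
  have [euz|euz] := boolP (e u z); first by apply: (main X0 Y0) => //; rewrite euz.
  apply: (main Y0 X0) => //; first by rewrite setUC.
  - by rewrite disjoint_sym.
  - by rewrite adjs_sym.
  suff -> : 1 < #|nb e Y0 u| by rewrite orbT.
  have nE : #|nb e E u| <= #|nb e X0 u| + #|nb e Y0 u|.
    apply: leq_trans (cardsU_le _ _); apply/subset_leq_card/subsetP => v.
    rewrite in_setU !in_nb => /andP[vE uv]; rewrite uv !andbT -in_setU XY !inE vE andbT.
    apply/andP; split; first by apply: contraNneq euz => <-.
    by apply: contraTneq uv => ->; rewrite ie.
  by move: nE; rewrite reg //; move: S3 uX; nlia.
move=> {X0 XS X0n Xn nX} XY dXY nXY X0 Y0 dist.
have inXY v : (v \in X) || (v \in Y) = [&& v != z, v != u & v \in E].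
  by rewrite -in_setU XY !inE.
have not v : v = u \/ v = z -> v \notin X /\ v \notin Y.
  move=> vuz; apply/norP; rewrite inXY; case: vuz => ->; rewrite eqxx ?andbF //.
have [[uX uY] [zX zY]] := (not u (or_introl erefl), not z (or_intror erefl)).
have XE : X \subset E.
  by apply/subsetP => v vX; have := inXY v; rewrite vX => /esym/and3P[].
have YE : Y \subset E.
  by apply/subsetP => v vY; have := inXY v; rewrite vY orbT => /esym/and3P[].
have uEX : u \in E :\: X by rewrite inE uX.
have zEX : z \in E :\: X by rewrite inE zX.
have uEY : u \in E :\: Y by rewrite inE uY.
have zEY : z \in E :\: Y by rewrite inE zY.
have dst Z : Z \subset E -> Z != set0 -> u \in E :\: Z -> z \in E :\: Z ->
   e u z || (1 < #|nb e Z u|) || (1 < #|nb e Z z|) ->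
   exists phi, [/\ forall v, v \in E :\: Z -> phi v \in S,
    forall v w, v \in E :\: Z -> w \in E :\: Z -> e v w -> phi v != phi w & phi u != phi z].
  move=> ZE Z0 uZ zZ; case: (boolP (e u z)) => [euz _|_ /= /orP[h|h]].
  - by have [phi [h1 h2]] := proper_const ZE Z0; exists phi; split=> //; apply: h2.
  - exact: distinct_const.
  have [||phi [h1 h2 h3]] := @distinct_const Z z u ZE Z0 zZ uZ; rewrite 1?eq_sym //.
  by exists phi; split=> //; rewrite eq_sym.
have [phi2 [h2 g2 d2]] := dst X XE X0 uEX zEX dist.
have [disY|uY1] := boolP (e u z || (1 < #|nb e Y u|) || (1 < #|nb e Y z|)).
  have [phi1 [h1 g1 d1]] := dst Y YE Y0 uEY zEY disY.
  by apply: (glue_const XY dXY nXY uE zE h1 g1 h2 g2); rewrite (negPf d1) (negPf d2).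
have [phi1 [h1 g1]] := proper_const YE Y0.
have [p1|p1] := boolP (phi1 u == phi1 z); last first.
  by apply: (glue_const XY dXY nXY uE zE h1 g1 h2 g2); rewrite (negPf p1) (negPf d2).
(* [phi1] gives [u] and [z] one colour, and they have so few neighbours in [Y] that the other side
   can imitate this. *)
move: uY1; rewrite !negb_or -!leqNgt => /andP[/andP[euz uY1] zY1].
have [phi3 [h3 g3 d3]] := same_const XY dXY X0 uE zE uz euz S3 uY1 zY1.
by apply: (glue_const XY dXY nXY uE zE h1 g1 h3 g3); rewrite p1 d3 eqxx.
Qed.

End Separator.

(** The block case of the theorem of Borodin and of Erdos, Rubin and Taylor. A surplus, or different
    lists at adjacent vertices, would give a colouring; so all lists are one set [S] and the graph
    is regular of degree [#|S|]. If this is at least 3, either two vertices separate [E], and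
    [separator_const] colours it, or some [v] can be deleted without creating a cut vertex and
    induction describes [E :\ v]. *)
Lemma nonseparable_uncolorable e E L : symmetric e -> irreflexive e -> conn e E ->
  (forall z, nsep e (E :\ z)) -> (forall u, u \in E -> #|nb e E u| <= #|L u|) ->
  ~ col e E L ->
  (forall x y, x \in E -> y \in E -> x != y -> e x y) \/
  (forall v, v \in E -> #|nb e E v| = 2) /\ exists2 S : {set C}, #|S| = 2 & ~ col e E (fun=> S).
Proof.
move=> se ie; have [n] := ubnP #|E|; elim: n E L => // n IH E L En cE nE dL nL.
have eqd v : v \in E -> #|nb e E v| = #|L v|.
  move=> vE; apply/eqP; rewrite eqn_leq dL //= leqNgt; apply/negP => vL; apply: nL.
  exact: (col_surplus c0 se ie cE dL vE vL).
have sub v w : v \in E -> w \in E -> e v w -> L v \subset L w.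
  move=> vE wE vw; apply/subsetP => c cv; apply: contraT => cw; case: nL.
  exact: (col_noncut se ie dL vE (nE v) wE vw cv cw).
have [v0 v0E] : exists v, v \in E by apply/set0Pn; case/andP: cE.
pose S := L v0.
have LS v : v \in E -> L v = S.
  suff XE : [set v in E | L v == S] = E.
    by move=> vE; move: (vE); rewrite -{1}XE inE => /andP[_ /eqP].
  apply/eqP; apply: contraT => Xn; case/andP: (cE) => _ nsE.
  have := nsepP nsE _ _ Xn; have -> : [set v in E | L v == S] \subset E.
    by apply/subsetP => x; rewrite inE => /andP[].
  have -> : [set v in E | L v == S] != set0 by apply/set0Pn; exists v0; rewrite inE v0E eqxx.
  move=> /(_ isT isT) /adjsP[x [y [+ + xy]]]; rewrite !inE => /andP[xE /eqP xS] /andP[+ yE].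
  by rewrite yE /= eqEsubset -xS !sub // se.
have reg v : v \in E -> #|nb e E v| = #|S| by move=> vE; rewrite eqd ?LS.
have nS : ~ col e E (fun=> S) by apply: contra_not nL; apply: col_sub => // v vE; rewrite LS.
have [S1|S2] := leqP #|S| 1.
  left=> x y xE yE xy; apply: contraT => nxy.
  have := nsepP _ (X := x |: nb e E x); case/andP: (cE) => _ nsE => /(_ _ _ nsE).
  have -> : x |: nb e E x \subset E.
    by rewrite subUset sub1set xE; apply/subsetP => u; rewrite in_nb => /andP[].
  have -> : x |: nb e E x != set0 by apply/set0Pn; exists x; rewrite !inE eqxx.
  have -> : x |: nb e E x != E.
    by apply/eqP => /setP/(_ y); rewrite !inE yE (negPf nxy) eq_sym (negPf xy).
  move=> /(_ isT isT isT) /adjsP[u [w [+ + uw]]].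
  rewrite in_setU1 in_setD in_setU1 negb_or !in_nb => + /andP[/andP[wx xw] wE].
  rewrite wE /= in xw; case/orP=> [/eqP ux|/andP[uE xu]]; first by rewrite -ux uw in xw.
  have : 1 < #|nb e E u|.
    by apply/card_gt1P; exists x, w; rewrite !in_nb xE wE uw se xu eq_sym.
  by rewrite reg // ltnNge S1.
have [S2'|S3] := leqP #|S| 2.
  have S2E : #|S| = 2 by apply/eqP; rewrite eqn_leq S2'.
  by right; split=> [v vE|]; [rewrite reg|exists S].
have [|/exists_inPn sepE] := boolP [exists v in E, [forall z, nsep e (E :\ v :\ z)]]; last first.
  case: nS; have := sepE v0 v0E; rewrite negb_forall => /existsP[z nz].
  have [zE|zE] := boolP (z \in E :\ v0); last first.
    by case/negP: nz; rewrite (_ : _ :\ z = E :\ v0) //; apply/setDidPl; rewrite disjoint_sym disjoints1.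
  move: zE; rewrite !inE => /andP[zv zE].
  by apply: (separator_const se ie cE reg S3 v0E zE _ nz); rewrite eq_sym.
case/exists_inP=> v vE /forallP nv; left.
have /card_gt0P[c cS] : 0 < #|S| by apply: leq_trans S3.
have /card_gt0P[u0] : 0 < #|nb e E v| by rewrite reg //; apply: leq_trans S3.
rewrite in_nb => /andP[u0E vu0].
have u0Ev : u0 \in E :\ v by rewrite !inE u0E andbT; apply: contraTneq vu0 => ->; rewrite ie.
have Ev : #|E| = #|E :\ v|.+1 by rewrite (cardsD1 v E) vE.
have degv u : u \in E -> #|S| = e v u + #|nb e (E :\ v) u|.
  by move=> uE; rewrite -(reg u uE) (nb_setD1 _ _ vE) se.
suff [vall cpl] : (forall u, u \in E :\ v -> e v u) /\
    (forall x y, x \in E :\ v -> y \in E :\ v -> x != y -> e x y).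
  move=> x y xE yE xy; have [xv|xv] := eqVneq x v; last first.
    have [yv|yv] := eqVneq y v; first by rewrite yv se vall // !inE xv.
    by apply: cpl; rewrite ?inE ?xv ?yv.
  by rewrite xv vall // !inE -xv eq_sym xy.
have nbsub u : u \in E :\ v -> nb e (E :\ v) u \subset E :\ v :\ u.
  move=> uEv; apply/subsetP => w; rewrite in_nb [in X in _ -> X]in_setD1 => /andP[-> uw]; rewrite andbT.
  by apply: contraTneq uw => ->; rewrite ie.
have cardu u : u \in E :\ v -> #|E :\ v| = #|E :\ v :\ u|.+1.
  by move=> uEv; rewrite (cardsD1 u (E :\ v)) uEv.
have [|||||cpl|[two _]] := IH (E :\ v) (fun u => if e v u then S :\ c else S).
- by move: En; rewrite Ev.
- by apply: nsep_conn u0Ev; apply: nE.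
- exact: nv.
- move=> u; rewrite inE => /andP[_ uE]; have := degv u uE.
  by case: (e v u) => /=; [have := card_setD1_ge S c; nlia | nlia].
- by apply: contra_not nS; apply: col_vertex.
(* [E :\ v] is complete: its vertices have equal degrees both in it and in [E], so all are adjacent
   to [v] because [u0] is. *)
- split=> // u uEv; have uE : u \in E by move: uEv; rewrite inE => /andP[].
  have hu := degv u uE; have hu0 := degv u0 u0E; rewrite vu0 in hu0.
  have le0 : #|E :\ v :\ u0| <= #|nb e (E :\ v) u0|.
    apply/subset_leq_card/subsetP => w; rewrite in_setD1 in_nb => /andP[wu wE].
    by rewrite wE cpl // eq_sym.
  have leu := subset_leq_card (nbsub u uEv).
  have := cardu u uEv; have := cardu u0 u0Ev; move: hu.
  by case: (e v u) => //; nlia.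
(* [E :\ v] is 2-regular: as the degrees in [E] are at least 3, [v] is adjacent to all of it, and
   regularity leaves it three vertices. *)
have vall u : u \in E :\ v -> e v u.
  move=> uEv; have uE : u \in E by move: uEv; rewrite inE => /andP[].
  have := degv u uE; rewrite two //; case: (e v u) => //; nlia.
split=> // x y xE yE xy.
have nbv : #|nb e E v| = #|E :\ v|.
  have -> // : nb e E v = E :\ v; apply/setP => u; rewrite in_nb in_setD1 andbC.
  have [->|uv] := eqVneq u v; first by rewrite ie.
  by case: (boolP (u \in E)) => uE; rewrite ?andbF // vall // !inE uv.
have := degv u0 u0E; rewrite vu0 two // -(reg v vE) nbv => E3.
have nbx : nb e (E :\ v) x = E :\ v :\ x.
  apply/eqP; rewrite eqEcard nbsub // two //.
  by have := cardu x xE; move: E3; nlia.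
have : y \in nb e (E :\ v) x by rewrite nbx in_setD1 yE eq_sym xy.
by rewrite in_nb => /andP[].
Qed.

End Degree.

(** * Forbidding colours around a component *)

Section EndBlock.
Variable V : finType.
Implicit Types (e : rel V) (A B D E K P Q S U W X Y Z : {set V}) (q r u v w x y z : V).

(* [E] is an end block of [D] and [x] its cut vertex, or [E = D]; the vertex [x0]
   is kept out of the part that can be peeled off. *)
Lemma end_block e D x0 : symmetric e -> conn e D -> x0 \in D ->
  exists E x, [/\ x \in E, E \subset D, conn e E & forall z, nsep e (E :\ z)] /\
  [/\ x0 \notin E :\ x, conn e (D :\: (E :\ x)),
      forall u w, u \in E :\ x -> w \in D -> e u w -> w \in E,
      forall w, w \in E :\ x -> nsep e (D :\ w) & (E :\ x = set0 -> D = [set x0])].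
Proof.
move=> se cD x0D.
have [/forallP nD|] := boolP [forall z, nsep e (D :\ z)].
  exists D, x0; split=> //; split=> //; first by rewrite !inE eqxx.
    by rewrite setDDr setDv set0U (setIidPr _) ?conn1 // sub1set.
  by move=> D0; apply/eqP; rewrite eqEsubset sub1set x0D -setD_eq0 D0 eqxx.
rewrite negb_forall => /existsP[z0 nz0].
(* A cut vertex and a side of it that misses [x0]; a smallest such side, with its cut vertex, is an
   end block. *)
pose P (p : V * {set V}) := [&& p.1 \in D, p.2 \subset D :\ p.1, p.2 != set0,
  x0 \notin p.2 & ~~ adjs e p.2 (D :\ p.1 :\: p.2)] && (p.2 != D :\ p.1).
have nsD : nsep e D by case/andP: cD.
have [p0 Pp0] : exists p, P p.
  have z0D : z0 \in D.
    by apply: contraNT nz0 => zD; rewrite (setDidPl _) // disjoint_sym disjoints1.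
  have [X [XD X0 Xn nX]] := nsepN nz0.
  have [x0X|x0X] := boolP (x0 \in X); last first.
    by exists (z0, X); apply/andP; split=> //; apply/and5P.
  exists (z0, D :\ z0 :\: X); apply/andP; split=> /=; last first.
    apply: contra X0 => /eqP DX; apply/eqP/setP => v; rewrite inE; apply/negP => vX.
    by have := subsetP XD v vX; rewrite -DX inE vX.
  apply/and5P; split=> //=; first exact: subsetDl.
  - by rewrite setD_eq0; apply: contra Xn => h; rewrite eqEsubset XD.
  - by rewrite in_setD x0X.
  by rewrite setDDr setDv set0U (setIidPr XD) adjs_sym.
case: (arg_minnP (fun p : V * {set V} => #|p.2|) Pp0) => -[z X] /andP[].
case/and5P=> /= zD XD X0 x0X nX Xn mX.
have zX : z \notin X by apply/negP => /(subsetP XD); rewrite !inE eqxx.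
have XD' : X \subset D := subset_trans XD (subsetDl _ _).
have out u w : u \in X -> w \in D -> e u w -> w \in z |: X.
  move=> uX wD uw; apply: contraTT uw; rewrite in_setU1 negb_or => /andP[wz wX].
  by rewrite (adjsN nX) // !inE wz wX.
have EX : (z |: X) :\ z = X by rewrite setU1K.
have cE : conn e (z |: X).
  apply: (@nsep_conn _ _ _ z); last by rewrite !inE eqxx.
  apply: (nsep_root se (r := z)); first by rewrite !inE eqxx.
  move=> Z ZE Z0 zZ; have ZX : Z \subset X by rewrite -EX subsetD1 ZE.
  have := conn_rootP cD zD (subset_trans ZX XD') Z0 zZ.
  case/adjsP=> u [w [uZ]]; rewrite inE => /andP[wZ wD] uw.
  by apply/adjsP; exists u, w; rewrite in_setD wZ uZ (out u) // (subsetP ZX).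
have small y Z : y \in D -> Z \subset X -> Z != X -> Z != set0 -> Z \subset D :\ y ->
    Z != D :\ y -> adjs e Z (D :\ y :\: Z).
  move=> yD ZX ZnX Z0 ZD ZnD; apply: contraT => nZ.
  have : P (y, Z).
    by apply/andP; split=> //; apply/and5P; split=> //; apply: contra x0X; apply: subsetP.
  by move/mX => /=; have := proper_card (_ : Z \proper X); rewrite properEneq ZnX => /(_ ZX); nlia.
have nE y : nsep e ((z |: X) :\ y).
  have [->|yz] := eqVneq y z.
    rewrite EX; apply: nsepI => Z ZX Z0 ZnX.
    have := small z Z zD ZX ZnX Z0 (subset_trans ZX XD).
    have -> : Z != D :\ z by apply: contraNneq Xn => ZD; rewrite eqEsubset XD -ZD.
    move=> /(_ isT) /adjsP[u [w [uZ]]]; rewrite !inE => /and3P[wZ wz wD] uw.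
    apply/adjsP; exists u, w; split=> //; rewrite inE wZ.
    by have := out u w (subsetP ZX u uZ) wD uw; rewrite in_setU1 (negPf wz).
  have [yX|yX] := boolP (y \in X); last first.
    rewrite (setDidPl _) //; first by case/andP: cE.
    by rewrite disjoint_sym disjoints1 in_setU1 negb_or yz.
  apply: (nsep_root se (r := z)); first by rewrite !inE eq_sym yz eqxx.
  move=> Z ZE Z0 zZ; have /subsetD1P[ZE' yZ] := ZE.
  have ZX : Z \subset X by rewrite -EX subsetD1 ZE'.
  have yD := subsetP XD' y yX.
  have := small y Z yD ZX.
  have -> : Z != X by apply: contraNneq yZ => ->.
  have -> : Z \subset D :\ y by rewrite subsetD1 (subset_trans ZX).
  have -> : Z != D :\ y by apply: contraNneq zZ => ->; rewrite !inE eq_sym yz.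
  move=> /(_ isT Z0 isT isT) /adjsP[u [w [uZ]]]; rewrite !inE => /and3P[wZ wy wD] uw.
  apply/adjsP; exists u, w; split=> //; rewrite in_setD in_setD1 wZ wy.
  exact: (out u w (subsetP ZX u uZ) wD uw).
have cDX : conn e (D :\: X) by apply: (conn_setD (B := [set z])); rewrite ?conn1 ?sub1set.
exists (z |: X), z; rewrite EX; split; split=> //.
- by rewrite !inE eqxx.
- by rewrite subUset sub1set zD.
- move=> w wX; have -> : D :\ w = ((z |: X) :\ w) :|: (D :\: X).
    apply/setP => v; rewrite !inE; have [->|vw] := eqVneq v w; first by rewrite wX.
    have [->|vz] := eqVneq v z; first by rewrite zD.
    by case: (boolP (v \in X)) => //= vX; rewrite (subsetP XD').
  have zw : z != w by apply: contraNneq zX => ->.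
  have : conn e ((z |: X) :\ w :|: D :\: X); last by case/andP.
  apply: connU => //; first by apply: (nsep_conn (nE w) (x := z)); rewrite !inE zw eqxx.
  by apply/orP; left; apply/set0Pn; exists z; rewrite !inE zw eqxx zX.
by move=> XE; rewrite XE eqxx in X0.
Qed.

Lemma complete_K5free e W E : irreflexive e -> K5free e W -> E \subset W ->
  (forall x y, x \in E -> y \in E -> x != y -> e x y) -> #|E| <= 4.
Proof.
move=> ie K EW cE; rewrite leqNgt; apply/negP => E5.
have /negP := K [seq [set y] | y <- take 5 (enum E)]; apply; apply/and3P; split.
- by rewrite size_map size_takel // -cardE.
- apply/allP => A /mapP[y /mem_take + ->]; rewrite mem_enum => yE.
  by rewrite sub1set (subsetP EW) ?conn1.
rewrite pairwise_map.
have := take_uniq 5 (enum_uniq E); rewrite uniq_pairwise.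
apply: (@sub_in_pairwise _ (mem E)); last by apply/allP => y /mem_take; rewrite mem_enum.
by move=> x y xE yE /= xy; rewrite disjoints1 inE xy adjs11 cE.
Qed.

End EndBlock.

(** * Forbidden colours that make a component extendable *)

Section Guard.
Variables (V C : finType) (c0 : C) (b : nat).
(** In the application [b] is k - 5, so this is the condition on k, and the bound [b + 4] on the
    lists below is k - 1. *)
Hypothesis b3 : 3 <= b.
Implicit Types (e : rel V) (A B D E K P Q S U W X Y Z : {set V}) (q r u v w x y z : V).
Implicit Types (L F : V -> {set C}) (phi : V -> C).

Definition rest e U L phi w := L w :\: phi @: nb e U w.

(* Forbidding the at most [b] colours [F u] at each outer neighbour [u] of [D]
   guarantees that any colouring outside of [D] extends to [D]. *)
Definition guarded e D U L := exists F : V -> {set C},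
  [/\ forall u, #|F u| <= b, forall u, F u != set0 -> u \in U /\ adjs e D [set u] &
      forall phi, (forall u, u \in U -> phi u \notin F u) -> col e D (rest e U L phi)].

(* [U] is the set of possible outer neighbours; adjacencies inside [U] are
   irrelevant except for [K5free]. *)
Record fits e D U L : Prop := Fits {
  fits_sym : symmetric e;
  fits_irr : irreflexive e;
  fits_K5 : K5free e (D :|: U);
  fits_dis : [disjoint D & U];
  fits_conn : conn e D;
  fits_adj : adjs e D U;
  fits_deg : forall w, w \in D -> #|nb e D w| + #|nb e U w| <= #|L w|;
  fits_le : forall w, w \in D -> #|L w| <= b + 4 }.

Section Step.
Variable n : nat.
Hypothesis IH : forall e D U L, #|D| < n -> fits e D U L -> guarded e D U L.
Variables (e : rel V) (D U : {set V}) (L : V -> {set C}).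
Hypothesis Dn : #|D| <= n.
Hypothesis G : fits e D U L.

Let se := fits_sym G.
Let ie := fits_irr G.
Let cD := fits_conn G.

Lemma rest_deg phi w : w \in D -> #|nb e D w| <= #|rest e U L phi w|.
Proof.
move=> wD; have := fits_deg G wD; have := card_setD_ge (L w) (phi @: nb e U w).
by have := leq_imset_card phi (nb e U w); rewrite /rest; nlia.
Qed.

Lemma rest_mem phi w c : c \in L w -> (forall u, u \in nb e U w -> phi u != c) ->
  c \in rest e U L phi w.
Proof.
move=> cL h; rewrite inE cL andbT; apply/imsetP => -[u uN cu].
by have := h u uN; rewrite cu eqxx.
Qed.

Lemma adjs_nb u w : w \in D -> u \in nb e U w -> u \in U /\ adjs e D [set u].
Proof.
rewrite in_nb => wD /andP[uU wu]; split=> //.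
by apply/adjsP; exists w, u; rewrite inE.
Qed.

(** Colours of [L w] forbidden at all outer neighbours of [w] survive every outer colouring; one
    more than the degree of [w] in [D] makes a surplus. *)
Lemma guarded_surplus w : w \in D -> nb e U w != set0 -> #|nb e D w| < b -> guarded e D U L.
Proof.
move=> wD; rewrite -card_gt0 => Nw db.
have [T [_ TL TD]] : exists T : {set C}, [/\ set0 \subset T, T \subset L w & #|T| = #|nb e D w|.+1].
  apply: card_between; rewrite ?sub0set // cards0 /=.
  by have := fits_deg G wD; nlia.
exists (fun u => if u \in nb e U w then T else set0); split.
- by move=> u; case: ifP => _; rewrite ?TD ?cards0.
- by move=> u; case: ifP => [uN _|]; [apply: adjs_nb uN|rewrite eqxx].
move=> phi h; apply: (col_surplus c0 se ie cD (rest_deg phi) wD).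
rewrite -TD; apply/subset_leq_card/subsetP => c cT.
apply: rest_mem; first exact: (subsetP TL).
move=> u uN; have [uU _] := adjs_nb wD uN.
by have := h u uU; rewrite uN; apply: contraNneq => ->.
Qed.

(** A single forbidden colour keeps [c] available at [v], while [w] never has it, so [col_noncut]
    applies. *)
Lemma guarded_color v w c : v \in D -> nsep e (D :\ v) -> w \in D -> e v w ->
  c \in L v -> c \notin L w -> guarded e D U L.
Proof.
move=> vD nv wD vw cv cw.
exists (fun u => if u \in nb e U v then [set c] else set0); split.
- by move=> u; case: ifP => _; rewrite ?cards1 ?cards0; move: b3; clear; lia.
- by move=> u; case: ifP => [uN _|]; [apply: adjs_nb uN|rewrite eqxx].
move=> phi h; apply: (col_noncut c0 se ie (rest_deg phi) vD nv wD vw (c := c)).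
  apply: rest_mem => // u uN; have [uU _] := adjs_nb vD uN.
  by have := h u uU; rewrite uN inE.
by rewrite inE (negPf cw) andbF.
Qed.

(** The list of [w] does not depend on the outer colouring, so [w] can be coloured in advance and
    deleted; the guard of [D :\ w] is reused. *)
Lemma guarded_free w : w \in D -> nsep e (D :\ w) -> nb e U w = set0 -> guarded e D U L.
Proof.
move=> wD nw Nw; have /adjsP[d [u0 [dD u0U du0]]] := fits_adj G.
have dw : d != w by apply: contra_eqN Nw => /eqP <-; apply/set0Pn; exists u0; rewrite in_nb u0U.
have dDw : d \in D :\ w by rewrite !inE dw.
have /card_gt0P[c cL] : 0 < #|L w|.
  have /card_gt0P : 0 < #|nb e D w|; last first.
    by move=> /card_gt0P; have := fits_deg G wD; nlia.
  have := conn_rootP (X := [set w]) cD dD; rewrite sub1set wD inE dw.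
  have -> : [set w] != set0 by apply/set0Pn; exists w; rewrite inE.
  move=> /(_ isT isT isT) /adjsP[x [y [/set1P-> + wy]]]; rewrite inE => /andP[_ yD].
  by apply/card_gt0P; exists y; rewrite in_nb yD.
pose L2 u := if e w u then L u :\ c else L u.
have [||F [F1 F2 F3]] := @IH e (D :\ w) U L2.
- by move: Dn; rewrite (cardsD1 w D) wD; nlia.
- split=> //.
  + by apply: K5free_sub (fits_K5 G) => //; apply: setSU; apply: subsetDl.
  + by apply: disjointWl (fits_dis G); apply: subsetDl.
  + exact: nsep_conn nw dDw.
  + by apply/adjsP; exists d, u0.
  + move=> u; rewrite inE => /andP[_ uD]; have := fits_deg G uD; rewrite (nb_setD1 _ _ wD) se /L2.
    by case: (e w u) => //=; have := card_setD1_ge (L u) c; nlia.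
  move=> u; rewrite inE => /andP[_ uD]; apply: leq_trans (fits_le G uD).
  by apply: subset_leq_card; rewrite /L2; case: ifP; rewrite ?subsetDl.
exists F; split=> // [u /F2[uU Du]|phi h].
  by split=> //; apply: adjs_sub Du => //; apply: subsetDl.
apply: (@col_vertex _ _ e D _ w c) => //.
  by apply: rest_mem => // u; rewrite Nw inE.
apply: col_sub (F3 phi h) => // u _; rewrite /rest /L2.
by case: ifP => // _; rewrite setDDl setUC -setDDl.
Qed.

(** * The end block K4 when three colours may be forbidden *)

Section Quad.
Variables (E : {set V}) (x : V).
Hypotheses (xE : x \in E) (ED : E \subset D) (E4 : #|E| = 4).
Hypothesis Ecomplete : forall u v, u \in E -> v \in E -> u != v -> e u v.
Hypothesis Enc : forall w, w \in E :\ x -> nsep e (D :\ w).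
Hypothesis Eout : forall u w, u \in E :\ x -> w \in D -> e u w -> w \in E.
Let B := E :\ x.
Let D' := D :\: B.
Hypothesis cD' : conn e D'.
Hypothesis aD' : adjs e D' U.
Variable S : {set C}.
Hypothesis LS : forall w, w \in B -> L w = S.
Hypothesis bE : b = 3.
Variable phi0 : V -> C.
Hypothesis bad0 : ~ col e D (rest e U L phi0).

Local Notation N := (nb e U).

Lemma B_mem w : w \in B -> [/\ w \in E, w != x & w \in D].
Proof. by rewrite inE => /andP[wx wE]; split=> //; [rewrite inE in wx|apply: (subsetP ED)]. Qed.

Lemma card_B : #|B| = 3.
Proof. by have := cardsD1 x E; rewrite xE E4 => -[]. Qed.

Lemma nbB w : w \in B -> nb e D w = E :\ w.
Proof.
move=> wB; have [wE _ wD] := B_mem wB; apply/setP => u; rewrite in_nb in_setD1.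
have [->|uw] := eqVneq u w; first by rewrite ie andbF.
apply/andP/idP => [[uD wu]|uE]; first exact: (Eout wB).
by rewrite (subsetP ED) // Ecomplete // eq_sym.
Qed.

Lemma degB w : w \in B -> #|nb e D w| = 3.
Proof.
move=> wB; have [wE _ _] := B_mem wB; rewrite nbB //.
by have := cardsD1 w E; rewrite wE E4 => -[].
Qed.

(** If the degree count were not tight at some vertex of [B], that vertex would have a surplus; if
    two remaining lists in [B] differed, [col_noncut] would colour [D]. *)
Lemma bad_quad phi : ~ col e D (rest e U L phi) ->
  [/\ forall w, w \in B -> phi @: N w \subset S,
      forall w, w \in B -> #|S| = #|N w| + 3,
      forall w, w \in B -> {in N w &, injective phi} &
      forall w w', w \in B -> w' \in B -> phi @: N w = phi @: N w'].
Proof.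
move=> bad.
have r3 w : w \in B -> #|S :\: phi @: N w| = 3.
  move=> wB; have [_ _ wD] := B_mem wB; have := rest_deg phi wD.
  rewrite degB // /rest LS // => h; apply/eqP; rewrite eqn_leq h andbT leqNgt; apply/negP => h'.
  apply: bad; apply: (col_surplus c0 se ie cD (rest_deg phi) wD).
  by rewrite degB // /rest LS.
have S3 w : w \in B -> #|N w| + 3 <= #|S|.
  by move=> wB; have [_ _ wD] := B_mem wB; have := fits_deg G wD; rewrite degB // LS // addnC.
have cI w : w \in B -> #|S :&: phi @: N w| + 3 = #|S|.
  by move=> wB; rewrite -(cardsID (phi @: N w) S) r3.
have le1 w : #|S :&: phi @: N w| <= #|phi @: N w| by apply/subset_leq_card/subsetIr.
have le2 w := leq_imset_card phi (N w).
have sub w : w \in B -> phi @: N w \subset S.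
  move=> wB; apply/setIidPr/eqP; rewrite eqEcard subsetIr.
  by have := S3 w wB; have := cI w wB; have := le2 w; nlia.
split=> // [w wB|w wB|].
- by have := S3 w wB; have := cI w wB; have := le1 w; have := le2 w; nlia.
- apply/imset_injP; rewrite eqn_leq le2 /=.
  by have := S3 w wB; have := cI w wB; have := le1 w; nlia.
have half w w' : w \in B -> w' \in B -> phi @: N w' \subset phi @: N w.
  move=> wB w'B; have [<-//|ww'] := eqVneq w w'.
  have [wE _ wD] := B_mem wB; have [w'E _ w'D] := B_mem w'B.
  apply/subsetP => c cN; apply: contraT => ncN; case: bad.
  have cS := subsetP (sub w' w'B) c cN.
  apply: (col_noncut c0 se ie (rest_deg phi) wD (Enc wB) w'D _ (c := c)).
  - exact: Ecomplete.
  - by rewrite inE LS // cS ncN.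
  by rewrite inE cN.
by move=> w w' wB w'B; apply/eqP; rewrite eqEsubset !half.
Qed.

Lemma card_S w : w \in B -> #|S| = #|N w| + 3.
Proof. by case: (bad_quad bad0) => _ + _ _; apply. Qed.

Lemma three_colours : exists2 T : {set C}, T \subset S & #|T| = 3.
Proof.
have /card_gt0P[w wB] : 0 < #|B| by rewrite card_B.
have [T [_ TS T3]] := @card_between _ set0 S 3 (sub0set _) ltac:(by rewrite cards0 (card_S wB) leq_addl).
by exists T.
Qed.

(** With [T] forbidden on [N w], a bad colouring must use exactly [S :\: T] there, and by [bad_quad]
    the same colours, all distinct, on [N w']. Forbidding up to three of them on [N w' :\: N w]
    leaves too few for that set. *)
Lemma guarded_far w w' : w \in B -> w' \in B -> #|N w| - 3 < #|N w' :\: N w| -> guarded e D U L.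
Proof.
move=> wB w'B far; have [T TS T3] := three_colours; have [_ _ wD] := B_mem wB; have [_ _ w'D] := B_mem w'B.
pose M := S :\: T.
have Mp : #|M| = #|N w|.
  have := cardsID T S; rewrite (setIidPr TS) T3 -/M (card_S wB); nlia.
have [M' [_ M'M M'3]] := @card_between _ set0 M (minn 3 #|N w|) (sub0set _)
  ltac:(by rewrite cards0 Mp /= geq_minr).
exists (fun u => if u \in N w then T else if u \in N w' then M' else set0); split.
- move=> u; case: ifP => _; first by rewrite T3 bE.
  by case: ifP => _; rewrite ?M'3 ?cards0 // bE geq_minl.
- move=> u; case: ifP => [uN _|_]; first exact: adjs_nb uN.
  by case: ifP => [uN _|]; [apply: adjs_nb uN|rewrite eqxx].
move=> phi h; apply: NNPP => bad; have [sub cS inj eqN] := bad_quad bad.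
have im : phi @: N w = M.
  apply/eqP; rewrite eqEcard (card_in_imset (inj w wB)) Mp leqnn andbT.
  apply/subsetP => _ /imsetP[u uN ->]; rewrite inE (subsetP (sub w wB)) ?imset_f // andbT.
  by have [uU _] := adjs_nb wD uN; have := h u uU; rewrite uN.
have : #|phi @: (N w' :\: N w)| <= #|M :\: M'|.
  apply/subset_leq_card/subsetP => _ /imsetP[u /setDP[uN' uN] ->].
  rewrite in_setD -im (eqN w w') // imset_f // andbT.
  by have [uU _] := adjs_nb w'D uN'; have := h u uU; rewrite (negPf uN) uN'.
rewrite card_in_imset; last first.
  by move=> u v /setDP[uN _] /setDP[vN _]; apply: (inj w').
have := cardsID M' M; rewrite (setIidPr M'M) M'3 Mp; move: far; nlia.
Qed.

(** Once [D'] is coloured, each vertex of the triangle [B] has at least two colours left, and [w]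
    has all three of [T], as neither its outer neighbours nor [x] use them. *)
Lemma finish (T : {set C}) phi w (psi : V -> C) : T \subset S -> #|T| = 3 -> w \in B ->
  (forall u, u \in N w -> phi u \notin T) ->
  (forall v, v \in D' -> psi v \in rest e U L phi v) ->
  (forall u v, u \in D' -> v \in D' -> e u v -> psi u != psi v) ->
  psi x \notin T -> col e D (rest e U L phi).
Proof.
move=> TS T3 wB wT h1 h2 xT.
have nbBB v : v \in B -> #|nb e B v| = 2.
  move=> vB; have -> : nb e B v = B :\ v.
    apply/setP => u; rewrite in_nb in_setD1 andbC.
    have [->|uv] := eqVneq u v; first by rewrite ie.
    have [uE|] := boolP (u \in B); last by rewrite andbF.
    by have [? _ _] := B_mem uE; have [? _ _] := B_mem vB; rewrite Ecomplete // eq_sym.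
  by have := cardsD1 v B; rewrite vB card_B => -[].
have cB : conn e B.
  apply: (@nsep_conn _ _ _ w) => //; apply: (nsep_root se wB) => X XB /set0Pn[v vX] wX.
  apply/adjsP; exists v, w; rewrite inE wX; split=> //.
  have [vE _ _] := B_mem (subsetP XB v vX); have [wE _ _] := B_mem wB.
  by apply: Ecomplete => //; apply: contraNneq wX => <-.
have w3 : 2 < #|rest e U L phi w :\ psi x|.
  rewrite -T3; apply/subset_leq_card/subsetP => c cT; rewrite inE in_set1; apply/andP; split.
    by apply: contraNneq xT => <-.
  apply: rest_mem; first by rewrite LS // (subsetP TS).
  by move=> u /wT; apply: contraNneq => ->.
have [||g [g1 g2]] := @col_surplus _ _ c0 e B (fun v => rest e U L phi v :\ psi x) w se ie cB _ wB.
- move=> v vB; have [_ _ vD] := B_mem vB; rewrite nbBB //.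
  by have := rest_deg phi vD; rewrite degB //; have := card_setD1_ge (rest e U L phi v) (psi x); nlia.
- by rewrite nbBB.
have cross u v : u \in B -> v \in D -> v \notin B -> e u v -> g u != psi v.
  move=> uB vD vB uv; have vE := Eout uB vD uv.
  have -> : v = x by apply/eqP; move: vB; rewrite in_setD1 vE andbT negbK.
  by have := g1 u uB; rewrite !inE => /andP[].
exists (fun v => if v \in B then g v else psi v); split=> [v vD|u v uD vD uv].
  case: ifPn => vB; last by apply: h1; rewrite in_setD vB.
  by have := g1 v vB; rewrite in_setD1 => /andP[].
case: ifPn => uB; case: ifPn => vB.
- exact: g2.
- exact: cross.
- by rewrite eq_sym; apply: cross; rewrite // se.
by apply: h2; rewrite // in_setD ?uB ?vB.
Qed.

Lemma xD' : x \in D'.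
Proof. by rewrite !inE eqxx (subsetP ED). Qed.

Lemma D'_lt : #|D'| < n.
Proof.
have := cardsID B D; rewrite (setIidPr _) -/D' ?card_B; first by move: Dn; nlia.
by apply/subsetP => w /B_mem[].
Qed.

(** Otherwise the vertices of [B], [c] and the connected set [D'] form a K5 model; [D'] is adjacent
    to [B] through [x]. *)
Lemma common_far (c : V) : (forall w, w \in B -> c \in N w) -> ~~ adjs e D' [set c].
Proof.
move=> cN; apply/negP => Dc.
have /card_gt2P[w1 [w2 [w3 [[B1 B2 B3] [n12 n23 n31]]]]] : 2 < #|B| by rewrite card_B.
have cU : c \in U by have := cN _ B1; rewrite in_nb => /andP[].
have cD0 : c \notin D by rewrite (disjointFl (fits_dis G)).
have inD w : w \in B -> w \in D :|: U by move=> /B_mem[_ _ wD]; rewrite inE wD.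
have wc w : w \in B -> w != c by move=> /B_mem[_ _ wD]; apply: contraNneq cD0 => <-.
have wD' w : w \in B -> w \notin D' by move=> wB; rewrite in_setD wB.
have wx w : w \in B -> adjs e [set w] D'.
  move=> wB; have [wE wx _] := B_mem wB; apply/adjsP; exists w, x.
  by rewrite inE eqxx xD' Ecomplete.
have ww w w' : w \in B -> w' \in B -> w != w' -> adjs e [set w] [set w'].
  by move=> /B_mem[wE _ _] /B_mem[w'E _ _] ww'; rewrite adjs11 Ecomplete.
have wcN w : w \in B -> adjs e [set w] [set c].
  by move=> /cN; rewrite in_nb adjs11 => /andP[].
have sD' : D' \subset D :|: U by apply: subset_trans (subsetDl _ _) (subsetUl _ _).
have cD'' : c \notin D' by apply: contra cD0; rewrite inE => /andP[].
have cW : c \in D :|: U by rewrite inE cU orbT.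
have Dc' : adjs e [set c] D' by rewrite adjs_sym.
have n13 : w1 != w3 by rewrite eq_sym.
by apply: (@K5free_five _ e (D :|: U) [set w1] [set w2] [set w3] [set c] D' se (fits_K5 G));
  rewrite ?conn1 ?sub1set ?disjoints1 ?in_set1 ?cW ?cD'' ?Dc' ?inD ?wD' ?wx ?wcN ?ww ?wc.
Qed.

Lemma nbD' y : y \in D' -> #|nb e D y| = (y == x) * 3 + #|nb e D' y|.
Proof.
move=> yD'; have /setDP[yD yB] := yD'.
have BD : B \subset D by apply/subsetP => w /B_mem[].
rewrite (nb_split _ _ BD) -/D'; congr (_ + _).
have [->|yx] := eqVneq y x.
  rewrite mul1n -card_B; apply/eq_card => w; rewrite in_nb.
  by case: (boolP (w \in B)) => //= /B_mem[wE wx _]; rewrite Ecomplete // eq_sym.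
apply/eqP; rewrite mul0n cards_eq0 -subset0; apply/subsetP => w; rewrite in_nb.
case/andP=> wB yw; have := Eout wB yD; rewrite se yw => /(_ isT) yE.
by rewrite in_setD1 yx yE in yB.
Qed.

(** [T] is forbidden on the common outer neighbourhood and removed from the list of [x], which can
    spare three colours because it loses three neighbours. By [common_far] the guard of [D'] is
    empty on that neighbourhood, so the two demands never add up. *)
Lemma guarded_equal : (forall w w', w \in B -> w' \in B -> N w = N w') -> guarded e D U L.
Proof.
move=> Neq; have [T TS T3] := three_colours.
have /card_gt0P[w wB] : 0 < #|B| by rewrite card_B.
have [_ _ wD] := B_mem wB.
pose L2 v := if v == x then L v :\: T else L v.
have [||F [F1 F2 F3]] := @IH e D' U L2; first exact: D'_lt.
- split=> //.
  + by apply: K5free_sub (fits_K5 G) => //; apply: setSU; apply: subsetDl.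
  + by apply: disjointWl (fits_dis G); apply: subsetDl.
  + move=> y yD'; have /setDP[yD yB] := yD'; have := fits_deg G yD; rewrite nbD' // /L2.
    by case: (y == x) => /=; [have := card_setD_ge (L y) T; rewrite T3; nlia|nlia].
  move=> y /setDP[yD _]; apply: leq_trans (fits_le G yD).
  by apply: subset_leq_card; rewrite /L2; case: ifP; rewrite ?subsetDl.
have F0 u : u \in N w -> F u = set0.
  move=> uN; apply/eqP; apply: contraT => /F2[_].
  by rewrite (negPf (common_far _)) // => w' w'B; rewrite (Neq w' w).
exists (fun u => if u \in N w then T else F u); split.
- by move=> u; case: ifP => _; rewrite ?T3.
- move=> u; case: ifP => [uN _|_ /F2[uU Du]]; first exact: adjs_nb uN.
  by split=> //; apply: adjs_sub Du => //; apply: subsetDl.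
move=> phi h.
have [|psi [h1 h2]] := F3 phi.
  by move=> u uU; have := h u uU; case: ifP => // uN _; rewrite F0 // inE.
apply: (finish TS T3 wB (psi := psi)) => //.
- move=> u uN; have [uU _] := adjs_nb wD uN.
  by have := h u uU; rewrite uN.
- move=> v vD'; have := h1 v vD'; rewrite /rest /L2 !inE; case: ifP => // _.
  by rewrite inE => /and3P[-> _ ->].
by have := h1 x xD'; rewrite /rest /L2 eqxx !inE => /and3P[].
Qed.

(* In every colouring that does not extend, [u1] and [u2] have the same colour,
   so they can be identified; the contracted set is joined through [B]. *)
Lemma guarded_merge w1 w2 u1 u2 : w1 \in B -> w2 \in B ->
  u1 \in N w1 :\: N w2 -> u2 \in N w2 :\: N w1 ->
  (forall u, u \in N w1 -> u != u1 -> forall w, w \in B -> u \in N w) ->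
  (forall phi, ~ col e D (rest e U L phi) -> phi u1 = phi u2) -> guarded e D U L.
Proof.
move=> B1 B2 /setDP[u1N u1N2] /setDP[u2N u2N1] C12 same.
have [T TS T3] := three_colours; have [w1E _ w1D] := B_mem B1; have [w2E _ w2D] := B_mem B2.
have [u1U _] := adjs_nb w1D u1N; have [u2U Du2] := adjs_nb w2D u2N.
have w12 : w1 != w2 by apply: contraNneq u1N2 => <-.
have u12 : u2 != u1 by apply: contraNneq u1N2 => <-.
have UD u : u \in U -> u \notin D by move=> uU; rewrite (disjointFl (fits_dis G)).
(* Unlike in the contraction of [Q], only the neighbours of [u1] pass to [u2], not those of [w1] and
   [w2]; so no vertex of [D'] gains outer neighbours. The contraction is used for K5-freeness
   only. *)
pose e2 a a' := (a != a') && [|| e a a', (a == u2) && e u1 a' | (a' == u2) && e u1 a].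
have se2 : symmetric e2.
  move=> a a'; rewrite /e2 eq_sym se; case: (a' != a) => //=; congr (_ || _).
  by rewrite orbC.
have ie2 : irreflexive e2 by move=> a; rewrite /e2 eqxx.
have e2E a a' : a != u2 -> a' != u2 -> e2 a a' = e a a'.
  move=> /negPf au /negPf bu; rewrite /e2 au bu !orbF.
  by case: eqP => // ->; rewrite ie.
have ee2 a a' : e a a' -> e2 a a'.
  by move=> ab; rewrite /e2 ab andbT; apply: contraTneq ab => ->; rewrite ie.
have D'D v : v \in D' -> v \in D by case/setDP.
have D'u2 v : v \in D' -> v != u2.
  by move=> /D'D vD; apply: contraTneq vD => ->; apply: UD.
pose U' := U :\ u1; have u2U' : u2 \in U' by rewrite !inE u12.
pose Q := [set u1; w1; w2; u2].
have cQ : conn e Q.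
  have a1 : e w1 u1 by move: u1N; rewrite in_nb => /andP[].
  have a2 : e w2 u2 by move: u2N; rewrite in_nb => /andP[].
  apply: connU; rewrite ?conn1 //; last first.
    by apply/orP; right; apply/adjsP; exists w2, u2; rewrite !inE eqxx ?orbT.
  apply: connU; rewrite ?conn1 //; last first.
    by apply/orP; right; apply/adjsP; exists w1, w2; rewrite !inE eqxx ?orbT Ecomplete.
  by apply: connU; rewrite ?conn1 // adjs11 se a1 orbT.
have K2 : K5free e2 (D' :|: U').
  have sQ : Q \subset D :|: U.
    by rewrite /Q !subUset !sub1set !in_setU u1U u2U w1D w2D !orbT.
  apply: (@K5free_sub _ (contract e Q u2) e2 (D' :|: U')) => //.
    move=> u v _ _ /andP[uv /or3P[euv|/andP[/eqP uu u1v]|/andP[/eqP vu u1u]]].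
    - by apply: contract_incl => //; rewrite !inE eqxx orbT.
    - rewrite /= uv; apply/adjsP; exists u1, v; rewrite u1v /blow uu eqxx; split=> //.
        by rewrite !inE eqxx.
      by rewrite -/(blow Q u2 v) mem_blow // !inE eqxx orbT.
    rewrite /= uv; apply/adjsP; exists u, u1; rewrite se u1u /blow vu eqxx; split=> //.
      by rewrite -/(blow Q u2 u) mem_blow // !inE eqxx orbT.
    by rewrite !inE eqxx.
  apply: K5free_contract (fits_K5 G) => //.
  - by rewrite !inE eqxx orbT.
  - by apply: setUSS; apply: subsetDl.
  apply/subsetP => v; rewrite in_setI in_setU => /andP[vDU]; rewrite 3!in_setU !in_set1.
  case/orP=> [/orP[/orP[]|]|//] /eqP vE; move: vDU; rewrite vE.
  - rewrite [u1 \in U']inE in_set1 eqxx orbF => /D'D u1D.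
    by have := UD _ u1U; rewrite u1D.
  - by rewrite in_setD B1 in_setD1 orFb => /andP[_ w1U]; have := UD _ w1U; rewrite w1D.
  by rewrite in_setD B2 in_setD1 orFb => /andP[_ w2U]; have := UD _ w2U; rewrite w2D.
have nbU' v : v \in D' -> nb e2 U' v = (if e v u1 then u2 |: (N v :\ u1) else N v).
  move=> vD'; apply/setP => u; rewrite in_nb in_setD1 /e2.
  rewrite (negPf (D'u2 v vD')) /= (se u1 v).
  have [->|uu2] := eqVneq u u2.
    rewrite u12 u2U D'u2 //=; case: (e v u1); first by rewrite !inE eqxx orbT.
    by rewrite orbF in_nb u2U.
  rewrite orbF; have [uU|uU] := boolP (u \in U); last first.
    by rewrite andbF; case: ifP => _; rewrite ?in_setU1 ?in_setD1 ?in_nb (negPf uU) ?(negPf uu2) ?andbF.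
  have vu : v != u by apply: contraTneq uU => <-; apply: contraTN (D'D v vD'); apply: UD.
  rewrite vu /=; case: ifP => vu1.
    by rewrite in_setU1 (negPf uu2) in_setD1 in_nb uU andbT.
  by rewrite in_nb uU andbT /=; case: eqP => // ->; rewrite vu1.
have cU' v : v \in D' -> #|nb e2 U' v| <= #|N v|.
  move=> vD'; rewrite nbU' //; case: ifP => // vu1.
  rewrite (cardsD1 u1 (N v)) in_nb u1U vu1 /=.
  by apply: leq_trans (cardsU_le _ _) _; rewrite cards1.
have nbD2 v : v \in D' -> nb e2 D' v = nb e D' v.
  move=> vD'; apply/setP => u; rewrite !in_nb; have [uD'|//] := boolP (u \in D').
  by rewrite e2E ?D'u2.
pose L2 v := if v == x then L v :\: T else L v.
have [||F [F1 F2 F3]] := @IH e2 D' U' L2; first exact: D'_lt.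
- split=> //.
  + by apply: disjointW (fits_dis G); apply: subsetDl.
  + by apply: conn_sub cD' => u v uD' vD'; apply: ee2.
  + have /adjsP[d [u [dD' uU du]]] := aD'; apply/adjsP.
    have [uu1|uu1] := eqVneq u u1; last by exists d, u; split=> //; [rewrite !inE uu1|apply: ee2].
    exists d, u2; rewrite u2U'; split=> //.
    by rewrite /e2 D'u2 //= eqxx (se u1 d) -uu1 du !orbT.
  + move=> y yD'; have /setDP[yD yB] := yD'; have := fits_deg G yD; rewrite nbD' // nbD2 // /L2.
    have := cU' y yD'.
    by case: (y == x) => /=; [have := card_setD_ge (L y) T; rewrite T3; nlia|nlia].
  move=> y /setDP[yD _]; apply: leq_trans (fits_le G yD).
  by apply: subset_leq_card; rewrite /L2; case: ifP; rewrite ?subsetDl.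
have F2' u : u != u2 -> F u != set0 -> u \in U' /\ adjs e D' [set u].
  move=> uu2 /F2[uU' /adjsP[d [v [dD' /set1P-> du]]]]; split=> //.
  by apply/adjsP; exists d, u; rewrite in_set1 -e2E // D'u2.
have F0 u : u \in N w1 -> u != u1 -> F u = set0.
  move=> uN uu1; apply/eqP; apply: contraT => /F2'.
  have -> : u != u2 by apply: contraNneq u2N1 => <-.
  move=> /(_ isT)[_]; rewrite (negPf (common_far _)) // => w wB; exact: C12.
(* No vertex gets two demands: [u2] is outside [N w1], [u1] is outside [U'], and on the rest of
   [N w1] the guard of [D'] is empty. *)
pose F' u := if u == u2 then F u2 else if u \in N w1 then T else F u.
exists F'; split.
- by move=> u; rewrite /F'; case: ifP => // _; case: ifP => // _; rewrite T3.
- move=> u; rewrite /F'; have [->//|uu2] := eqVneq u u2.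
  case: ifP => [uN _|_ Fu]; first exact: adjs_nb uN.
  have [uU' Du] := F2' u uu2 Fu; split; first by move: uU'; rewrite inE => /andP[].
  by apply: adjs_sub Du => //; apply: subsetDl.
move=> phi h; apply: NNPP => bad; have phi12 := same phi bad; apply: bad.
have hF u : u \in U' -> phi u \notin F u.
  rewrite in_setD1 => /andP[uu1 uU]; have := h u uU; rewrite /F'.
  by case: eqP => [->//|_]; case: ifP => // uN _; rewrite F0 // inE.
have [psi [h1 h2]] := F3 phi hF.
have imU' v : v \in D' -> phi @: nb e2 U' v = phi @: N v.
  move=> vD'; rewrite nbU' //; case: ifP => // vu1.
  have u1Nv : u1 \in N v by rewrite in_nb u1U.
  by rewrite imsetU1 -phi12 -imsetU1 setD1K.
have h1' v : v \in D' -> psi v \in L2 v :\: phi @: N v.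
  by move=> vD'; rewrite -imU' //; apply: h1.
apply: (finish TS T3 B1 (psi := psi)).
- move=> u uN; have [uU _] := adjs_nb w1D uN.
  have := h u uU; rewrite /F' uN; case: eqP => // uu2.
  by rewrite -uu2 uN in u2N1.
- move=> v vD'; have := h1' v vD'; rewrite /rest /L2 !inE; case: ifP => // _.
  by rewrite inE => /and3P[-> _ ->].
- by move=> u v uD' vD' uv; apply: h2 => //; apply: ee2.
by have := h1' x xD'; rewrite /L2 eqxx !inE => /and3P[].
Qed.

(** At most 7 colours mean at most 4 outer neighbours for each vertex of [B]. Outside the reach of
    [guarded_far], two outer neighbourhoods then differ in at most one vertex each way, and these
    two vertices share their colour in every bad colouring. *)
Lemma guarded_quad : #|S| <= 7 -> guarded e D U L.
Proof.
move=> S7.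
have [/exists_inP[w wB /exists_inP[w' w'B far]]|near] :=
  boolP [exists w in B, [exists w' in B, #|N w| - 3 < #|N w' :\: N w|]].
  exact: guarded_far far.
have [sub0 cS inj0 eq0] := bad_quad bad0.
have N1 w w' : w \in B -> w' \in B -> #|N w' :\: N w| <= 1.
  move=> wB w'B; have /exists_inPn/(_ w' w'B) := exists_inPn near w wB.
  by have := cS w wB; move: S7; nlia.
have [|/forall_inPn[w1 B1 /forall_inPn[w2 B2 N12]]] :=
    boolP [forall w in B, [forall w' in B, N w == N w']].
  move=> /forall_inP h; apply: guarded_equal => w w' wB w'B.
  by apply/eqP; have /forall_inP := h w wB; apply.
have diff w w' : w \in B -> w' \in B -> N w != N w' -> exists u, N w :\: N w' = [set u].
  move=> wB w'B ww'; apply/cards1P; rewrite eqn_leq N1 //= card_gt0 setD_eq0.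
  apply: contra ww' => sub; rewrite eqEcard sub.
  by have := cS w wB; have := cS w' w'B; nlia.
have [u1 u1E] := diff w1 w2 B1 B2 N12.
have [|u2 u2E] := diff w2 w1 B2 B1; first by rewrite eq_sym.
have u1N : u1 \in N w1 :\: N w2 by rewrite u1E set11.
have u2N : u2 \in N w2 :\: N w1 by rewrite u2E set11.
have same phi : ~ col e D (rest e U L phi) -> phi u1 = phi u2.
  move=> bad; have [_ _ inj eqN] := bad_quad bad.
  have /setDP[u1N1 u1N2] := u1N.
  have : phi u1 \in phi @: N w2 by rewrite -(eqN w1 w2) // imset_f.
  case/imsetP=> t tN2 pt; have [tN1|tN1] := boolP (t \in N w1).
    by have ut := inj w1 B1 _ _ u1N1 tN1 pt; rewrite ut tN2 in u1N2.
  by have : t \in [set u2]; [rewrite -u2E inE tN1 | move/set1P=> <-].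
(* If [u] were missing from [N w], nothing else of [N w1] or [N w2] would be, so [N w] would contain
   both [u1] and [u2], on which [phi0] is not injective. *)
apply: (guarded_merge B1 B2 u1N u2N _ same) => u uN1 uu1 w wB; apply: contraT => uNw.
have uN2 : u \in N w2.
  by apply: contraT => uN2; have : u \in [set u1]; [rewrite -u1E inE uN2|rewrite inE (negPf uu1)].
have in_w v w' : v \in N w' -> w' \in B -> u \in N w' -> v != u -> v \in N w.
  move=> vN w'B uN' vu; apply: contraT => vw.
  have v1 : v \in N w' :\: N w by rewrite inE vw.
  have u1' : u \in N w' :\: N w by rewrite inE uNw.
  by have := card_le1P (N1 w w' wB w'B) v v1 u; rewrite u1' inE eq_sym (negPf vu).
have /setDP[u1N1 u1N2] := u1N; have /setDP[u2N2 u2N1] := u2N.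
have h1 : u1 \in N w by apply: (in_w u1 w1) => //; rewrite eq_sym.
have h2 : u2 \in N w by apply: (in_w u2 w2) => //; apply: contraNneq u2N1 => ->.
by have := inj0 w wB _ _ h1 h2 (same phi0 bad0) => u12; rewrite -u12 u1N1 in u2N1.
Qed.

End Quad.

(** A bad colouring leaves lists of the size of the degrees on an end block, which is therefore
    complete or 2-regular. Its non-cut vertices have outer neighbours, so degrees below [b] are
    settled by a surplus; what remains is a K4 with [b = 3]. *)
Lemma guarded_step : guarded e D U L.
Proof.
have [/exists_inP[w wD /andP[nw /eqP Nw]]|nofree] :=
    boolP [exists w in D, nsep e (D :\ w) && (nb e U w == set0)].
  exact: guarded_free nw Nw.
have free w : w \in D -> nsep e (D :\ w) -> nb e U w != set0.
  by move=> wD nw; have := exists_inPn nofree w wD; rewrite nw.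
case: (classic (forall phi, col e D (rest e U L phi))) => [all|].
  exists (fun=> set0); split=> [u|u|phi _]; last exact: all.
    by rewrite cards0.
  by rewrite eqxx.
case/not_all_ex_not=> phi0 bad0.
have [d [u [dD uU du]]] := adjsP _ _ _ (fits_adj G).
have [E [x [[xE ED cE nE] [dE cD' Eout Enc E0]]]] := end_block se cD dD.
have B_mem w : w \in E :\ x -> [/\ w \in E, w \in D, nb e U w != set0 & #|nb e D w| = #|nb e E w|].
  move=> wB; have /setD1P[wx wE] := wB; have wD := subsetP ED w wE.
  split=> //; first by rewrite free ?Enc.
  congr #|pred_of_set _|; apply/setP => v; rewrite !in_nb.
  have [vE|vE] := boolP (v \in E); first by rewrite (subsetP ED).
  rewrite andFb; apply/negP => /andP[vD wv].
  by rewrite (Eout w v) in vE.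
have [B0|/set0Pn[w wB]] := eqVneq (E :\ x) set0.
  have D1 := E0 B0; apply: (guarded_surplus dD).
    by apply/set0Pn; exists u; rewrite in_nb uU.
  apply: leq_trans b3; rewrite ltnS; apply: leq_trans (leq0n _).
  rewrite leqn0 cards_eq0 -subset0; apply/subsetP => v.
  by rewrite in_nb D1 in_set1 => /andP[/eqP->]; rewrite ie.
have [wE wD Nw dw] := B_mem w wB.
have E0' : E != set0 by apply/set0Pn; exists x.
have [L' dL' bad'] := residual_lists c0 se ie cD (rest_deg phi0) bad0 ED E0'.
have [cpl|[two _]] := nonseparable_uncolorable c0 se ie cE nE dL' bad'; last first.
  by apply: (guarded_surplus wD Nw); rewrite dw two.
have E4 : #|E| <= 4.
  exact: (complete_K5free ie (fits_K5 G) (subset_trans ED (subsetUl _ _)) cpl).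
have dE1 v : v \in E -> #|nb e E v| <= #|E|.-1.
  move=> vE; rewrite (cardsD1 v E) vE /=; apply/subset_leq_card/subsetP => t.
  by rewrite in_nb in_setD1 => /andP[-> vt]; rewrite andbT; apply: contraTneq vt => ->; rewrite ie.
have [Eb|bE] := ltnP #|E|.-1 b.
  by apply: (guarded_surplus wD Nw); rewrite dw; apply: leq_ltn_trans (dE1 w wE) Eb.
have E4' : #|E| = 4 by move: E4 b3 bE; nlia.
have bE3 : b = 3 by move: b3 bE; rewrite E4'; nlia.
have [/exists_inP[v vB /exists_inP[v' v'B /subsetPn[c cv cv']]]|Lsub] :=
    boolP [exists v in E :\ x, [exists v' in E :\ x, ~~ (L v \subset L v')]].
  have [vE vD _ _] := B_mem v vB; have [v'E v'D _ _] := B_mem v' v'B.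
  apply: (guarded_color vD (Enc v vB) v'D _ cv cv'); apply: cpl => //.
  by apply: contraNneq cv' => <-.
have LS v : v \in E :\ x -> L v = L w.
  move=> vB; apply/eqP; rewrite eqEsubset.
  have /exists_inPn/(_ w wB) := exists_inPn Lsub v vB.
  by have /exists_inPn/(_ v vB) := exists_inPn Lsub w wB; rewrite !negbK => -> ->.
(* A vertex of [D'] that is no cut vertex of [D] has an outer neighbour by [free]. It is taken from
   an end block of [D'], away from [x], or is [x] itself if [D'] has no other vertex. *)
have aD' : adjs e (D :\: (E :\ x)) U.
  have xD : x \in D by apply: (subsetP ED).
  have xD' : x \in D :\: (E :\ x) by rewrite !inE eqxx xD.
  suff [y yD' ny] : exists2 y, y \in D :\: (E :\ x) & nsep e (D :\ y).
    have yD : y \in D by move: yD'; rewrite in_setD => /andP[].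
    have /set0Pn[t] := free y yD ny; rewrite in_nb => /andP[tU yt].
    by apply/adjsP; exists y, t.
  have cB : conn e (E :\ x) by apply: nsep_conn wB.
  have [E' [x' [[x'E' E'D' cE' nE'] [xE' cD'' Eout' Enc' E0'']]]] := end_block se cD' xD'.
  have [B0|/set0Pn[y yB]] := eqVneq (E' :\ x') set0.
    exists x => //; have D'x := E0'' B0.
    suff -> : D :\ x = E :\ x by apply: nE.
    apply/setP => v; rewrite !in_setD1; have [//|vx] := eqVneq v x; rewrite /=.
    apply/idP/idP => [vD|]; last exact: (subsetP ED).
    apply: contraT => vE; have : v \in [set x] by rewrite -D'x !inE vD (negPf vE) andbF.
    by rewrite inE (negPf vx).
  have yx : y != x by apply: contraNneq xE' => <-.
  have yD' : y \in D :\: (E :\ x) by have /setD1P[_ /(subsetP E'D')] := yB.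
  exists y => //.
  have yE : y \notin E by move: yD'; rewrite !inE yx /= => /andP[].
  have -> : D :\ y = (D :\: (E :\ x) :\ y) :|: (E :\ x).
    apply/setP => v; rewrite in_setU in_setD1 [v \in _ :\ y]in_setD1 in_setD.
    have [->|vy] := eqVneq v y; first by rewrite /= in_setD1 (negPf yE) andbF.
    have [vB|vB] := boolP (v \in E :\ x); last by rewrite orbF.
    by rewrite /= (subsetP ED) //; move: vB; rewrite inE => /andP[].
  have : conn e ((D :\: (E :\ x) :\ y) :|: (E :\ x)); last by case/andP.
  have xD'y : x \in D :\: (E :\ x) :\ y by rewrite in_setD1 xD' eq_sym yx.
  apply: connU => //; first exact: nsep_conn (Enc' y yB) xD'y.
  apply/orP; right; apply/adjsP; exists x, w; split=> //.
  by have /setD1P[wx _] := wB; apply: cpl; rewrite // eq_sym.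
apply: (guarded_quad xE ED E4' cpl Enc Eout cD' aD' LS bE3 bad0).
by have := fits_le G wD; rewrite bE3.
Qed.
End Step.

Theorem guarded_fits e D U L : fits e D U L -> guarded e D U L.
Proof.
have [n] := ubnP #|D|; elim: n e D U L => // n IH e D U L Dn G.
exact: (guarded_step IH Dn G).
Qed.
End Guard.

(** * The theorem *)

Section OddCycle.
Variables (V : finType) (e : rel V).
Hypotheses (se : symmetric e) (ie : irreflexive e).

(** The path is extended backwards as long as its first vertex has a neighbour off it. *)
Lemma closed_start x p : path e x p -> uniq (x :: p) ->
  exists x' p', [/\ path e x' p', uniq (x' :: p') & forall z, e x' z -> z \in p'].
Proof.
have [n] := ubnP (#|V| - size p); elim: n x p => // n IH x p pn xp up.
have [/forallP cl|] := boolP [forall z, e x z ==> (z \in p)].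
  by exists x, p; split=> // z; apply/implyP.
rewrite negb_forall => /existsP[z]; rewrite negb_imply => /andP[xz zp].
have up' : uniq (z :: x :: p).
  by rewrite cons_uniq up andbT in_cons negb_or zp andbT; apply: contraTneq xz => ->; rewrite ie.
apply: (IH z (x :: p)) => //=; last by rewrite se xz.
have := max_card (mem (z :: x :: p)); rewrite (card_uniqP up') /=; move: pn; clear; move: #|V| (size p) => m q; lia.
Qed.

Hypothesis deg2 : forall v, #|nb e setT v| = 2.
Hypothesis cV : conn e setT.

(** Both neighbours of the first vertex lie on a path that cannot be extended; the one that is not
    second closes a cycle. *)
Lemma cycle_exists : exists c : seq V, [/\ cycle e c, uniq c & 2 < size c].
Proof.
have /set0Pn[x0 _] : [set: V] != set0 by case/andP: cV.
have [x [p [xp up cl]]] := @closed_start x0 [::] isT isT.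
have [y] : exists y, y \in nb e setT x by apply/card_gt0P; rewrite deg2.
rewrite in_nb => /andP[_ xy]; have := cl y xy.
case: p xp up cl => [|h p] // xp up cl _.
have [z zN zh] := @card_other _ (nb e setT x) h ltac:(by rewrite deg2).
have xz : e x z by move: zN; rewrite in_nb => /andP[].
have := cl z xz; rewrite in_cons (negPf zh) /= => zp.
case/splitPr: zp xp up {cl} => p1 p2 xp up.
exists (x :: h :: rcons p1 z); split.
- rewrite /= rcons_path last_rcons (se z) xz andbT.
  move: xp; rewrite /= cat_path => /and3P[-> xp1 /andP[lz _]].
  by rewrite rcons_path xp1 lz.
- rewrite -cats1; move: up; rewrite -cat_rcons -!cat_cons cat_uniq => /andP[+ _].
  by rewrite cats1.
by rewrite /= size_rcons.
Qed.

Lemma next_neq_prev (c : seq V) v : uniq c -> 2 < size c -> v \in c -> next c v != prev c v.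
Proof.
move=> uc c3 vc; apply/eqP => nvp.
have nn : next c (next c v) = v by rewrite nvp next_prev.
have [i c' ci] := rot_to vc.
have uc' : uniq (v :: c') by rewrite -ci rot_uniq.
have s3 : 2 < size (v :: c') by rewrite -ci size_rot.
rewrite -!(next_rot i uc) ci in nn.
case: c' ci uc' s3 nn => [|a [|b c']] // _ /= /andP[].
rewrite !inE !negb_or => /and3P[va vb _] _ _; rewrite eqxx.
by rewrite eq_sym (negPf va) eqxx => bv; rewrite bv eqxx in vb.
Qed.

(** The two neighbours along the cycle exhaust the degree, so no edge leaves it, and connectedness
    makes it spanning. *)
Lemma cycle_adj (c : seq V) : cycle e c -> uniq c -> 2 < size c ->
  c =i V /\ forall x y, e x y = (y == next c x) || (x == next c y).
Proof.
move=> cc uc c3.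
have nbc v : v \in c -> nb e setT v = [set next c v; prev c v].
  move=> vc; apply: set2_card => //; rewrite ?in_nb ?inE /=.
  - exact: next_cycle.
  - by rewrite se; apply: prev_cycle.
  exact: next_neq_prev.
have all_c : c =i V.
  case/andP: cV => _ nV; suff cT : [set v in c] = setT.
    by move=> v; have := in_setT v; rewrite -cT inE => ->.
  apply/eqP; apply: contraT => cT; have := nsepP nV (subsetT _) _ cT.
  have -> : [set v in c] != set0.
    case: c c3 {cc uc nbc cT} => // a c _; apply/set0Pn; exists a.
    by rewrite inE mem_head.
  move=> /(_ isT) /adjsP[x [y [+ + xy]]]; rewrite !inE andbT => xc yc.
  have : y \in nb e setT x by rewrite in_nb inE.
  by rewrite nbc // !inE => /orP[]/eqP yE; rewrite yE ?mem_next ?mem_prev xc in yc.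
split=> // x y; have xc : x \in c by rewrite all_c.
have -> : e x y = (y \in nb e setT x) by rewrite in_nb inE.
rewrite nbc // !inE; congr (_ || _).
by apply/eqP/eqP => ->; rewrite ?next_prev ?prev_next.
Qed.

(** Even length is needed at the last vertex, where the index jumps from an odd number to 0. *)
Lemma odd_next (c : seq V) v : uniq c -> ~~ odd (size c) -> v \in c ->
  odd (index (next c v) c) = ~~ odd (index v c).
Proof.
case: c => // y p uc ev vc; rewrite next_nth vc.
have : index v (y :: p) < size (y :: p) by rewrite index_mem.
rewrite [X in _ < X]/= ltnS leq_eqVlt => /orP[/eqP iv|iv].
  rewrite nth_default ?iv // index_head; move: ev => /=.
  by rewrite negbK => ->.
have -> : nth y p (index v (y :: p)) = nth y (y :: p) (index v (y :: p)).+1 by [].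
by rewrite index_uniq.
Qed.

Lemma two_regular_odd (C : finType) (S : {set C}) : #|S| = 2 -> ~ col e setT (fun=> S) ->
  exists c : seq V, [/\ uniq c, c =i V, 3 <= size c, odd (size c) &
    forall x y, e x y = (y == next c x) || (x == next c y)].
Proof.
move=> S2 nS; have [c [cc uc c3]] := cycle_exists.
have [cV' ca] := cycle_adj cc uc c3.
exists c; split=> //; apply: contraT => ev; case: nS.
have /cards2P[a [b [ab ->]]] : #|S| == 2 by rewrite S2.
exists (fun v => if odd (index v c) then a else b); split=> [v _|x y _ _].
  by case: ifP; rewrite !inE eqxx ?orbT.
rewrite ca => /orP[]/eqP->; rewrite odd_next ?cV' //; case: (odd _) => //=.
  by rewrite eq_sym.
by rewrite eq_sym.
Qed.

End OddCycle.

(** * From components and induced subgraphs to cuts *)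

Section Connectivity.
Variables (V T : finType) (f : T -> V) (e : rel V).
Hypothesis fI : injective f.

Lemma nsep_preim (e' : rel T) (Y : {set T}) : (forall x y, e' x y = e (f x) (f y)) ->
  nsep e' Y = nsep e (f @: Y).
Proof.
move=> ee; apply/idP/idP => nY; apply: nsepI => X XY X0 XnY.
  have XE : X = f @: (f @^-1: X :&: Y).
    apply/setP => x; apply/idP/imsetP => [xX|[y]]; last by rewrite !inE => /andP[yX _] ->.
    have /imsetP[y yY xy] := subsetP XY x xX; exists y => //.
    by rewrite !inE -xy xX.
  have := nsepP nY (subsetIr (f @^-1: X) Y).
  have -> : f @^-1: X :&: Y != set0 by apply: contraNneq X0 => h; rewrite XE h imset0.
  have -> : f @^-1: X :&: Y != Y by apply: contraNneq XnY => h; rewrite XE h.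
  move=> /(_ isT isT) /adjsP[x [y [+ + xy]]]; rewrite !inE => /andP[xX _] /andP[yX yY].
  apply/adjsP; exists (f x), (f y); rewrite -ee !inE xX xy; split=> //.
  by move: yX; rewrite yY andbT => ->; rewrite imset_f.
have := nsepP nY (imsetS f XY).
have -> : f @: X != set0 by apply: contraNneq X0 => /eqP; rewrite imset_eq0.
have -> : f @: X != f @: Y by apply: contraNneq XnY => h; apply/eqP/(imset_inj fI).
move=> /(_ isT isT) /adjsP[x [y [/imsetP[x' x'X ->] + xy]]].
rewrite inE => /andP[+ /imsetP[y' y'Y yE]]; rewrite yE mem_imset // => y'X.
by apply/adjsP; exists x', y'; split=> //; [rewrite inE y'X|rewrite ee -yE].
Qed.

End Connectivity.

Lemma conn_connect (V : finType) (e : rel V) (A : {set V}) x y :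
  conn e A -> x \in A -> y \in A -> connect e x y.
Proof.
move=> cA xA yA; apply: contraT => nxy.
have := conn_rootP cA yA (X := [set z in A | connect e x z]); rewrite inE (negPf nxy) andbF.
have -> : [set z in A | connect e x z] \subset A by apply/subsetP => z; rewrite inE => /andP[].
have -> : [set z in A | connect e x z] != set0.
  by apply/set0Pn; exists x; rewrite inE xA connect0.
move=> /(_ isT isT isT) /adjsP[u [v [+ + uv]]]; rewrite !inE => /andP[uA xu] /andP[+ vA].
by rewrite vA /= (connect_trans xu (connect1 uv)).
Qed.

Lemma closed_connected (V : finType) (e : rel V) (A : {set V}) x y : symmetric e ->
  ~~ adjs e A (~: A) -> connect e x y -> x \in A -> y \in A.
Proof.
move=> se nA xy xA; rewrite -(closed_connect (a := mem A) _ xy) //.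
have half u v : e u v -> u \in A -> v \in A.
  move=> uv uA; apply: contraT => vA.
  by rewrite (adjsN nA uA) // in uv; rewrite inE.
by move=> u v uv; apply/idP/idP; apply: half => //; rewrite se.
Qed.

Section Bridge.
Variable G : sgraph.
Local Notation e := (@adj G).

Lemma component_class (x : G) : [set y in [set: G] | connect e x y] \in components G.
Proof. by apply/imsetP; exists x. Qed.

Lemma nsep_components : (#|components G| <= 1) = nsep e setT.
Proof.
apply/idP/idP => [c1|nG].
  apply: nsepI => X _ /set0Pn[x xX] XT; apply: contraT => nX.
  have /subsetPn[y _ yX] : ~~ (setT \subset X) by rewrite subTset.
  have := card_le1P c1 _ (component_class x) [set z in [set: G] | connect e y z].
  rewrite component_class => /esym/eqP yx.
  have : y \in [set z in [set: G] | connect e y z] by rewrite !inE connect0.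
  rewrite yx !inE /= => xy; case/negP: yX.
  by apply: (closed_connected (@adj_sym G) _ xy xX); rewrite -setTD.
apply/card_le1P => A /imsetP[x _ AE] B; apply/imsetP/eqP => [[y _ B_mem]|->]; last by exists x.
have cG (z : G) : conn e setT by exact: nsep_conn nG (in_setT z).
by rewrite AE B_mem; apply/setP => z; rewrite !inE !(conn_connect (cG x)) ?inE.
Qed.

Lemma connected_conn : connected G = conn e setT.
Proof.
rewrite /connected /conn -nsep_components eqn_leq andbC; congr (_ && _).
apply/idP/set0Pn => [/card_gt0P[A /imsetP[x _ _]]|[x _]]; first by exists x.
by apply/card_gt0P; exists [set y in [set: G] | connect e x y]; apply: component_class.
Qed.

End Bridge.

Lemma nsep_induced (G : sgraph) (A : {set G}) (Y : {set induced A}) :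
  nsep (@adj (induced A)) Y = nsep (@adj G) (val @: Y).
Proof. by apply: nsep_preim => //; apply: val_inj. Qed.

Lemma val_setT (G : sgraph) (A : {set G}) : val @: [set: induced A] = A.
Proof.
apply/setP => x; apply/imsetP/idP => [[y _ ->]|xA]; first exact: (valP y).
by exists (Sub x xA : induced A).
Qed.

Lemma connected_induced (G : sgraph) (A : {set G}) : connected (induced A) = conn (@adj G) A.
Proof.
rewrite connected_conn /conn nsep_induced val_setT; congr (_ && _).
by rewrite -[in RHS](val_setT A) imset_eq0.
Qed.

Lemma K5free_minor (G : sgraph) : K5_minor_free G -> K5free (@adj G) setT.
Proof.
move=> K s; apply/negP => /and3P[/eqP s5 sa sp]; apply: K.
exists (fun i : 'I_5 => nth set0 s i).
have lt5 (i : 'I_5) : i < size s by rewrite s5.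
have sP (i j : 'I_5) : i < j -> [disjoint nth set0 s i & nth set0 s j] &&
    adjs (@adj G) (nth set0 s i) (nth set0 s j).
  by move=> ij; apply: (pairwiseP set0 sp) => //; apply: lt5.
split=> [x|x y xy|x y].
- by rewrite connected_induced; have /andP[] := allP sa _ (mem_nth set0 (lt5 x)).
- case: (ltngtP x y) => [/sP/andP[]//|/sP/andP[+ _]|xy']; first by rewrite disjoint_sym.
  by case/eqP: xy; apply: val_inj.
rewrite /= => xy; case: (ltngtP x y) => [/sP/andP[_ /adjsP//]|/sP/andP[_ /adjsP[u [v [ux vy uv]]]]|xy'].
  by exists v, u; rewrite adj_sym.
by case/eqP: xy; apply: val_inj.
Qed.

(** By [residual_lists] the obstruction reaches every block; [g] unwraps the two nested subtypes in
    which a block lives. *)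
Lemma uncolorable_gallai (G : sgraph) (C : finType) (c0 : C) (L : G -> {set C}) (D : {set G}) :
  conn (@adj G) D -> (forall u, u \in D -> #|nb (@adj G) D u| <= #|L u|) ->
  ~ col (@adj G) D L -> gallai_tree (induced D).
Proof.
move=> cD dL nL B /maxsetp; set H := induced B => /andP[cH nH].
have cHT : conn (@adj H) setT by rewrite -connected_conn.
have nHz z : nsep (@adj H) (setT :\ z).
  have := forallP nH z; rewrite /cut_vertex (eqP cH) -leqNgt nsep_components.
  by rewrite nsep_induced val_setT setTD.
pose g (u : H) : G := val (val u).
have gI : injective g by move=> u v /val_inj/val_inj.
pose E := g @: setT.
have ED : E \subset D by apply/subsetP => _ /imsetP[u _ ->]; apply: (valP (val u)).
have E0 : E != set0 by rewrite imset_eq0; case/andP: cHT.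
have sG := @adj_sym G; have iG := @adj_irrefl G.
have [L' dL' nL'] := residual_lists c0 sG iG cD dL nL ED E0.
have [||cpl|[two [S S2 nS]]] := nonseparable_uncolorable c0 (@adj_sym H) (@adj_irrefl H) cHT nHz
    (L := fun u => L' (g u)).
- move=> u _; apply: leq_trans (dL' (g u) _); last by apply: imset_f.
  rewrite -(card_imset _ gI); apply/subset_leq_card/subsetP => _ /imsetP[v + ->].
  by rewrite !in_nb imset_f // inE.
- apply: contra_not nL' => -[phi [h1 h2]].
  pose psi v := if [pick u | g u == v] is Some u then phi u else c0.
  have psiE u : psi (g u) = phi u.
    by rewrite /psi; case: pickP => [w /eqP/gI->//|/(_ u)]; rewrite eqxx.
  exists psi; split=> [_ /imsetP[u _ ->]|_ _ /imsetP[u _ ->] /imsetP[v _ ->] uv].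
    by rewrite psiE; apply: h1; rewrite inE.
  by rewrite !psiE; apply: h2; rewrite ?inE.
- left=> x y; apply/idP/idP => [|xy]; last by apply: cpl; rewrite ?inE.
  by apply: contraTneq => ->; rewrite adj_irrefl.
right; apply: two_regular_odd S2 nS => //; [exact: adj_sym|exact: adj_irrefl|].
by move=> v; apply: two.
Qed.

Lemma ele_emin m (I : finType) (P : pred I) (F : I -> enat) i : P i ->
  ele (Some m) (\big[emin/None]_(j | P j) F j) -> ele (Some m) (F i).
Proof.
move=> Pi; rewrite (bigD1 i) //=; case: (F i) => [a|//].
by case: (\big[_/_]_(_ | _) _) => [b|//] /=; rewrite leq_min => /andP[].
Qed.

(* A walk [x - u - y] has length 2. *)
Lemma comp_dist_far (G : sgraph) (S D : {set G}) x y u : ele (Some 3) (comp_dist S) ->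
  D \subset S -> ~~ adjs (@adj G) D (S :\: D) -> u \notin S -> x \in D -> y \in S ->
  adj u x -> adj u y -> y \in D.
Proof.
(* With at most one component the distance is 0, against the bound 3. *)
rewrite /comp_dist; case: ifP => // _ far DS nD uS xD yS ux uy; apply: contraT => yD.
have xS := subsetP DS x xD.
pose x' : induced S := Sub x xS; pose y' : induced S := Sub y yS.
pose A := val @: [set z in [set: induced S] | connect (@adj (induced S)) x' z].
pose B := val @: [set z in [set: induced S] | connect (@adj (induced S)) y' z].
have AS : A \in components_in S by apply: imset_f; apply: component_class.
have BS : B \in components_in S by apply: imset_f; apply: component_class.
have xA : x \in A by apply/imsetP; exists x'; rewrite // !inE connect0.
have yB : y \in B by apply/imsetP; exists y'; rewrite // !inE connect0.
have AB : A != B.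
  apply/eqP => AB; move: yB; rewrite -AB => /imsetP[z]; rewrite !inE => /andP[_ xz] yz.
  have zy : z = y' by apply: val_inj.
  rewrite zy in xz; case/negP: yD.
  have := closed_connected (A := [set z : induced S | val z \in D]) (@adj_sym (induced S)) _ xz.
  rewrite !inE /=; apply=> //; apply/adjsP => -[s [t [+ + st]]]; rewrite !inE => sD tD.
  by case/adjsP: nD; exists (val s), (val t); rewrite inE tD (valP t).
have {}far := ele_emin AS far.
have {}far := ele_emin (P := fun B => (B \in components_in S) && (A != B)) (i := B) _ far.
have {far} : ele (Some 3) (set_dist A B) by apply: far; rewrite BS.
rewrite /set_dist => /(ele_emin xA)/(ele_emin yB).
(* [dist] ranges over lengths below [#|G|], so length 2 counts only in a graph with three
   vertices. *)
have G3 : 2 < #|G|.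
  rewrite -cardsT; apply/card_gt2P; exists x, u, y; rewrite !inE; split=> //; split.
  - by apply: contraNneq uS => <-.
  - by apply: contraNneq uS => ->.
  by apply: contraNneq yD => ->.
rewrite /dist => dist3; suff : ele (Some 3) (Some (nat_of_ord (Ordinal G3))) by [].
apply: (ele_emin _ dist3).
by apply/existsP; exists [tuple u; y]; rewrite /= adj_sym ux uy eqxx.
Qed.

Lemma isolated_gallai (G : sgraph) (v : G) : gallai_tree (induced [set v]).
Proof.
move=> B _; left=> x y; suff -> : x = y by rewrite adj_irrefl eqxx.
apply: val_inj; apply: val_inj.
by have /set1P-> := valP (val x); have /set1P-> := valP (val y).
Qed.

Lemma closed_component (G : sgraph) (D : {set G}) : conn (@adj G) D ->
  ~~ adjs (@adj G) D (~: D) -> D \in components G.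
Proof.
move=> cD nD; have /set0Pn[x xD] : D != set0 by case/andP: cD.
suff -> : D = [set y in [set: G] | connect (@adj G) x y] by apply: component_class.
apply/setP => y; rewrite !inE /=; apply/idP/idP => [yD|xy]; first exact: conn_connect cD xD yD.
exact: (closed_connected (@adj_sym G) nD xy xD).
Qed.

(** * Assembling the guards of all small components *)

Section Main.
Variables (k : nat) (G : sgraph) (C : finType) (L : G -> {set C}) (c0 : C).
Local Notation e := (@adj G).
Local Notation S := (small_vertices G k).
Hypothesis k8 : 8 <= k.
Hypothesis K : K5free e setT.
Hypothesis far : ele (Some 3) (comp_dist S).
Hypothesis notG : forall D : {set G}, D \in components G -> ~ gallai_tree (induced D).
Hypothesis cardL : forall v, #|L v| = minn (deg v) k.

Let se : symmetric e := @adj_sym G.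
Let ie : irreflexive e := @adj_irrefl G.

Lemma in_small v : (v \in S) = (deg v < k).
Proof. by rewrite inE. Qed.

Lemma degE v : deg v = #|nb e setT v|.
Proof. by apply: eq_card => u; rewrite !inE. Qed.

(** In [S] a list has the size of the full degree, which is at most k - 1. Without outer neighbours
    [D] is a component of [G]; it is not a Gallai tree and needs no guard. *)
Lemma guard_component (D : {set G}) : conn e D -> D \subset S -> ~~ adjs e D (S :\: D) ->
  guarded (k - 5) e D (~: S) L.
Proof.
move=> cD DS nD.
have DLe w : w \in D -> #|nb e D w| + #|nb e (~: S) w| <= #|L w|.
  move=> wD; have := subsetP DS w wD; rewrite in_small cardL => wk.
  rewrite (minn_idPl (ltnW wk)) degE (nb_split _ _ (subsetT D)) leq_add2l.
  apply/subset_leq_card/nb_sub/subsetP => u; rewrite !inE andbT.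
  by apply: contraNN => uD; have := subsetP DS u uD; rewrite inE.
have [aD|naD] := boolP (adjs e D (~: S)).
  apply: guarded_fits => //; first by move: k8; clear; lia.
  split=> //.
  - by apply: K5free_sub K; rewrite ?subsetT.
  - by rewrite disjoint_sym disjoints_subset setCS.
  move=> w wD; have := subsetP DS w wD; rewrite in_small cardL; move: k8.
  by move: (deg w); clear; lia.
have nU w : w \in D -> nb e (~: S) w = set0.
  move=> wD; apply/setP => u; rewrite in_nb in_set0; apply/negP => /andP[uS wu].
  by rewrite (adjsN naD wD uS) in wu.
exists (fun=> set0); split=> [u|u|phi _]; rewrite ?cards0 ?eqxx //.
have DC : D \in components G.
  apply: closed_component => //; apply/adjsP => -[w [u [wD uD wu]]].
  have [uS|uS] := boolP (u \in S); first by rewrite (adjsN nD wD) // in wu; rewrite inE uS andbT -in_setC.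
  by rewrite (adjsN naD wD) // in wu; rewrite in_setC.
apply: NNPP => nc; case: (notG DC); apply: (uncolorable_gallai c0 (L := L)) => //.
  by move=> u uD; apply: leq_trans (DLe u uD); apply: leq_addr.
apply: contra_not nc; apply: col_sub => // w wD.
by rewrite /rest nU // imset0 setD0.
Qed.

(** Components are split off one at a time. By [comp_dist_far] no outer vertex is adjacent to two of
    them, so the guards have disjoint supports and their sizes do not add up. *)
Lemma guard_closed (X : {set G}) : X \subset S -> ~~ adjs e X (S :\: X) -> guarded (k - 5) e X (~: S) L.
Proof.
have [n] := ubnP #|X|; elim: n X => // n IH X Xn XS nX.
have [->|/set0Pn[x xX]] := eqVneq X set0.
  exists (fun=> set0); split=> [u|u|phi _]; rewrite ?cards0 ?eqxx //.
  by exists (fun=> c0); split=> [v|u v]; rewrite inE.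
have [D [xD DX cD nDX]] := compP se xX.
have DS := subset_trans DX XS.
have nD : ~~ adjs e D (S :\: D).
  apply/adjsP => -[w [u [wD /setDP[uS uD] wu]]].
  have [uX|uX] := boolP (u \in X); first by rewrite (adjsN nDX wD) // in wu; rewrite inE uD.
  by rewrite (adjsN nX (subsetP DX w wD)) // in wu; rewrite inE uX.
have nXD : ~~ adjs e (X :\: D) (S :\: (X :\: D)).
  apply/adjsP => -[w [u [wXD /setDP[uS uXD] wu]]].
  have [wX wD] := setDP wXD.
  have [uX|uX] := boolP (u \in X); last by rewrite (adjsN nX wX) // in wu; rewrite inE uX.
  have uD : u \in D by apply: contraNT uXD => uD; rewrite inE uD.
  by rewrite se (adjsN nDX uD wXD) in wu.
have [F1 [a1 b1 c1]] := guard_component cD DS nD.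
have [||F2 [a2 b2 c2]] := IH (X :\: D) _ _ nXD.
- have := cardsID D X; rewrite (setIidPr DX); have : 0 < #|D| by apply/card_gt0P; exists x.
  by move: Xn; nlia.
- exact: subset_trans (subsetDl _ _) XS.
have F12 u : F1 u != set0 -> F2 u = set0.
  move=> /b1[uS /adjsP[y [u1 [yD /set1P-> yu]]]]; apply/eqP; apply: contraT.
  move=> /b2[_ /adjsP[z [u2 [/setDP[zX zD] /set1P-> zu]]]].
  case/negP: zD; rewrite in_setC in uS.
  by apply: (comp_dist_far far DS nD uS yD); rewrite 1?(subsetP XS) // se.
exists (fun u => if F1 u == set0 then F2 u else F1 u); split.
- by move=> u; case: ifP.
- move=> u; case: ifPn => [_ /b2[uS aD]|_ /b1[uS aD]]; split=> //.
    by apply: adjs_sub aD => //; apply: subsetDl.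
  exact: adjs_sub aD.
move=> phi h; have [|g1 [h1 k1]] := c1 phi.
  by move=> u uS; have := h u uS; case: ifPn => [/eqP->|//]; rewrite inE.
have [|g2 [h2 k2]] := c2 phi.
  by move=> u uS; have := h u uS; case: ifPn => [//|/F12->]; rewrite inE.
exists (fun v => if v \in D then g1 v else g2 v); split=> [v vX|v w vX wX vw].
  by case: ifPn => vD; [apply: h1|apply: h2; rewrite inE vD].
case: ifPn => vD; case: ifPn => wD.
- exact: k1.
- by rewrite (adjsN nDX vD) // in vw; rewrite inE wD.
- by rewrite se (adjsN nDX wD) // in vw; rewrite inE vD.
by apply: k2; rewrite // inE ?vD ?wD.
Qed.

Lemma all_colored : list_colorable L.
Proof.
have [|F [F1 F2 F3]] := @guard_closed S (subxx _).
  by rewrite setDv; apply/adjsP => -[a [b [_]]]; rewrite inE.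
(* Outside [S] the lists have k colours and lose at most k - 5, so 5 remain. *)
have [|phi [h1 h2]] := @K5free_choosable _ _ c0 e (~: S) (fun v => L v :\: F v) se ie
    (K5free_sub (subsetT _) (fun _ _ _ _ h => h) K).
  move=> v; rewrite in_setC in_small -leqNgt => vk.
  have := card_setD_ge (L v) (F v); have := F1 v; rewrite cardL (minn_idPr vk).
  by move: k8; nlia.
have [u uS|psi [g1 g2]] := F3 phi.
  by have := h1 u uS; rewrite inE => /andP[].
have cross u v : u \in S -> v \notin S -> e u v -> psi u != phi v.
  move=> uS vS uv; have := g1 u uS; rewrite inE => /andP[+ _].
  by apply: contraNneq => ->; apply: imset_f; rewrite in_nb in_setC vS.
exists (fun v => if v \in S then psi v else phi v); split=> [v|u v uv].
  case: ifPn => vS; first by have := g1 v vS; rewrite inE => /andP[].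
  by have := h1 v; rewrite in_setC => /(_ vS); rewrite inE => /andP[].
case: ifPn => uS; case: ifPn => vS.
- exact: g2.
- exact: cross.
- by rewrite eq_sym; apply: cross; rewrite // se.
by apply: h2; rewrite ?in_setC.
Qed.

End Main.

Theorem theorem7 (k : nat) (G : sgraph) :
  8 <= k ->
  K5_minor_free G ->
  ele (Some 3) (comp_dist (small_vertices G k)) ->
  (forall C : {set G}, C \in components G -> ~ gallai_tree (induced C)) ->
  f_list_colorable (fun v : G => minn (deg v) k).
Proof.
move=> k8 K far notG C L cardL.
(* A default colour is taken from the list of some vertex; an empty list would mean an isolated
   vertex, whose component is a Gallai tree. The null graph has no vertex and is settled
   separately. *)
have [v _|no] := pickP (@predT G); last first.
  by exists (fun v => False_rect C (notF (esym (no v)))); split=> v; have := no v.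
have /card_gt0P[c0 _] : 0 < #|L v|.
  rewrite cardL leq_min (leq_trans _ k8) // andbT lt0n; apply/eqP => d0.
  apply: (notG [set v]); last exact: isolated_gallai.
  apply: closed_component; first exact: conn1.
  apply/adjsP => -[w [u [/set1P-> _ vu]]].
  by have := in_set0 u; rewrite -(cards0_eq d0) inE vu.
exact: (all_colored c0 k8 (K5free_minor K) far notG cardL).
Qed.
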